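(* Let $(V,\phi)$ and $M$ be as in the context (assumptions (A1), (A2), (H1)–(H3)). Let $\overline U(t,\mu)=\langle\mu(dy),V(t,y,\mu)\rangle$. Then the function $$U(t,x,\mu)=V(t,x,\mu)+M(t,\mu)+\langle\mu(dy),\delta_\mu V(t,y,\mu;x)-\delta_\mu V(t,y,\mu;y)\rangle,\quad (t,x,\mu)\in[0,T]\times\mathbb R^n\times\mathcal P_2(\mathbb R^n),$$ is a solution of the equation $$\begin{aligned}0=&\ \partial_tU(t,x,\mu)+U_x(t,x,\mu)f^*(t,x,\mu)+\tfrac12{\rm Tr}[U_{xx}(t,x,\mu)(\Sigma+\Sigma_0)]+L^*(t,x,\mu)\\ &+\langle\mu(dy),\partial_y\delta_\mu U(t,x,\mu;y)f^*(t,y,\mu)\rangle+\tfrac12\langle\mu(dy),{\rm Tr}[\partial_y^2\delta_\mu U(t,x,\mu;y)(\Sigma+\Sigma_0)]\rangle\\ &+\langle\mu(dy),{\rm Tr}[\partial_{xy}\delta_\mu U(t,x,\mu;y)\Sigma_0]\rangle+\tfrac12\langle\mu^{\otimes2}(dydz),{\rm Tr}[\partial_{yz}\delta_{\mu\mu}U(t,x,\mu;y,z)\Sigma_0]\rangle\\ &+\langle\mu(dy),\delta_\mu L^*(t,y,\mu;x)-\delta_\mu L^*(t,y,\mu;y)\rangle\\ &+\langle\mu(dy),\partial_y\delta_\mu\overline U(t,\mu;y)[\delta_\mu f^*(t,y,\mu;x)-\delta_\mu f^*(t,y,\mu;y)]\rangle\\ &+\tfrac12\langle\mu(dy),{\rm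 Tr}\{[\partial_{yz}\delta_{\mu\mu}\overline U(t,\mu;y,z)]|_{z=y}\Sigma\}\rangle\end{aligned}$$ on $[0,T]\times\mathbb R^n\times\mathcal P_2(\mathbb R^n)$ with terminal condition $$U(T,x,\mu)=g(x,\mu)+\langle\mu(dy),\delta_\mu g(y,\mu;x)-\delta_\mu g(y,\mu;y)\rangle.$$
   Context: **Notation.** $T>0$ is fixed; $|\cdot|$ is the Frobenius norm. $\mathcal P_2(\mathbb R^n)$ is the set of Borel probability measures on $\mathbb R^n$ with finite second moment, with the Wasserstein distance $W_2$. $\langle\mu,\psi\rangle=\langle\psi\rangle_\mu=\langle\mu(dy),\psi(y)\rangle=\int\psi\,d\mu$; in particular $\langle|y|\rangle_\mu=\int|y|\mu(dy)$. $\partial_x\psi=\psi_x$ is a row vector, $\partial_x^2\psi=\psi_{xx}$ the Hessian, $\partial_{xy}\psi=(\partial_{x_i}\partial_{y_j}\psi)_{i,j}$. For a function $F(\mu)$ (other arguments held fixed), $\delta_\mu F(\mu;y)$ is the function with $\lim_{\epsilon\downarrow0}\epsilon^{-1}[F(\mu+\epsilon(\nu-\mu))-F(\mu)]=\int\delta_\mu F(\mu;y)(\nu-\mu)(dy)$ for all $\nu\in\mathcal P_2(\mathbb R^n)$, normalized by $\int\delta_\mu F(\mu;y)\mu(dy)=0$; $\delta_{\mu\mu}F(\mu;y,z)$ is the derivative of $\mu\mapsto\delta_\mu F(\mu;y)$ with new variable $z$, and $\delta_{\mu\mu\mu}F(\mu;y,z,w)$ is defined similarly (componentwise for vector-valued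 $F$). Partial derivatives refer to the variables as they actually appear, e.g. $\partial_x\delta_\mu V(t,y,\mu;x)$ differentiates in the variable after the semicolon. A function has quadratic (resp. linear) growth if its norm is at most $C_a(1+\sum|\cdot|^2+\langle|y|\rangle_\mu^2)$ (resp. $C_a(1+\sum|\cdot|+\langle|y|\rangle_\mu)$), the sum being over all its $\mathbb R^n$-valued arguments, for some constant $C_a$. **Data.** $\mathbb U\subset\mathbb R^{n_1}$ is nonempty and closed; $\sigma\in\mathbb R^{n\times n_2}$, $\sigma_0\in\mathbb R^{n\times n_3}$ are constant, $\Sigma=\sigma\sigma^T$, $\Sigma_0=\sigma_0\sigma_0^T$. (A1) $f:\mathbb R^n\times\mathbb U\times\mathcal P_2(\mathbb R^n)\to\mathbb R^n$ is continuous, Lipschitz in $(x,\mu)$ uniformly in $u$, and $|f(x,u,\mu)|\le C_a(1+|x|+|u|+\langle|y|\rangle_\mu)$. (A2) $L:\mathbb R^n\times\mathbb U\times\mathcal P_2(\mathbb R^n)\to\mathbb R_+$ and $g:\mathbb R^n\times\mathcal P_2(\mathbb R^n)\to\mathbb R_+$ are continuous and $L(x,u,\mu),g(x,\mu)\le C_a(1+|x|^2+|u|^2+\langle|y|\rangle_\mu^2)$. Given $\phi:[0,T]\times\mathbb R^n\times\mathcal P_2(\mathbb R^n)\to\mathbb U$ put $f^*(t,x,\mu)=f(x,\phi(t,x,\mu),\mu)$, $L^*(t,x,\mu)=L(x,\phi(t,x,\mu),\mu)$ and, for a function $F(t,x,\mu)$, $$\begin{aligned}\mathcal LF(t,x,\mu)=&\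 \partial_tF+F_x f^*(t,x,\mu)+\tfrac12{\rm Tr}[F_{xx}(\Sigma+\Sigma_0)]+\langle\mu(dy),\partial_y\delta_\mu F(t,x,\mu;y)f^*(t,y,\mu)\rangle\\&+\tfrac12\langle\mu(dy),{\rm Tr}[\partial_y^2\delta_\mu F(t,x,\mu;y)(\Sigma+\Sigma_0)]\rangle+\langle\mu(dy),{\rm Tr}[\partial_{xy}\delta_\mu F(t,x,\mu;y)\Sigma_0]\rangle\\&+\tfrac12\langle\mu^{\otimes2}(dydz),{\rm Tr}[\partial_{yz}\delta_{\mu\mu}F(t,x,\mu;y,z)\Sigma_0]\rangle\end{aligned}$$ (terms with $x$-derivatives vanish if $F$ does not depend on $x$). **(H1)** There is a pair $(V,\phi)$, $V:[0,T]\times\mathbb R^n\times\mathcal P_2(\mathbb R^n)\to\mathbb R$, $\phi:[0,T]\times\mathbb R^n\times\mathcal P_2(\mathbb R^n)\to\mathbb U$, such that: (a) $\mathcal LV+L^*=0$ on $[0,T]\times\mathbb R^n\times\mathcal P_2(\mathbb R^n)$, $V(T,x,\mu)=g(x,\mu)$, and for all $(t,x,\mu)$ the point $\phi(t,x,\mu)$ minimizes over $u\in\mathbb U$ the function $[V_x(t,x,\mu)+\langle\mu(dy),\partial_x\delta_\mu V(t,y,\mu;x)\rangle]f(x,u,\mu)+L(x,u,\mu)$; (b) $\phi$ is continuous and of linear growth; (c) writing $\delta_\mu V=\delta_\mu V(t,x,\mu;y)$, $\delta_{\mu\mu}V=\delta_{\mu\mu}V(t,x,\mu;y,z)$, $\delta_{\mu\mu\mu}V=\delta_{\mu\mu\mu}V(t,x,\mu;y,z,w)$,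 the functions $V$, $\partial_tV$, $V_x$, $V_{xx}$, $\delta_\mu V$, $\partial_t\delta_\mu V$, $\partial_x\delta_\mu V$, $\partial_x^2\delta_\mu V$, $\partial_y\delta_\mu V$, $\partial_y^2\delta_\mu V$, $\partial_{xy}\delta_\mu V$, $\delta_{\mu\mu}V$, $\partial_x\delta_{\mu\mu}V$, $\partial_y\delta_{\mu\mu}V$, $\partial_y^2\delta_{\mu\mu}V$, $\partial_{xy}\delta_{\mu\mu}V$, $\partial_{yz}\delta_{\mu\mu}V$, $\delta_{\mu\mu\mu}V$, $\partial_y\delta_{\mu\mu\mu}V$, $\partial_{yz}\delta_{\mu\mu\mu}V$ exist and are jointly continuous; (d) $V,\delta_\mu V,\delta_{\mu\mu}V,\partial_t\delta_\mu V,\delta_{\mu\mu\mu}V$ have quadratic growth; $V_x,\partial_y\delta_\mu V,\partial_x\delta_\mu V,\partial_y\delta_{\mu\mu}V,\partial_y\delta_{\mu\mu\mu}V$ have linear growth; $V_{xx},\partial_y^2\delta_\mu V,\partial_{xy}\delta_\mu V,\partial_x^2\delta_\mu V,\partial_{yz}\delta_{\mu\mu}V,\partial_y^2\delta_{\mu\mu}V,\partial_{xy}\delta_{\mu\mu}V,\partial_{yz}\delta_{\mu\mu\mu}V$ are bounded. **(H2)** $\delta_\mu f^*,\delta_{\mu\mu}f^*$ exist, are jointly continuous and have linear growth; $\delta_\mu L^*,\delta_{\mu\mu}L^*,\delta_\mu g,\delta_{\mu\mu}g$ exist, are jointly continuous and have quadratic growth. **(H3)** There is $M:[0,T]\times\mathcal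 P_2(\mathbb R^n)\to\mathbb R$ with $M(T,\mu)=0$ and $$\mathcal LM+\langle\mu^{\otimes2}(dydz),\partial_y\delta_\mu V(t,z,\mu;y)[\delta_\mu f^*(t,y,\mu;z)-\delta_\mu f^*(t,y,\mu;y)]\rangle+\tfrac12\langle\mu^{\otimes2}(dydw),{\rm Tr}\{[\partial_{yz}\delta_{\mu\mu}V(t,w,\mu;y,z)]|_{z=y}\Sigma\}\rangle=0,$$ such that $M,\partial_tM,\delta_\mu M,\delta_{\mu\mu}M,\partial_y\delta_\mu M,\partial_y^2\delta_\mu M,\partial_{yz}\delta_{\mu\mu}M$ are jointly continuous, $|\delta_\mu M(t,\mu;y)|,|\delta_{\mu\mu}M(t,\mu;y,z)|\le C_a(1+|y|^2+|z|^2+\langle|y|^2\rangle_\mu)$, $\partial_y\delta_\mu M$ has linear growth, and $\partial_y^2\delta_\mu M$, $\partial_{yz}\delta_{\mu\mu}M$ are bounded. *)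

(* Defs.v *)
From HB Require Import structures.
From mathcomp Require Import all_boot all_order all_algebra.
From mathcomp Require Import all_classical all_reals all_analysis.
From mathcomp Require Import measurable_realfun.

Set Implicit Arguments.
Unset Strict Implicit.
Unset Printing Implicit Defensive.

Import Order.TTheory GRing.Theory Num.Theory.
Import numFieldTopology.Exports numFieldNormedType.Exports.

Local Open Scope classical_set_scope.
Local Open Scope ring_scope.

(* Frobenius norm; on column vectors it is the Euclidean norm.  The norm `|A|
   of the library is the sup norm, which induces the same topology. *)
Definition fnorm (R : realType) (p q : nat) (A : 'M[R]_(p, q)) : R :=
  Num.sqrt (\sum_i \sum_j A i j ^+ 2).

HB.instance Definition _ (R : realType) (p q : nat) :=
  Measurable.copy 'M[R]_(p, q) (g_sigma_algebraType (@open 'M[R]_(p, q))).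

Section borel_lemmas.
Context {R : realType} {p q : nat}.
Local Notation E := 'M[R]_(p, q).

Lemma continuous_borel (h : E -> R) : continuous h -> measurable_fun setT h.
Proof.
move=> /continuousP ch.
apply: (measurability _ (RGenOpens.measurableE R)).
move=> _ [_ [a [b ->] <-]]; rewrite setTI; apply: sub_sigma_algebra.
by apply: ch; exact: interval_open.
Qed.

Lemma continuous_fnorm : continuous (@fnorm R p q).
Proof.
move=> A; apply: continuous_comp; last exact: sqrt_continuous.
move: A; apply: continuous_big => [|i _]; first exact: add_continuous.
apply: continuous_big => [|j _ A]; first exact: add_continuous.
by under eq_fun do rewrite expr2; apply: continuousM; exact: coord_continuous.
Qed.

Lemma measurable_fnorm2 : measurable_fun setT (fun x : E => (fnorm x ^+ 2)%:E).
Proof.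
apply/measurable_EFinP; apply: continuous_borel => A.
by under eq_fun do rewrite expr2; apply: continuousM; exact: continuous_fnorm.
Qed.

End borel_lemmas.

Record P2 (R : realType) (n : nat) := MkP2 {
  p2prob :> probability 'cV[R]_n R ;
  p2moment : (\int[p2prob]_x (fnorm x ^+ 2)%:E < +oo)%E }.

HB.instance Definition _ (R : realType) (n : nat) := gen_eqMixin (P2 R n).
HB.instance Definition _ (R : realType) (n : nat) := gen_choiceMixin (P2 R n).

Section wasserstein.
Context {R : realType} {n : nat}.
Local Notation E := 'cV[R]_n.
Implicit Types mu nu : P2 R n.

Definition coupling mu nu : set (probability (E * E)%type R) :=
  [set pi | forall A : set E, measurable A ->
     pi (A `*` setT) = mu A /\ pi (setT `*` A) = nu A].

Definition W2 mu nu : R :=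
  Num.sqrt (fine (ereal_inf
    [set (\int[pi]_z (fnorm (z.1 - z.2) ^+ 2)%:E)%E
       | pi in coupling mu nu])).

(* W2 is a metric, so these are the open sets of its metric topology; defining
   the topology this way does not require the triangle inequality for W2. *)
Definition W2_open (O : set (P2 R n)) : Prop :=
  forall mu, O mu -> exists2 e : R, 0 < e & forall nu, W2 mu nu < e -> O nu.

Lemma W2_openT : W2_open setT.
Proof. by move=> mu _; exists 1. Qed.

Lemma W2_openI : setI_closed W2_open.
Proof.
move=> A B oA oB mu [/oA[a a0 Aa] /oB[b b0 Bb]].
exists (Num.min a b); first by rewrite lt_min a0.
by move=> nu; rewrite lt_min => /andP[/Aa ? /Bb].
Qed.

Lemma W2_open_bigU (I : Type) (f : I -> set (P2 R n)) :
  (forall i, W2_open (f i)) -> W2_open (\bigcup_i f i).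
Proof.
move=> of_ mu [i _ /(of_ i)[e e0 fe]].
by exists e => // nu /fe ?; exists i.
Qed.

HB.instance Definition _ :=
  isOpenTopological.Build (P2 R n) W2_openT W2_openI W2_open_bigU.

End wasserstein.

Section mixture.
Context {R : realType} {n : nat}.
Local Notation E := 'cV[R]_n.
Implicit Types (mu nu : P2 R n) (e : R).

(* Truncation to [0, 1], so that mix e mu nu below is defined for every real e;
   only 0 <= e <= 1 matters. *)
Definition clip01 e : R := Num.max 0 (Num.min 1 e).

Lemma clip01_ge0 e : 0 <= clip01 e.
Proof. by rewrite /clip01 le_max lexx. Qed.

Lemma clip01_le1 e : 0 <= 1 - clip01 e.
Proof. by rewrite subr_ge0 /clip01 ge_max ler01 ge_min lexx. Qed.

Definition mix_measure e mu nu : set E -> \bar R :=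
  measure_add (mscale (NngNum (clip01_le1 e)) mu)
              (mscale (NngNum (clip01_ge0 e)) nu).

HB.instance Definition _ e mu nu := Measure.on (mix_measure e mu nu).

Lemma mix_measure_setT e mu nu : mix_measure e mu nu setT = 1%E.
Proof.
rewrite /mix_measure measure_addE /= /mscale /= !probability_setT !mule1.
by rewrite -EFinD subrK.
Qed.

HB.instance Definition _ e mu nu :=
  @Measure_isProbability.Build _ _ R (mix_measure e mu nu)
    (mix_measure_setT e mu nu).

Lemma mix_moment e mu nu :
  (\int[mix_measure e mu nu]_x (fnorm x ^+ 2)%:E < +oo)%E.
Proof.
have m2 := @measurable_fnorm2 R n 1.
have ge0 x : setT x -> (0 <= (fnorm (x : E) ^+ 2)%:E)%E.
  by rewrite lee_fin sqr_ge0.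
rewrite /mix_measure ge0_integral_measure_add// !ge0_integral_mscale//=.
rewrite lte_add_pinfty// lte_mul_pinfty// ?p2moment// lee_fin.
- exact: clip01_le1.
- exact: clip01_ge0.
Qed.

(* mu + e (nu - mu) *)
Definition mix e mu nu : P2 R n := MkP2 (@mix_moment e mu nu).

Lemma mixE e mu nu (A : set E) : 0 <= e <= 1 ->
  mix e mu nu A = ((1 - e)%:E * mu A + e%:E * nu A)%E.
Proof.
move=> /andP[e0 e1]; rewrite /= /mix_measure measure_addE /= /mscale /=.
by rewrite /clip01 (min_r e1) (max_r e0).
Qed.

End mixture.

Section calculus.
Context {R : realType} {n : nat}.
Local Notation E := 'cV[R]_n.
Implicit Types (mu nu : P2 R n) (x y z : E).

(* D is the function delta_mu F(mu; .).  Integrability against every nu is what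
   gives a meaning to the integral of D against nu - mu. *)
Definition is_lfd (F : P2 R n -> R) mu (D : E -> R) : Prop :=
  [/\ forall nu, (p2prob nu).-integrable setT (EFin \o D),
      forall nu, e^-1 * (F (mix e mu nu) - F mu) @[e --> 0^'+] -->
        \int[nu]_y D y - \int[mu]_y D y
    & \int[mu]_y D y = 0].

Definition lfd_ex (F : P2 R n -> R) mu : Prop := exists D, is_lfd F mu D.

(* delta_mu F(mu; y), a junk value if the derivative does not exist. *)
Definition lfd (F : P2 R n -> R) mu : E -> R :=
  xget (fun=> 0) [set D | is_lfd F mu D].

(* delta_{mu mu} F(mu; y, z) and delta_{mu mu mu} F(mu; y, z, w). *)
Definition lfd2 (F : P2 R n -> R) mu y : E -> R :=
  lfd (fun m => lfd F m y) mu.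
Definition lfd3 (F : P2 R n -> R) mu y z : E -> R :=
  lfd (fun m => lfd2 F m y z) mu.

Definition lfd2_ex (F : P2 R n -> R) mu : Prop :=
  forall y, lfd_ex (fun m => lfd F m y) mu.
Definition lfd3_ex (F : P2 R n -> R) mu : Prop :=
  forall y z, lfd_ex (fun m => lfd2 F m y z) mu.

(* Componentwise versions for vector-valued functions. *)
Definition vlfd (F : P2 R n -> E) mu y : E :=
  \col_i lfd (fun m => F m i 0) mu y.
Definition vlfd2 (F : P2 R n -> E) mu y z : E :=
  \col_i lfd2 (fun m => F m i 0) mu y z.
Definition vlfd_ex (F : P2 R n -> E) mu : Prop :=
  forall i, lfd_ex (fun m => F m i 0) mu.
Definition vlfd2_ex (F : P2 R n -> E) mu : Prop :=
  forall i, lfd2_ex (fun m => F m i 0) mu.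

Definition basis (i : 'I_n) : E := delta_mx i 0.

Definition grad (h : E -> R) x : 'rV[R]_n := \row_i 'D_(basis i) h x.

Definition hess (h : E -> R) x : 'M[R]_n :=
  \matrix_(i, j) 'D_(basis i) ('D_(basis j) h) x.

(* entry (i, j) is d/dx_i d/dy_j h *)
Definition cross (h : E -> E -> R) x y : 'M[R]_n :=
  \matrix_(i, j) 'D_(basis i) (fun x' => 'D_(basis j) (h x') y) x.

Definition grad_ex (h : E -> R) : Prop :=
  forall x i, derivable h x (basis i).

Definition hess_ex (h : E -> R) : Prop :=
  grad_ex h /\ forall j, grad_ex ('D_(basis j) h).

Definition cross_ex (h : E -> E -> R) : Prop :=
  (forall x, grad_ex (h x)) /\
  forall j y, grad_ex (fun x => 'D_(basis j) (h x) y).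

(* row vector times column vector *)
Definition rowapp (r : 'rV[R]_n) (v : E) : R := (r *m v) 0 0.

Definition mean mu : R := \int[mu]_y fnorm y.
Definition moment2 mu : R := \int[mu]_y fnorm y ^+ 2.

(* Upper bounds for quadratic and linear growth; xs lists the R^n-valued
   arguments. *)
Definition quad (C : R) (xs : seq E) mu : R :=
  C * (1 + \sum_(x <- xs) fnorm x ^+ 2 + mean mu ^+ 2).
Definition lin (C : R) (xs : seq E) mu : R :=
  C * (1 + \sum_(x <- xs) fnorm x + mean mu).

(* Derivative of a function of time on [0, T], one-sided at 0 and T. *)
Definition dt (T : R) (h : R -> R) (t : R) : R :=
  lim ((h s - h t) / (s - t) @[s --> within `[0, T] t^']).
Definition dt_ex (T : R) (h : R -> R) (t : R) : Prop :=
  cvg ((h s - h t) / (s - t) @[s --> within `[0, T] t^']).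

(* Joint continuity on [0, T] * X * P_2(R^n). *)
Definition jcont (T : R) (X Y : topologicalType) (F : R -> X -> P2 R n -> Y) :
    Prop :=
  {within [set a : R * X * P2 R n | 0 <= a.1.1 <= T],
    continuous (fun a => F a.1.1 a.1.2 a.2)}.

End calculus.

Section equations.
Context {R : realType} {n : nat}.
Local Notation E := 'cV[R]_n.
Local Notation P := (P2 R n).
Variables (T : R) (fs : R -> E -> P -> E) (Sigma Sigma0 : 'M[R]_n).
Variable F : R -> E -> P -> R.

(* The second-order operator generated by the closed-loop drift fs = f*. *)
Definition Lop t x mu : R :=
  dt T (fun s => F s x mu) t
  + rowapp (grad (fun x' => F t x' mu) x) (fs t x mu)
  + 2^-1 * \tr (hess (fun x' => F t x' mu) x *m (Sigma + Sigma0))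
  + \int[mu]_y rowapp (grad (lfd (F t x) mu) y) (fs t y mu)
  + 2^-1 * \int[mu]_y \tr (hess (lfd (F t x) mu) y *m (Sigma + Sigma0))
  + \int[mu]_y \tr (cross (fun x' y' => lfd (F t x') mu y') x y *m Sigma0)
  + 2^-1 * \int[(p2prob mu \x p2prob mu)%E]_a
      \tr (cross (lfd2 (F t x) mu) a.1 a.2 *m Sigma0).

(* All derivatives and integrals in Lop are meaningful at time t. *)
Definition Lop_wf t : Prop :=
  forall mu,
  [/\ forall x, dt_ex T (fun s => F s x mu) t,
      hess_ex (fun x => F t x mu),
      forall x, [/\ lfd_ex (F t x) mu, hess_ex (lfd (F t x) mu),
        lfd2_ex (F t x) mu & cross_ex (lfd2 (F t x) mu)],
      cross_ex (fun x y => lfd (F t x) mu y)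
    & forall x,
      [/\ (p2prob mu).-integrable setT
            (fun y => (rowapp (grad (lfd (F t x) mu) y) (fs t y mu))%:E),
          (p2prob mu).-integrable setT
            (fun y =>
              (\tr (hess (lfd (F t x) mu) y *m (Sigma + Sigma0)))%:E),
          (p2prob mu).-integrable setT
            (fun y => (\tr (cross (fun x' y' => lfd (F t x') mu y') x y
              *m Sigma0))%:E)
        & (p2prob mu \x p2prob mu)%E.-integrable setT
            (fun a => (\tr (cross (lfd2 (F t x) mu) a.1 a.2
              *m Sigma0))%:E)]].

End equations.

Section assumptions.
Context {R : realType} {n n1 : nat}.
Local Notation E := 'cV[R]_n.
Local Notation E1 := 'cV[R]_n1.
Local Notation P := (P2 R n).
Variables (T : R) (UU : set E1) (Sigma Sigma0 : 'M[R]_n).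
Variables (f : E -> E1 -> P -> E) (L : E -> E1 -> P -> R) (g : E -> P -> R).
Variables (V : R -> E -> P -> R) (phi : R -> E -> P -> E1) (M : R -> P -> R).

Record assumptionA1 : Prop := {
  A1_cont : {within [set a : E * E1 * P | UU a.1.2],
    continuous (fun a => f a.1.1 a.1.2 a.2)} ;
  A1_lip : exists C : R, forall x x' u mu mu', UU u ->
    fnorm (f x u mu - f x' u mu') <= C * (fnorm (x - x') + W2 mu mu') ;
  A1_growth : exists C : R, forall x u mu, UU u ->
    fnorm (f x u mu) <= C * (1 + fnorm x + fnorm u + mean mu) }.

Record assumptionA2 : Prop := {
  A2_L_cont : {within [set a : E * E1 * P | UU a.1.2],
    continuous (fun a => L a.1.1 a.1.2 a.2)} ;
  A2_g_cont : continuous (fun a : E * P => g a.1 a.2) ;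
  A2_L_ge0 : forall x u mu, UU u -> 0 <= L x u mu ;
  A2_g_ge0 : forall x mu, 0 <= g x mu ;
  A2_L_growth : exists C : R, forall x u mu, UU u ->
    L x u mu <= C * (1 + fnorm x ^+ 2 + fnorm u ^+ 2 + mean mu ^+ 2) ;
  A2_g_growth : exists C : R, forall x mu,
    g x mu <= quad C [:: x] mu }.

Definition fstar t x mu : E := f x (phi t x mu) mu.
Definition Lstar t x mu : R := L x (phi t x mu) mu.

Let dV t x mu y := lfd (V t x) mu y.
Let d2V t x mu y z := lfd2 (V t x) mu y z.
Let d3V t x mu y z w := lfd3 (V t x) mu y z w.

Record assumptionH1 : Prop := {
  H1_phi_in : forall t x mu, 0 <= t <= T -> UU (phi t x mu) ;
  H1_eq : forall t x mu, 0 <= t <= T ->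
    Lop T fstar Sigma Sigma0 V t x mu + Lstar t x mu = 0 ;
  H1_terminal : forall x mu, V T x mu = g x mu ;
  H1_min : forall t x mu, 0 <= t <= T ->
    let H u :=
      rowapp (grad (fun x' => V t x' mu) x
              + \row_i \int[mu]_y grad (dV t y mu) x 0 i) (f x u mu)
      + L x u mu in
    forall u, UU u -> H (phi t x mu) <= H u ;
  H1_phi_cont : jcont T phi ;
  H1_phi_growth : exists C : R, forall t x mu, 0 <= t <= T ->
    fnorm (phi t x mu) <= lin C [:: x] mu ;
  H1_V_ex : forall t mu, 0 <= t <= T ->
    (forall x, dt_ex T (fun s => V s x mu) t) /\
    hess_ex (fun x => V t x mu) ;
  H1_dV_ex : forall t mu, 0 <= t <= T ->
    [/\ forall x, lfd_ex (V t x) mu,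
        forall x y, dt_ex T (fun s => dV s x mu y) t,
        forall y, hess_ex (fun x => dV t x mu y),
        forall x, hess_ex (fun y => dV t x mu y)
      & cross_ex (fun x y => dV t x mu y)] ;
  H1_d2V_ex : forall t mu, 0 <= t <= T ->
    [/\ forall x, lfd2_ex (V t x) mu,
        forall y z, grad_ex (fun x => d2V t x mu y z),
        forall x z, hess_ex (fun y => d2V t x mu y z),
        forall z, cross_ex (fun x y => d2V t x mu y z)
      & forall x, cross_ex (fun y z => d2V t x mu y z)] ;
  H1_d3V_ex : forall t mu, 0 <= t <= T ->
    [/\ forall x, lfd3_ex (V t x) mu,
        forall x z w, grad_ex (fun y => d3V t x mu y z w)
      & forall x w, cross_ex (fun y z => d3V t x mu y z w)] ;
  H1_V_cont : jcont T V ;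
  H1_dtV_cont : jcont T (fun t x mu => dt T (fun s => V s x mu) t) ;
  H1_Vx_cont : jcont T (fun t x mu => grad (fun x' => V t x' mu) x) ;
  H1_Vxx_cont : jcont T (fun t x mu => hess (fun x' => V t x' mu) x) ;
  H1_dV_cont : jcont T (fun t '((x, y) : E * E) mu => dV t x mu y) ;
  H1_dtdV_cont : jcont T (fun t '((x, y) : E * E) mu =>
    dt T (fun s => dV s x mu y) t) ;
  H1_dxdV_cont : jcont T (fun t '((x, y) : E * E) mu =>
    grad (fun x' => dV t x' mu y) x) ;
  H1_dxxdV_cont : jcont T (fun t '((x, y) : E * E) mu =>
    hess (fun x' => dV t x' mu y) x) ;
  H1_dydV_cont : jcont T (fun t '((x, y) : E * E) mu =>
    grad (fun y' => dV t x mu y') y) ;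
  H1_dyydV_cont : jcont T (fun t '((x, y) : E * E) mu =>
    hess (fun y' => dV t x mu y') y) ;
  H1_dxydV_cont : jcont T (fun t '((x, y) : E * E) mu =>
    cross (fun x' y' => dV t x' mu y') x y) ;
  H1_d2V_cont : jcont T (fun t '((x, y, z) : E * E * E) mu =>
    d2V t x mu y z) ;
  H1_dxd2V_cont : jcont T (fun t '((x, y, z) : E * E * E) mu =>
    grad (fun x' => d2V t x' mu y z) x) ;
  H1_dyd2V_cont : jcont T (fun t '((x, y, z) : E * E * E) mu =>
    grad (fun y' => d2V t x mu y' z) y) ;
  H1_dyyd2V_cont : jcont T (fun t '((x, y, z) : E * E * E) mu =>
    hess (fun y' => d2V t x mu y' z) y) ;
  H1_dxyd2V_cont : jcont T (fun t '((x, y, z) : E * E * E) mu =>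
    cross (fun x' y' => d2V t x' mu y' z) x y) ;
  H1_dyzd2V_cont : jcont T (fun t '((x, y, z) : E * E * E) mu =>
    cross (fun y' z' => d2V t x mu y' z') y z) ;
  H1_d3V_cont : jcont T (fun t '((x, y, z, w) : E * E * E * E) mu =>
    d3V t x mu y z w) ;
  H1_dyd3V_cont : jcont T (fun t '((x, y, z, w) : E * E * E * E) mu =>
    grad (fun y' => d3V t x mu y' z w) y) ;
  H1_dyzd3V_cont : jcont T (fun t '((x, y, z, w) : E * E * E * E) mu =>
    cross (fun y' z' => d3V t x mu y' z' w) y z) ;
  H1_quad : exists C : R, forall t x y z w mu, 0 <= t <= T ->
    [/\ `|V t x mu| <= quad C [:: x] mu,
        `|dV t x mu y| <= quad C [:: x; y] mu,
        `|d2V t x mu y z| <= quad C [:: x; y; z] mu,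
        `|dt T (fun s => dV s x mu y) t| <= quad C [:: x; y] mu
      & `|d3V t x mu y z w| <= quad C [:: x; y; z; w] mu] ;
  H1_lin : exists C : R, forall t x y z w mu, 0 <= t <= T ->
    [/\ fnorm (grad (fun x' => V t x' mu) x) <= lin C [:: x] mu,
        fnorm (grad (fun y' => dV t x mu y') y) <= lin C [:: x; y] mu,
        fnorm (grad (fun x' => dV t x' mu y) x) <= lin C [:: x; y] mu,
        fnorm (grad (fun y' => d2V t x mu y' z) y) <= lin C [:: x; y; z] mu
      & fnorm (grad (fun y' => d3V t x mu y' z w) y)
          <= lin C [:: x; y; z; w] mu] ;
  H1_bounded1 : exists C : R, forall t x y mu, 0 <= t <= T ->
    [/\ fnorm (hess (fun x' => V t x' mu) x) <= C,
        fnorm (hess (fun y' => dV t x mu y') y) <= C,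
        fnorm (cross (fun x' y' => dV t x' mu y') x y) <= C
      & fnorm (hess (fun x' => dV t x' mu y) x) <= C] ;
  H1_bounded2 : exists C : R, forall t x y z w mu, 0 <= t <= T ->
    [/\ fnorm (cross (fun y' z' => d2V t x mu y' z') y z) <= C,
        fnorm (hess (fun y' => d2V t x mu y' z) y) <= C,
        fnorm (cross (fun x' y' => d2V t x' mu y' z) x y) <= C
      & fnorm (cross (fun y' z' => d3V t x mu y' z' w) y z) <= C] }.

Record assumptionH2 : Prop := {
  H2_f_ex : forall t x mu, 0 <= t <= T ->
    vlfd_ex (fstar t x) mu /\ vlfd2_ex (fstar t x) mu ;
  H2_L_ex : forall t x mu, 0 <= t <= T ->
    lfd_ex (Lstar t x) mu /\ lfd2_ex (Lstar t x) mu ;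
  H2_g_ex : forall x mu, lfd_ex (g x) mu /\ lfd2_ex (g x) mu ;
  H2_df_cont : jcont T (fun t '((x, y) : E * E) mu =>
    vlfd (fstar t x) mu y) ;
  H2_d2f_cont : jcont T (fun t '((x, y, z) : E * E * E) mu =>
    vlfd2 (fstar t x) mu y z) ;
  H2_dL_cont : jcont T (fun t '((x, y) : E * E) mu =>
    lfd (Lstar t x) mu y) ;
  H2_d2L_cont : jcont T (fun t '((x, y, z) : E * E * E) mu =>
    lfd2 (Lstar t x) mu y z) ;
  H2_dg_cont : continuous (fun '((x, y, mu) : E * E * P) =>
    lfd (g x) mu y) ;
  H2_d2g_cont : continuous (fun '((x, y, z, mu) : E * E * E * P) =>
    lfd2 (g x) mu y z) ;
  H2_f_lin : exists C : R, forall t x y z mu, 0 <= t <= T ->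
    fnorm (vlfd (fstar t x) mu y) <= lin C [:: x; y] mu /\
    fnorm (vlfd2 (fstar t x) mu y z) <= lin C [:: x; y; z] mu ;
  H2_L_quad : exists C : R, forall t x y z mu, 0 <= t <= T ->
    `|lfd (Lstar t x) mu y| <= quad C [:: x; y] mu /\
    `|lfd2 (Lstar t x) mu y z| <= quad C [:: x; y; z] mu ;
  H2_g_quad : exists C : R, forall x y z mu,
    `|lfd (g x) mu y| <= quad C [:: x; y] mu /\
    `|lfd2 (g x) mu y z| <= quad C [:: x; y; z] mu }.

Record assumptionH3 : Prop := {
  H3_terminal : forall mu, M T mu = 0 ;
  (* M does not depend on x, so the x-argument 0 given to Lop is immaterial. *)
  H3_eq : forall t mu, 0 <= t <= T ->
    Lop T fstar Sigma Sigma0 (fun s _ m => M s m) t 0 mu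
    + \int[(p2prob mu \x p2prob mu)%E]_a
        (let: (y, z) := a in
         rowapp (grad (dV t z mu) y)
                (vlfd (fstar t y) mu z - vlfd (fstar t y) mu y))
    + 2^-1 * \int[(p2prob mu \x p2prob mu)%E]_a
        (let: (y, w) := a in \tr (cross (d2V t w mu) y y *m Sigma)) = 0 ;
  H3_ex : forall t mu, 0 <= t <= T ->
    [/\ dt_ex T (fun s => M s mu) t, lfd_ex (M t) mu, lfd2_ex (M t) mu,
        hess_ex (lfd (M t) mu) & cross_ex (lfd2 (M t) mu)] ;
  (* The argument in E is a dummy: M and its t-derivative depend on (t, mu). *)
  H3_M_cont : jcont T (fun t (_ : E) mu => M t mu) ;
  H3_dtM_cont : jcont T (fun t (_ : E) mu => dt T (fun s => M s mu) t) ;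
  H3_dM_cont : jcont T (fun t (y : E) mu => lfd (M t) mu y) ;
  H3_d2M_cont : jcont T (fun t '((y, z) : E * E) mu => lfd2 (M t) mu y z) ;
  H3_dydM_cont : jcont T (fun t (y : E) mu => grad (lfd (M t) mu) y) ;
  H3_dyydM_cont : jcont T (fun t (y : E) mu => hess (lfd (M t) mu) y) ;
  H3_dyzd2M_cont : jcont T (fun t '((y, z) : E * E) mu =>
    cross (lfd2 (M t) mu) y z) ;
  H3_quad : exists C : R, forall t y z mu, 0 <= t <= T ->
    `|lfd (M t) mu y| <= C * (1 + fnorm y ^+ 2 + moment2 mu) /\
    `|lfd2 (M t) mu y z|
      <= C * (1 + fnorm y ^+ 2 + fnorm z ^+ 2 + moment2 mu) ;
  H3_lin : exists C : R, forall t y mu, 0 <= t <= T ->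
    fnorm (grad (lfd (M t) mu) y) <= lin C [:: y] mu ;
  H3_bounded : exists C : R, forall t y z mu, 0 <= t <= T ->
    fnorm (hess (lfd (M t) mu) y) <= C /\
    fnorm (cross (lfd2 (M t) mu) y z) <= C }.

End assumptions.

Section master_equation.
Context {R : realType} {n : nat}.
Local Notation E := 'cV[R]_n.
Local Notation P := (P2 R n).
Variables (T : R) (fs : R -> E -> P -> E) (Ls : R -> E -> P -> R).
Variables (Sigma Sigma0 : 'M[R]_n).
Variables (Ubar : R -> P -> R) (U : R -> E -> P -> R).

(* U solves the equation on [0, T] * R^n * P_2(R^n): the derivatives exist, the
   integrals converge and the identity holds. *)
Record solves_master_equation : Prop := {
  master_wf : forall t, 0 <= t <= T -> Lop_wf T fs Sigma Sigma0 U t ;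
  master_Ubar_ex : forall t mu, 0 <= t <= T ->
    [/\ lfd_ex (Ubar t) mu, grad_ex (lfd (Ubar t) mu),
        lfd2_ex (Ubar t) mu & cross_ex (lfd2 (Ubar t) mu)] ;
  master_coef_ex : forall t y mu, 0 <= t <= T ->
    lfd_ex (Ls t y) mu /\ vlfd_ex (fs t y) mu ;
  master_integrable : forall t x mu, 0 <= t <= T ->
    [/\ (p2prob mu).-integrable setT
          (fun y => (lfd (Ls t y) mu x - lfd (Ls t y) mu y)%:E),
        (p2prob mu).-integrable setT
          (fun y => (rowapp (grad (lfd (Ubar t) mu) y)
            (vlfd (fs t y) mu x - vlfd (fs t y) mu y))%:E)
      & (p2prob mu).-integrable setT
          (fun y => (\tr (cross (lfd2 (Ubar t) mu) y y *m Sigma))%:E)] ;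
  master_eq : forall t x mu, 0 <= t <= T ->
    0 = dt T (fun s => U s x mu) t
      + rowapp (grad (fun x' => U t x' mu) x) (fs t x mu)
      + 2^-1 * \tr (hess (fun x' => U t x' mu) x *m (Sigma + Sigma0))
      + Ls t x mu
      + \int[mu]_y rowapp (grad (lfd (U t x) mu) y) (fs t y mu)
      + 2^-1 * \int[mu]_y \tr (hess (lfd (U t x) mu) y *m (Sigma + Sigma0))
      + \int[mu]_y \tr (cross (fun x' y' => lfd (U t x') mu y') x y *m Sigma0)
      + 2^-1 * \int[(p2prob mu \x p2prob mu)%E]_a
          \tr (cross (lfd2 (U t x) mu) a.1 a.2 *m Sigma0)
      + \int[mu]_y (lfd (Ls t y) mu x - lfd (Ls t y) mu y)
      + \int[mu]_y rowapp (grad (lfd (Ubar t) mu) y)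
          (vlfd (fs t y) mu x - vlfd (fs t y) mu y)
      + 2^-1 * \int[mu]_y \tr (cross (lfd2 (Ubar t) mu) y y *m Sigma) }.

End master_equation.

(* Main.v *)
(* U is the sum of V, of M, and of the averages of delta_mu V(y; x) and of
   - delta_mu V(y; y) over mu(dy).  The second-order operator of an average of a
   family G(x, y, mu) over y is the average of an operator acting on G, because
   the flat derivative of m |-> int G(y, m) m(dy) at z is
   G(z, mu) - int G + int delta_mu G(y, mu; z) mu(dy).  The flat derivative
   commutes with derivatives in time and space (Clairaut along the segments
   e |-> mu + e (nu - mu), which are continuous for W2), so the equation of V can
   be differentiated in mu.  The differentiated equation at (y; x) evaluates the
   operator on delta_mu V(y; x); at (y; y) it does so for delta_mu V(y; y), except
   that the mixed second derivatives of delta_mu V on the diagonal carry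
   Sigma + Sigma0 instead of Sigma0.  This excess, together with the lower-order
   terms in delta_mu f* and delta_mu L*, is what the equation of M compensates. *)

From HB Require Import structures.
Require Import Defs.
From mathcomp Require Import all_boot all_order all_algebra.
From mathcomp Require Import all_classical all_reals all_analysis.
From mathcomp Require Import measurable_realfun.
From mathcomp Require Import ring lra.

Import Order.TTheory GRing.Theory Num.Theory.
Import numFieldTopology.Exports numFieldNormedType.Exports.
Local Open Scope classical_set_scope.
Local Open Scope ring_scope.

Set Implicit Arguments.
Unset Strict Implicit.
Unset Printing Implicit Defensive.

(** * Integrals and quadratic growth *)

(** Flat derivatives are handled along segments: [F (mix e mu nu)] is a function of a real variable
    on [0, 1], and a Dirac mass [nu] recovers pointwise values. One relative derivative [hasD]
    serves time, space directions and segments, so a single Clairaut theorem gives all commutations.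

    Two obstacles shape the proof. The data bound the iterated flat derivatives of V through
    derivatives in y and mixed derivatives in y, z, whereas U also needs those in the last
    variables. They come from the symmetry of iterated flat derivatives, which under the zero-mean
    normalisation reads D2(y,z) + D1(z) = D2(z,y) + D1(y); its lower-order terms match those
    produced by differentiating an integral in its own measure. Next, quadratic growth involves only
    the first moment of the measure, while integrating a quadratic function produces the second
    moment, so the growth class is not stable under averaging. In the double integral of the
    operator, boundedness of the mixed derivatives takes over.

    Functions are represented at a fixed time by jets, explicit lists of their derivatives, which
    reduces the equation to linear arithmetic between integrals. *)

Section caratheodory.
Context {R : realType} {n : nat}.
Local Notation E := 'cV[R]_n.

Let rd (k : nat) (x : E) : 'cV[int]_n := \col_i Num.floor (x i 0 * k.+1%:R).
Let gr (k : nat) (q : 'cV[int]_n) : E := \col_i ((q i 0)%:~R / k.+1%:R).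

Lemma cV_norm_le (x : E) (e : R) : 0 <= e ->
  (forall i, `|x i 0| <= e) -> `|x| <= e.
Proof.
move=> e0 xe; rewrite /Num.Def.normr/= mx_normrE.
apply/bigmax_leP; split=> // -[i j] _ /=; rewrite (ord1 j); exact: xe.
Qed.

Lemma cV_coord_le (x : E) i : `|x i 0| <= `|x|.
Proof.
rewrite [leRHS]/Num.Def.normr/= mx_normrE.
exact: (le_bigmax_cond _ (fun ij : 'I_n * 'I_1 => `|x ij.1 ij.2|)
  (erefl : predT (i, 0))).
Qed.

Let rd_cvg (x : E) : gr k (rd k x) @[k --> \oo] --> x.
Proof.
apply/cvgrPdist_lt => e e0.
have := near_infty_natSinv_lt (PosNum e0); apply: filterS => k /= ke.
apply: le_lt_trans ke; apply: cV_norm_le => // i.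
rewrite !mxE.
have k0 : (0 : R) < k.+1%:R by [].
set a := x i 0 * _.
have -> : x i 0 = a / k.+1%:R by rewrite mulfK// lt0r_neq0.
 rewrite -mulrBl normrM (@ger0_norm _ (_^-1)) ?invr_ge0//.
rewrite ler_piMl ?invr_ge0// ler_norml.
have := floor_le a; have := floorD1_gt a.
rewrite intrD; lra.
Qed.

(** Rounding [x] to the grid of mesh 1/(k+1) leaves countably many values, so the rounded function
    is measurable, and it tends to [h] by continuity in [x]. This is the source of joint
    measurability: a product carries the product sigma-algebra, which is not by definition generated
    by its open sets. *)
Lemma caratheodory_measurable d (Y : measurableType d) (h : E * Y -> R) :
  (forall x, measurable_fun setT (fun y => h (x, y))) ->
  (forall y, continuous (fun x => h (x, y))) ->
  measurable_fun setT h.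
Proof.
move=> mh ch.
apply: (@measurable_fun_cvg _ _ _ _ (fun k (a : E * Y) => h (gr k (rd k a.1), a.2))).
- move=> k _ B mB; rewrite setTI.
  (* [A q] is the cell of points that are rounded to [q]; the preimage of [B] is then a countable
     union of rectangles. *)
  pose A (q : 'cV[int]_n) : set E := \bigcap_(i in [set: 'I_n])
    [set x | (q i 0)%:~R <= x i 0 * k.+1%:R < (q i 0 + 1)%:~R].
  have -> : (fun a : E * Y => h (gr k (rd k a.1), a.2)) @^-1` B =
    \bigcup_q (A q `*` ((fun y => h (gr k q, y)) @^-1` B)).
    apply/seteqP; split=> [[x y] /= Bh|[x y] /= [q _ [/= Ax By]]].
      exists (rd k x) => //; split => //= i _ /=; rewrite mxE.
      by rewrite floor_le floorD1_gt.
    suff -> : rd k x = q by [].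
    apply/matrixP => i j; rewrite (ord1 j) mxE; apply: floor_def.
    exact: Ax.
  apply: countable_bigcupT_measurable; first exact: countableP.
  move=> q; apply: measurableX; last first.
    by rewrite -[X in measurable X]setTI; exact: mh.
  apply: fin_bigcap_measurable => // i _.
  have mc : measurable_fun setT (fun x : E => x i 0 * k.+1%:R).
    apply: continuous_borel => x.
    apply: (@continuousM R _ (fun x : E => x i 0) (fun=> k.+1%:R) x);
      [exact: coord_continuous|exact: cst_continuous].
  have := mc measurableT _ (@measurable_itv R `[(q i 0)%:~R, (q i 0 + 1)%:~R[).
  rewrite setTI; congr (measurable _).
- move=> [x y] _ /=.
  exact: (cvg_comp _ _ (rd_cvg (x := x)) (ch y x)).
Qed.

End caratheodory.

Section real_integrals.
Context d (T : measurableType d) (R : realType).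
Variable mu : {measure set T -> \bar R}.

Lemma dominated_integrable_real (K g : T -> R) :
  measurable_fun setT K -> mu.-integrable setT (EFin \o g) ->
  (forall y, `|K y| <= g y) -> mu.-integrable setT (EFin \o K).
Proof.
move=> mK ig Kg; apply: (le_integrable measurableT _ _ ig).
  exact/measurable_EFinP.
by move=> y _ /=; rewrite lee_fin (le_trans (Kg y))// ler_norm.
Qed.

Lemma dominated_convergence_real (K : nat -> T -> R) (L g : T -> R) :
  (forall k, measurable_fun setT (K k)) ->
  (forall y, K k y @[k --> \oo] --> L y) ->
  mu.-integrable setT (EFin \o g) ->
  (forall k y, `|K k y| <= g y) ->
  \int[mu]_y K k y @[k --> \oo] --> \int[mu]_y L y.
Proof.
move=> mK KL ig Kg.
have mL : measurable_fun setT L.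
  by apply: (measurable_fun_cvg mK) => y _; exact: KL.
have [] := @dominated_convergence _ _ _ mu _ measurableT
  (fun k => EFin \o K k) (EFin \o L) (EFin \o g).
- by move=> k; exact/measurable_EFinP.
- exact/measurable_EFinP.
- by apply: aeW => y _; apply: cvg_EFin; [exact: nearW|exact: KL].
- exact: ig.
- by apply: aeW => y k _ /=; rewrite lee_fin.
move=> iL _; rewrite -[X in _ --> X](fineK (integrable_fin_num measurableT iL)).
by move=> /fine_cvgP[_].
Qed.

End real_integrals.

Section real_fubini.
Context d1 d2 (X : measurableType d1) (Y : measurableType d2) (R : realType).
Variables (m1 : probability X R) (m2 : probability Y R).

Lemma integrable_prod_fst (a : X -> R) : m1.-integrable setT (EFin \o a) ->
  (m1 \x m2)%E.-integrable setT (fun z => (a z.1)%:E).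
Proof.
move=> /integrableP[ma ia].
have mf : measurable_fun setT (fun z : X * Y => (a z.1)%:E).
  exact: (measurableT_comp ma).
apply/(integrable12ltyP _ _ mf) => /=.
by under eq_integral do rewrite integral_cst// [X in (_ * X)%E]probability_setT mule1.
Qed.

Lemma integrable_prod_snd (b : Y -> R) : m2.-integrable setT (EFin \o b) ->
  (m1 \x m2)%E.-integrable setT (fun z => (b z.2)%:E).
Proof.
move=> /integrableP[ma ia].
have mf : measurable_fun setT (fun z : X * Y => (b z.2)%:E).
  exact: (measurableT_comp ma).
apply/(integrable21ltyP _ _ mf) => /=.
by under eq_integral do rewrite integral_cst// [X in (_ * X)%E]probability_setT mule1.
Qed.

Variables (K : X * Y -> R) (a : X -> R) (b : Y -> R).
Hypothesis mK : measurable_fun setT K.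
Hypothesis ia : m1.-integrable setT (EFin \o a).
Hypothesis ib : m2.-integrable setT (EFin \o b).
Hypothesis Kab : forall x y, `|K (x, y)| <= a x + b y.

Lemma integrable_prod : (m1 \x m2)%E.-integrable setT (EFin \o K).
Proof.
apply: (@dominated_integrable_real _ _ _ _ K (fun z => a z.1 + b z.2)) => //.
  have := integrableD measurableT (integrable_prod_fst ia) (integrable_prod_snd ib).
  by apply: eq_integrable => // z _; rewrite /= EFinD.
by case.
Qed.

Lemma integrable_sec1 x : m2.-integrable setT (fun y => (K (x, y))%:E).
Proof.
apply: (@dominated_integrable_real _ _ _ _ _ (fun y => a x + b y)) => //.
  by apply: measurableT_comp.
have := integrableD measurableT
  (finite_measure_integrable_cst m2 (a x) measurableT) ib.
by apply: eq_integrable => // y _; rewrite /= EFinD.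
Qed.

Lemma integrable_sec2 y : m1.-integrable setT (fun x => (K (x, y))%:E).
Proof.
apply: (@dominated_integrable_real _ _ _ _ _ (fun x => a x + b y)) => //.
  by apply: measurableT_comp.
have := integrableD measurableT
  ia (finite_measure_integrable_cst m1 (b y) measurableT).
by apply: eq_integrable => // x _; rewrite /= EFinD.
Qed.

Let sec1E x : ((\int[m2]_y K (x, y))%:E = \int[m2]_y (K (x, y))%:E)%E.
Proof.
rewrite /Rintegral fineK//; apply: integrable_fin_num => //.
exact: integrable_sec1.
Qed.

Let sec2E y : ((\int[m1]_x K (x, y))%:E = \int[m1]_x (K (x, y))%:E)%E.
Proof.
rewrite /Rintegral fineK//; apply: integrable_fin_num => //.
exact: integrable_sec2.
Qed.

Lemma integrable_sec1_int :
  m1.-integrable setT (fun x => (\int[m2]_y K (x, y))%:E).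
Proof.
have := integrable_fubini_F integrable_prod.
apply: eq_integrable => // x _; by rewrite sec1E.
Qed.

(** The separated bound [a x + b y] makes every section of [K] integrable, not only almost every
    one, so the real-valued inner integrals lose nothing against the extended ones and Fubini
    carries over. *)
Lemma Rintegral_prod1 :
  \int[(m1 \x m2)%E]_z K z = \int[m1]_x \int[m2]_y K (x, y).
Proof.
rewrite /Rintegral -(integral12_prod_meas1 integrable_prod).
by congr fine; apply: eq_integral => x _; exact/esym/sec1E.
Qed.

Lemma Rintegral_prod2 :
  \int[(m1 \x m2)%E]_z K z = \int[m2]_y \int[m1]_x K (x, y).
Proof.
rewrite /Rintegral -(integral21_prod_meas1 integrable_prod).
by congr fine; apply: eq_integral => x _; exact/esym/sec2E.
Qed.

End real_fubini.

Section continuity.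
Context {R : realType} {T : topologicalType} {V : pseudoMetricNormedZmodType R}.
Implicit Types f g : T -> V.

Lemma cont_cst {U : topologicalType} (u : U) : continuous (fun _ : T => u).
Proof. exact: cst_continuous. Qed.

Lemma cont_D f g : continuous f -> continuous g -> continuous (fun x => f x + g x).
Proof. by move=> cf cg x; exact: cvgD (cf x) (cg x). Qed.

Lemma cont_N f : continuous f -> continuous (fun x => - f x).
Proof. by move=> cf x; exact: cvgN (cf x). Qed.

Lemma cont_B f g : continuous f -> continuous g -> continuous (fun x => f x - g x).
Proof. by move=> cf cg x; exact: cvgB (cf x) (cg x). Qed.

Lemma cont_M (f g : T -> R) :
  continuous f -> continuous g -> continuous (fun x => f x * g x).
Proof. by move=> cf cg x; exact: cvgM (cf x) (cg x). Qed.

End continuity.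

Lemma cont_id {T : topologicalType} : continuous (fun x : T => x).
Proof. by move=> x; exact: cvg_id. Qed.

Lemma cont_comp {S T U : topologicalType} (f : S -> T) (g : T -> U) :
  continuous f -> continuous g -> continuous (fun x => g (f x)).
Proof. by move=> cf cg x; apply: (cvg_comp _ _ (cf x)); exact: cg. Qed.

Lemma cont_pair {S T U : topologicalType} (f : S -> T) (g : S -> U) :
  continuous f -> continuous g -> continuous (fun x => (f x, g x)).
Proof. by move=> cf cg x; exact: cvg_pair (cf x) (cg x). Qed.

Section points.
Context {R : realType} {n : nat}.
Local Notation E := 'cV[R]_n.
Implicit Types (x : E).

Lemma fnorm_ge0 p q (A : 'M[R]_(p, q)) : 0 <= fnorm A.
Proof. exact: sqrtr_ge0. Qed.

Lemma fnorm_sqr p q (A : 'M[R]_(p, q)) :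
  fnorm A ^+ 2 = \sum_i \sum_j A i j ^+ 2.
Proof.
rewrite sqr_sqrtr//; apply: sumr_ge0 => i _; apply: sumr_ge0 => j _.
exact: sqr_ge0.
Qed.

Lemma fnorm_entry p q (A : 'M[R]_(p, q)) i j : `|A i j| <= fnorm A.
Proof.
rewrite -(@ler_sqr _ `|_|) ?nnegrE ?fnorm_ge0// fnorm_sqr real_normK ?num_real//.
rewrite (bigD1 i)//= (bigD1 j)//= -addrA lerDl addr_ge0//.
  by apply: sumr_ge0 => ? _; exact: sqr_ge0.
by apply: sumr_ge0 => ? _; apply: sumr_ge0 => ? _; exact: sqr_ge0.
Qed.

Lemma norm_le_fnorm x : `|x| <= fnorm x.
Proof. by apply: cV_norm_le => [|i]; [exact: fnorm_ge0|exact: fnorm_entry]. Qed.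

Lemma fnorm2_le_norm x : fnorm x ^+ 2 <= n%:R * `|x| ^+ 2.
Proof.
rewrite fnorm_sqr.
apply: (@le_trans _ _ (\sum_(i < n) `|x| ^+ 2)); last first.
  by rewrite sumr_const card_ord mulr_natl.
apply: ler_sum => i _; rewrite big_ord1 -real_normK ?num_real//.
by rewrite ler_sqr ?nnegrE// cV_coord_le.
Qed.

Lemma continuous_norm2 : continuous (fun x : E => 1 + `|x| ^+ 2).
Proof.
apply: cont_D; first exact: cont_cst.
under eq_fun do rewrite expr2.
by apply: cont_M; exact: norm_continuous.
Qed.

Lemma integrable_norm2 (m : P2 R n) :
  (p2prob m).-integrable setT (fun x => (1 + `|x| ^+ 2)%:E).
Proof.
have i1 : (p2prob m).-integrable setT (fun x => (1 + fnorm x ^+ 2)%:E).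
  have : (p2prob m).-integrable setT (fun x => (fnorm (x : E) ^+ 2)%:E).
    apply/integrableP; split; first exact: measurable_fnorm2.
    apply: le_lt_trans (p2moment m); rewrite le_eqVlt; apply/orP; left.
    apply/eqP; apply: eq_integral => x _; rewrite gee0_abs//.
    by rewrite lee_fin sqr_ge0.
  move/(integrableD measurableT
    (finite_measure_integrable_cst (p2prob m) 1 measurableT)).
  by apply: eq_integrable.
apply: (@dominated_integrable_real _ _ _ _ _ (fun x : E => 1 + fnorm x ^+ 2)).
- by apply: continuous_borel; exact: continuous_norm2.
- exact: i1.
- move=> x; rewrite ger0_norm ?addr_ge0 ?sqr_ge0// lerD2l.
  by rewrite ler_sqr ?nnegrE// ?fnorm_ge0// norm_le_fnorm.
Qed.

(** Growth is measured in the sup norm, which combines with the norm of tuples of vectors; it is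
    comparable to [fnorm] up to a constant depending on [n]. *)
Definition qgrow (K : E -> R) : Prop :=
  measurable_fun setT K /\ exists C, forall y, `|K y| <= C * (1 + `|y| ^+ 2).

Lemma qgrow_integrable (m : P2 R n) K : qgrow K ->
  (p2prob m).-integrable setT (EFin \o K).
Proof.
move=> [mK [C KC]].
apply: (@dominated_integrable_real _ _ _ _ K (fun y => C * (1 + `|y| ^+ 2))) => //.
have := integrableZl measurableT C (integrable_norm2 m).
by apply: eq_integrable.
Qed.

Lemma qgrowE (K : E -> R) C : measurable_fun setT K ->
  (forall y, `|K y| <= C * (1 + `|y| ^+ 2)) -> qgrow K.
Proof. by move=> ? ?; split => //; exists C. Qed.

Let w0 x : 0 <= 1 + `|x| ^+ 2. Proof. by rewrite addr_ge0// sqr_ge0. Qed.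

Lemma qgrow_cst r : qgrow (fun=> r).
Proof.
split; first exact: measurable_cst.
by exists `|r| => y; rewrite ler_peMr// lerDl sqr_ge0.
Qed.

End points.

(** * Mixtures and Dirac measures *)

Section P2_algebra.
Context {R : realType} {n : nat}.
Local Notation E := 'cV[R]_n.
Implicit Types (mu nu : P2 R n) (x : E) (K L : E -> R).

(** All fields other than the set function are proofs, equal by proof irrelevance. Leibniz equality
    is what permits rewriting a mixture inside an arbitrary functional [F]. *)
Lemma P2_ext mu nu : (forall A, mu A = nu A) -> mu = nu.
Proof.
case: mu nu => [[m1 c1] h1] [[m2 c2] h2] /= m12.
have m12' : m1 = m2 by apply/funext => A; exact: m12.
subst m2.
have c12 : c1 = c2.
  clear h1 h2 m12; destruct c1 as [[] [] [] [] [] [] []].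
  destruct c2 as [[] [] [] [] [] [] []].
  repeat match goal with p : ?A, q : ?A |- _ =>
    (have ? : q = p by (exact: Prop_irrelevance)); subst q end.
  by [].
by subst c2; rewrite (Prop_irrelevance h1 h2).
Qed.

Let mix_ge0 (m : P2 R n) (A : set E) : (0 <= m A)%E.
Proof. exact: measure_ge0. Qed.

Lemma mix0 mu nu : mix 0 mu nu = mu.
Proof.
apply: P2_ext => A; rewrite mixE ?lexx ?ler01//.
by rewrite subr0 mul1e mul0e adde0.
Qed.

Lemma mix1 mu nu : mix 1 mu nu = nu.
Proof.
apply: P2_ext => A; rewrite mixE ?lexx ?ler01//.
by rewrite subrr mul1e mul0e add0e.
Qed.

(** A segment joining two points of a segment is an affinely reparametrised piece of it. This
    transports a derivative at the starting point of a segment to its interior points. *)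
Lemma mix_mix s a b mu nu : 0 <= s <= 1 -> 0 <= a <= 1 -> 0 <= b <= 1 ->
  mix s (mix a mu nu) (mix b mu nu) = mix (a + s * (b - a)) mu nu.
Proof.
move=> s01 a01 b01.
have /andP[s0 s1] := s01; have /andP[a0 a1] := a01; have /andP[b0 b1] := b01.
apply: P2_ext => A; rewrite !mixE//; last by apply/andP; split; nra.
have x0 := mix_ge0 mu A; have y0 := mix_ge0 nu A.
rewrite !ge0_muleDr ?mule_ge0 ?lee_fin ?subr_ge0// !muleA -!EFinM.
rewrite addeACA -!ge0_muleDl ?lee_fin ?mulr_ge0 ?subr_ge0// -!EFinD.
by congr (_%:E * _ + _%:E * _)%E; ring.
Qed.

Lemma mix_comm a b mu nu pi : 0 <= a <= 1 -> 0 <= b <= 1 ->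
  mix a (mix b mu nu) pi = mix b (mix a mu pi) (mix a nu pi).
Proof.
move=> a01 b01; have /andP[a0 a1] := a01; have /andP[b0 b1] := b01.
apply: P2_ext => A; rewrite !mixE//.
have x0 := mix_ge0 mu A; have y0 := mix_ge0 nu A; have z0 := mix_ge0 pi A.
rewrite !ge0_muleDr ?mule_ge0 ?lee_fin ?subr_ge0// !muleA -!EFinM.
rewrite [RHS]addeACA -!ge0_muleDl ?lee_fin ?mulr_ge0 ?subr_ge0// -!EFinD.
by congr (_%:E * _ + _%:E * _ + _%:E * _)%E; ring.
Qed.

(** The weights are c = 1 - (1 - a)(1 - b) and d = a / c; stating them by multiplicative equations
    keeps the case c = 0 admissible. *)
Lemma mix_assoc a b c d mu nu pi : 0 <= a <= 1 -> 0 <= b <= 1 ->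
  0 <= c <= 1 -> 0 <= d <= 1 -> c * d = a -> 1 - c = (1 - a) * (1 - b) ->
  mix a (mix b mu nu) pi = mix c mu (mix d nu pi).
Proof.
move=> a01 b01 c01 d01 cd cab.
have /andP[a0 a1] := a01; have /andP[b0 b1] := b01.
have /andP[c0 c1] := c01; have /andP[d0 d1] := d01.
apply: P2_ext => A; rewrite !mixE//.
have x0 := mix_ge0 mu A; have y0 := mix_ge0 nu A; have z0 := mix_ge0 pi A.
rewrite !ge0_muleDr ?mule_ge0 ?lee_fin ?subr_ge0// !muleA -!EFinM -addeA.
by congr (_%:E * _ + (_%:E * _ + _%:E * _))%E; [rewrite cab|lra|rewrite cd].
Qed.

Let int_mscale (k : {nonneg R}) mu K : (p2prob mu).-integrable setT (EFin \o K) ->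
  (mscale k mu).-integrable setT (EFin \o K) /\
  (\int[mscale k mu]_x (K x)%:E = k%:num%:E * \int[mu]_x (K x)%:E)%E.
Proof.
move=> iK.
have mK : measurable_fun setT (EFin \o K) by apply: measurable_int iK.
split.
  apply/integrableP; split => //.
  rewrite ge0_integral_mscale//; last exact: measurableT_comp.
  by case/integrableP : iK => _ ?; apply: lte_mul_pinfty.
rewrite [LHS]integralE [X in _ = (_ * X)%E]integralE.
have ip := integrable_funepos measurableT iK.
have iN := integrable_funeneg measurableT iK.
rewrite !ge0_integral_mscale//; [|exact: measurable_funeneg|exact: measurable_funepos].
rewrite [RHS]muleBr ?fin_num_adde_defl ?fin_numN//; exact: integrable_fin_num.
Qed.

Lemma int_mix K e mu nu : 0 <= e <= 1 ->
  (p2prob mu).-integrable setT (EFin \o K) ->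
  (p2prob nu).-integrable setT (EFin \o K) ->
  \int[mix e mu nu]_y K y = (1 - e) * \int[mu]_y K y + e * \int[nu]_y K y.
Proof.
move=> /andP[e0 e1] imu inu.
pose k1 := NngNum (clip01_le1 e); pose k2 := NngNum (clip01_ge0 e).
have ce : clip01 e = e by rewrite /clip01 (min_r e1) (max_r e0).
have [i1 E1] := int_mscale k1 imu; have [i2 E2] := int_mscale k2 inu.
rewrite /Rintegral /= /mix_measure (integral_measure_add measurableT i1 i2).
rewrite [X in (X + _)%E]E1 [X in (_ + X)%E]E2 /= ce.
have f1 := integrable_fin_num measurableT imu.
have f2 := integrable_fin_num measurableT inu.
by rewrite fineD ?fin_numM// !fineM.
Qed.

Lemma diracP2_moment x : (\int[@dirac _ E x R]_y (fnorm y ^+ 2)%:E < +oo)%E.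
Proof.
rewrite integral_dirac//; last exact: measurable_fnorm2.
by rewrite diracT mul1e ltry.
Qed.

(** These are the test measures that turn an identity between integrals against all of [P2] into a
    pointwise one. *)
Definition diracP2 x : P2 R n := @MkP2 R n (@dirac _ E x R) (@diracP2_moment x).

Lemma int_dirac K x : measurable_fun setT K -> \int[diracP2 x]_y K y = K x.
Proof.
move=> mK; rewrite /Rintegral/= integral_dirac//; last exact/measurable_EFinP.
by rewrite diracT mul1e.
Qed.

End P2_algebra.

(** * Continuity of segments for the Wasserstein distance *)

Section W2_segments.
Context {R : realType} {n : nat}.
Local Notation E := 'cV[R]_n.
Implicit Types (mu nu : P2 R n).

Let diag (x : E) : E * E := (x, x).
Let mdiag : measurable_fun setT diag.
Proof. exact: measurable_fun_pair. Qed.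

Let diag_measure (m : P2 R n) : {measure set (E * E) -> \bar R} :=
  measure_function_pushforward__canonical__measure_function_Measure
    (p2prob m) mdiag.

Section segment_coupling.
Variables (c : R) (mu nu : P2 R n).

(** Mass [1 - c] does not move and sits on the diagonal; mass [c] is sent to [nu] by the independent
    coupling. The transport cost is thus proportional to [c]. *)
Definition seg_coupling : set (E * E) -> \bar R :=
  measure_add (mscale (NngNum (clip01_le1 c)) (diag_measure mu))
              (mscale (NngNum (clip01_ge0 c)) (p2prob mu \x p2prob nu)%E).

HB.instance Definition _ := Measure.on seg_coupling.

Lemma seg_coupling_setT : seg_coupling setT = 1%E.
Proof.
rewrite /seg_coupling measure_addE /= /mscale /=.
have -> : pushforward mu diag setT = 1%E by exact: (probability_setT mu).
rewrite -[X in (_ * (_ \x _) X)%E]setXTT product_measure1E//.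
rewrite [X in (_ * (X * _))%E](probability_setT mu).
by rewrite [X in (_ * (_ * X))%E](probability_setT nu) !mule1 -EFinD subrK.
Qed.

HB.instance Definition _ :=
  @Measure_isProbability.Build _ _ R seg_coupling seg_coupling_setT.

Lemma seg_couplingE (A B : set E) : measurable A -> measurable B ->
  seg_coupling (A `*` B) =
    ((1 - clip01 c)%:E * mu (A `&` B) + (clip01 c)%:E * (mu A * nu B))%E.
Proof.
move=> mA mB; rewrite /seg_coupling measure_addE /= /mscale /=.
by rewrite product_measure1E//; congr (_ * _ + _)%E.
Qed.

Lemma seg_couplingP : 0 <= c <= 1 ->
  coupling mu (mix c mu nu) seg_coupling.
Proof.
move=> c01 A mA; have /andP[c0 c1] := c01.
have cc : clip01 c = c by rewrite /clip01 (min_r c1) (max_r c0).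
have pT (m : P2 R n) : m [set: E] = 1%E by exact: (probability_setT m).
split.
  apply: (etrans (seg_couplingE mA measurableT)); rewrite cc setIT (pT nu) mule1.
  by rewrite -ge0_muleDl ?lee_fin ?subr_ge0// -EFinD subrK mul1e.
apply: (etrans (seg_couplingE measurableT mA)).
by rewrite cc setTI mixE// (pT mu) mul1e.
Qed.

Lemma measurable_dist2 :
  measurable_fun setT (fun z : E * E => (fnorm (z.1 - z.2) ^+ 2)%:E).
Proof.
have cf : continuous (fun x : E => fnorm x ^+ 2).
  by under eq_fun do rewrite expr2; apply: cont_M; exact: continuous_fnorm.
apply/measurable_EFinP; apply: caratheodory_measurable => /=.
  move=> x; apply: continuous_borel; apply: (@cont_comp _ _ _ (fun y => x - y)) cf.
  by apply: cont_B; [exact: cont_cst|exact: cont_id].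
move=> y; apply: (@cont_comp _ _ _ (fun x => x - y)) cf.
by apply: cont_B; [exact: cont_id|exact: cont_cst].
Qed.

Lemma fnormB2 (x y : E) :
  fnorm (x - y) ^+ 2 <= 2 * fnorm x ^+ 2 + 2 * fnorm y ^+ 2.
Proof.
rewrite !fnorm_sqr !mulr_sumr -big_split/=; apply: ler_sum => i _.
rewrite !mulr_sumr -big_split/=; apply: ler_sum => j _.
rewrite !mxE -subr_ge0.
have -> : 2 * x i j ^+ 2 + 2 * y i j ^+ 2 - (x i j - y i j) ^+ 2 =
  (x i j + y i j) ^+ 2 by ring.
exact: sqr_ge0.
Qed.

Lemma moment2E (m : P2 R n) :
  (\int[p2prob m]_x (fnorm x ^+ 2)%:E = (moment2 m)%:E)%E.
Proof.
rewrite /moment2 /Rintegral fineK// ge0_fin_numE ?p2moment//.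
by apply: integral_ge0 => x _; rewrite lee_fin sqr_ge0.
Qed.

Lemma moment2_ge0 (m : P2 R n) : 0 <= moment2 m.
Proof. by apply: Rintegral_ge0 => x _; exact: sqr_ge0. Qed.

Lemma int_dist2_prod :
  (\int[(p2prob mu \x p2prob nu)]_z (fnorm (z.1 - z.2) ^+ 2)%:E
   <= (2 * (moment2 mu + moment2 nu))%:E)%E.
Proof.
have p0 (z : E * E) : (0 <= (fnorm (z.1 - z.2) ^+ 2)%:E)%E.
  by rewrite lee_fin sqr_ge0.
rewrite (fubini_tonelli1 _ measurable_dist2 p0) /fubini_F/=.
have i2 (m : P2 R n) : (p2prob m).-integrable setT (fun x => (2 * fnorm (x : E) ^+ 2)%:E).
  apply: (@qgrow_integrable R n m (fun x => 2 * fnorm x ^+ 2)); split.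
    by apply: measurable_funM => //; apply/measurable_EFinP; exact: (@measurable_fnorm2 R n 1).
  exists (2 * n%:R) => y; rewrite ger0_norm ?mulr_ge0 ?sqr_ge0 ?fnorm_ge0//.
  rewrite -mulrA ler_wpM2l// (le_trans (fnorm2_le_norm y))// ler_wpM2l//.
  by rewrite lerDr ler01.
have iC (q : P2 R n) (r : R) : (\int[p2prob q]_x r%:E = r%:E)%E.
  by rewrite integral_cst// [X in (_ * X)%E]probability_setT mule1.
have E2 (q : P2 R n) : (\int[p2prob q]_x (2 * fnorm (x : E) ^+ 2)%R%:E = (2 * moment2 q)%R%:E)%E.
  under eq_integral do rewrite EFinM.
  rewrite ge0_integralZl//; [by rewrite moment2E| |].
  - exact: (@measurable_fnorm2 R n 1).
  - by move=> x _; rewrite lee_fin sqr_ge0.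
apply: (@le_trans _ _ (\int[p2prob mu]_x
    ((2 * fnorm x ^+ 2)%:E + (2 * moment2 nu)%:E)%E)%E).
  apply: ge0_le_integral => //.
  - by move=> x _; apply: integral_ge0 => y _; rewrite lee_fin sqr_ge0.
  - exact: (measurable_fun_fubini_tonelli_F
      (fun z : E * E => (fnorm (z.1 - z.2) ^+ 2)%:E) measurable_dist2 p0).
  - apply: emeasurable_funD => //; by case/integrableP : (i2 mu).
  - move=> x _; rewrite -E2.
    apply: (@le_trans _ _ (\int[p2prob nu]_y
      ((2 * fnorm x ^+ 2)%:E + (2 * fnorm y ^+ 2)%:E)%E)%E).
      apply: ge0_le_integral => //.
      + by move=> y _; rewrite lee_fin sqr_ge0.
      + exact: (measurableT_comp measurable_dist2 (pair1_measurable x)).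
      + apply: emeasurable_funD => //; by case/integrableP : (i2 nu).
      + by move=> y _; rewrite -EFinD lee_fin fnormB2.
    rewrite (integralD measurableT
      (finite_measure_integrable_cst _ (2 * fnorm x ^+ 2) measurableT) (i2 nu)).
    by rewrite [X in (X + _)%E](iC nu).
rewrite (integralD measurableT (i2 mu)
  (finite_measure_integrable_cst _ (2 * moment2 nu) measurableT)).
by rewrite E2 [X in (_ + X)%E](iC mu) -EFinD mulrDr.
Qed.

(** The diagonal part of [seg_coupling] costs nothing, and the product part is bounded through |x -
    y|^2 <= 2 |x|^2 + 2 |y|^2. The rate, a square root of [c], is enough for continuity at the
    starting point. *)
Lemma W2_mix_le : 0 <= c <= 1 ->
  W2 mu (mix c mu nu) <= Num.sqrt (c * (2 * (moment2 mu + moment2 nu))).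
Proof.
move=> c01; have /andP[c0 c1] := c01.
have cc : clip01 c = c by rewrite /clip01 (min_r c1) (max_r c0).
have p0 (z : E * E) : setT z -> (0 <= (fnorm (z.1 - z.2) ^+ 2)%:E)%E.
  by rewrite lee_fin sqr_ge0.
have D0 : 0 <= c * (2 * (moment2 mu + moment2 nu)).
  by rewrite !mulr_ge0// addr_ge0// moment2_ge0.
rewrite /W2; set S := [set _ | _ in _].
have S0 : (0 <= ereal_inf S)%E.
  by apply: le_ereal_inf_tmp => _ [pi _ <-]; apply: integral_ge0.
have Sle : (ereal_inf S <= (c * (2 * (moment2 mu + moment2 nu)))%:E)%E.
  apply: (@le_trans _ _ (\int[seg_coupling]_z (fnorm (z.1 - z.2) ^+ 2)%:E)%E).
    by apply: ereal_inf_lbound; exists seg_coupling => //; exact: seg_couplingP.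
  have md := measurable_dist2.
  rewrite /seg_coupling ge0_integral_measure_add// !ge0_integral_mscale//.
  rewrite (ge0_integral_pushforward mdiag)//; last by move=> z _; exact: p0.
  rewrite /= cc.
  have -> : (\int[p2prob mu]_x
      (((fun z : E * E => (fnorm (z.1 - z.2) ^+ 2)%:E) \o diag) x) = 0)%E.
    apply: integral0_eq => x _ /=; rewrite subrr.
    rewrite fnorm_sqr; congr EFin; rewrite big1// => i _.
    by rewrite big1// => j _; rewrite mxE expr0n.
  rewrite mule0 add0e [leRHS]EFinM; apply: lee_pmul => //.
  - by apply: integral_ge0.
  - exact: int_dist2_prod.
apply: ler_wsqrtr.
have : ereal_inf S \is a fin_num.
  by rewrite ge0_fin_numE// (le_lt_trans Sle)// ltry.
by move/fineK => Sf; rewrite -lee_fin Sf.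
Qed.

End segment_coupling.

(** The endpoint [nu s] may move, because an iterated mixture becomes a mixture of [mu] with a
    moving measure; only the weight times the second moments has to vanish. *)
Lemma mix_cvg (T : Type) (F : set_system T) (FF : Filter F) (c : T -> R)
    (nu : T -> P2 R n) mu :
  (\forall s \near F, 0 <= c s <= 1) ->
  c s * (moment2 mu + moment2 (nu s)) @[s --> F] --> 0 ->
  mix (c s) mu (nu s) @[s --> F] --> mu.
Proof.
move=> c01 c0 A; rewrite nbhsE => -[B [oB Bmu] BA]; apply: (filterS BA).
have [e e0 He] := oB _ Bmu.
(* The halving compensates the factor 2 under the root in [W2_mix_le]. *)
have e2 : 0 < (e ^+ 2) / 2 by rewrite divr_gt0// exprn_gt0.
have /cvgrPdist_lt /(_ _ e2) := c0.
apply: filterS2 c01 => s cs; rewrite sub0r normrN => ce.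
apply: He; apply: le_lt_trans (W2_mix_le mu (nu s) cs) _.
rewrite -[ltRHS]gtr0_norm// -sqrtr_sqr ltr_sqrt ?exprn_gt0//.
rewrite mulrCA; apply: le_lt_trans (_ : 2 * `|c s * (moment2 mu + moment2 (nu s))| < _).
  by rewrite ler_wpM2l// ler_norm.
by rewrite mulrC -ltr_pdivlMr.
Qed.

End W2_segments.

(** * One-sided derivatives of a real variable *)

Section relative_derivative.
Context {R : realType}.
Implicit Types (I J : set R) (f g : R -> R) (a b s r l : R).

(** Being relative to [I], this is one notion for the time derivative on [0, T], derivatives along
    segments on [0, 1] and directional derivatives on [-1, 1]. For I = [0, T] it is literally the
    limit occurring in [dt]. *)
Definition hasD I f s l : Prop :=
  (f r - f s) / (r - s) @[r --> within I s^'] --> l.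

Definition convex_set I : Prop :=
  forall a b c, I a -> I b -> a <= c <= b -> I c.

Definition limit_pt I s : Prop :=
  forall d, 0 < d -> exists r, [/\ I r, r != s & `|r - s| < d].

Lemma hasDP I f s l : hasD I f s l <->
  forall e, 0 < e -> exists2 d, 0 < d & forall r, I r -> r != s ->
    `|r - s| < d -> `|(f r - f s) / (r - s) - l| < e.
Proof.
split=> [/cvgrPdist_lt h e e0|h].
  have := h _ e0; rewrite /within/= /dnbhs /within/= => /nbhs_ballP[d /= d0 dh].
  exists d => // r Ir rs rd; rewrite distrC; apply: dh => //.
  by rewrite /ball/= distrC.
apply/cvgrPdist_lt => e e0; have [d d0 dh] := h _ e0.
rewrite /within/= /dnbhs /within/=; apply/nbhs_ballP; exists d => // r /=.
by rewrite /ball/= distrC => rd rs Ir; rewrite distrC; exact: dh.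
Qed.

(** If no radius worked, bad points in the balls of radius 1/(k+1) would form a sequence
    contradicting the hypothesis. Dominated convergence speaks of sequences, the mean value
    arguments of neighbourhoods; this lemma joins them. *)
Lemma seq_limit_eps (X : pseudoMetricType R) (D : set X) (F : X -> R) x l :
  (forall u : nat -> X, (forall k, D (u k)) -> u k @[k --> \oo] --> x ->
     F (u k) @[k --> \oo] --> l) ->
  forall e, 0 < e -> exists2 d, 0 < d &
    forall y, D y -> ball x d y -> `|F y - l| < e.
Proof.
move=> h e e0; apply: contrapT => nd.
have nd' k : exists y, [/\ D y, ball x k.+1%:R^-1 y & e <= `|F y - l|].
  apply: contrapT => nk; apply: nd; exists k.+1%:R^-1; first by rewrite invr_gt0.
  move=> y Dy xy; rewrite ltNge; apply/negP => ey.
  by apply: nk; exists y.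
have [u uP] := choice nd'.
have Du k : D (u k) by have [] := uP k.
have ux : u k @[k --> \oo] --> x.
  apply/cvg_ballP => d d0.
  have := near_infty_natSinv_lt (PosNum d0); apply: filterS => k /= kd.
  by have [_ + _] := uP k; apply: le_ball; exact: ltW.
have /cvgrPdist_lt /(_ _ e0)[N _ /(_ N (leqnn N))] := h u Du ux.
by have [_ _ +] := uP N; rewrite distrC leNgt => /negP.
Qed.

Lemma hasD_seq I f s l (u : nat -> R) : hasD I f s l ->
  (forall k, I (u k) /\ u k != s) -> u k @[k --> \oo] --> s ->
  (f (u k) - f s) / (u k - s) @[k --> \oo] --> l.
Proof.
move=> /hasDP h Iu us; apply/cvgrPdist_lt => e e0.
have [d d0 dh] := h _ e0.
have /cvgrPdist_lt /(_ _ d0) := us; apply: filterS => k skd.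
by have [Ik ks] := Iu k; rewrite distrC; apply: dh => //; rewrite distrC.
Qed.

Lemma seq_hasD I f s l :
  (forall u : nat -> R, (forall k, I (u k) /\ u k != s) ->
     u k @[k --> \oo] --> s ->
     (f (u k) - f s) / (u k - s) @[k --> \oo] --> l) -> hasD I f s l.
Proof.
move=> h; apply/hasDP => e e0.
have [d d0 dh] := @seq_limit_eps R (fun r => I r /\ r != s)
  (fun r => (f r - f s) / (r - s)) s l h _ e0.
exists d => // r Ir rs rd; apply: dh => //.
by rewrite /ball/= distrC.
Qed.

Lemma hasD_unique I f s l l' : limit_pt I s ->
  hasD I f s l -> hasD I f s l' -> l = l'.
Proof.
move=> Is /hasDP h /hasDP h'; apply/eqP; rewrite -subr_eq0 -normr_le0.
apply/ler_addgt0Pr => e e0; rewrite add0r (splitr e).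
have e2 : 0 < e / 2 by rewrite divr_gt0.
have [d d0 dh] := h _ e2; have [d' d0' dh'] := h' _ e2.
have [|r [Ir rs]] := Is (Num.min d d'); first by rewrite lt_min d0.
rewrite lt_min => /andP[rd rd'].
have := ltW (dh _ Ir rs rd); have := ltW (dh' _ Ir rs rd').
set q := _ / _ => h1 h2; apply: (le_trans _ (lerD h2 h1)).
by rewrite [`|q - l|]distrC; apply: le_trans (ler_normD _ _); rewrite addrA subrK.
Qed.

Lemma hasD_continuous I f s l : hasD I f s l ->
  forall e, 0 < e -> exists2 d, 0 < d &
    forall r, I r -> `|r - s| < d -> `|f r - f s| < e.
Proof.
move=> /hasDP h e e0; have [d d0 dh] := h _ ltr01.
have l1 : 0 < `|l| + 1 by rewrite ltr_wpDl.
exists (Num.min d (e / (`|l| + 1))); first by rewrite lt_min d0 divr_gt0.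
move=> r Ir; rewrite lt_min => /andP[rd re].
have [->|rs] := eqVneq r s; first by rewrite subrr normr0.
have rs0 : r - s != 0 by rewrite subr_eq0.
have -> : f r - f s = (f r - f s) / (r - s) * (r - s) by rewrite divfK.
rewrite normrM; apply: (@le_lt_trans _ _ ((`|l| + 1) * `|r - s|)).
  rewrite ler_wpM2r//; have := ltW (dh _ Ir rs rd); set q := _ / _ => ql.
  rewrite -[q](subrK l) addrC (le_trans (ler_normD _ _))//.
  by rewrite lerD2l.
by rewrite mulrC -ltr_pdivlMr.
Qed.

Lemma hasD_ext I f g s l : I s -> {in I, f =1 g} -> hasD I f s l -> hasD I g s l.
Proof.
move=> Is fg /hasDP h; apply/hasDP => e /h[d d0 dh]; exists d => // r Ir.
by rewrite -!fg ?inE//; exact: dh.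
Qed.

Lemma hasD_eq I f s l l' : hasD I f s l -> l = l' -> hasD I f s l'.
Proof. by move=> h <-. Qed.

Lemma hasD_cst I c s : hasD I (fun=> c) s 0.
Proof.
by apply/hasDP => e e0; exists 1 => // r _ _ _; rewrite subrr mul0r subrr normr0.
Qed.

Lemma hasD_id I s : hasD I (fun r => r) s 1.
Proof.
apply/hasDP => e e0; exists 1 => // r _ rs _.
by rewrite divff ?subr_eq0// subrr normr0.
Qed.

Lemma hasDD I f g s l l' : hasD I f s l -> hasD I g s l' ->
  hasD I (fun r => f r + g r) s (l + l').
Proof.
move=> hf hg; apply: seq_hasD => u Iu us.
under eq_fun do rewrite opprD addrACA mulrDl.
exact: cvgD (hasD_seq hf Iu us) (hasD_seq hg Iu us).
Qed.

Lemma hasDN I f s l : hasD I f s l -> hasD I (fun r => - f r) s (- l).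
Proof.
move=> hf; apply: seq_hasD => u Iu us.
under eq_fun do rewrite -opprD mulNr.
exact: cvgN (hasD_seq hf Iu us).
Qed.

Lemma hasDB I f g s l l' : hasD I f s l -> hasD I g s l' ->
  hasD I (fun r => f r - g r) s (l - l').
Proof. by move=> hf hg; apply: hasDD => //; exact: hasDN. Qed.

Lemma hasDM I f g s l l' : hasD I f s l -> hasD I g s l' ->
  hasD I (fun r => f r * g r) s (f s * l' + g s * l).
Proof.
move=> hf hg; apply: seq_hasD => u Iu us.
have fu : f (u k) @[k --> \oo] --> f s.
  apply/cvgrPdist_lt => e e0; have [d d0 dh] := hasD_continuous hf e0.
  have /cvgrPdist_lt /(_ _ d0) := us; apply: filterS => k; rewrite distrC => kd.
  by rewrite distrC; apply: dh => //; have [] := Iu k.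
have E k : (f (u k) * g (u k) - f s * g s) / (u k - s) =
    f (u k) * ((g (u k) - g s) / (u k - s)) + g s * ((f (u k) - f s) / (u k - s)).
  by rewrite !mulrA -mulrDl; congr (_ / _); ring.
under eq_fun do rewrite E.
exact: cvgD (cvgM fu (hasD_seq hg Iu us))
            (cvgM (cvg_cst (g s)) (hasD_seq hf Iu us)).
Qed.

Lemma hasDZ I f s l c : hasD I f s l -> hasD I (fun r => c * f r) s (c * l).
Proof.
move=> hf; have := hasDM (hasD_cst I c s) hf.
by rewrite mulr0 addr0.
Qed.

Lemma is_deriveP (V : normedModType R) (f : V -> R) (x v : V) l :
  is_derive x v f l <-> forall e, 0 < e -> exists2 d, 0 < d &
    forall h, h != 0 -> `|h| < d -> `|(f (x + h *: v) - f x) / h - l| < e.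
Proof.
have E h : h^-1 *: ((f \o shift x) (h *: v) - f x) = (f (x + h *: v) - f x) / h.
  by rewrite -[LHS]/(h^-1 * (f (h *: v + x) - f x)) mulrC [h *: v + x]addrC.
have P : (forall e, 0 < e -> exists2 d, 0 < d &
    forall h, h != 0 -> `|h| < d -> `|(f (x + h *: v) - f x) / h - l| < e) <->
    h^-1 *: ((f \o shift x) (h *: v) - f x) @[h --> 0^'] --> l.
  rewrite (funext E).
  split=> [h|/cvgrPdist_lt h e e0].
    apply/cvgrPdist_lt => e e0; have [d d0 dh] := h _ e0.
    rewrite /dnbhs /within/=; apply/nbhs_ballP; exists d => // r /=.
    by rewrite /ball/= sub0r normrN => rd r0; rewrite distrC; exact: dh.
  have := h _ e0; rewrite /dnbhs /within/= => /nbhs_ballP[d /= d0 dh].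
  exists d => // r r0 rd; rewrite distrC; apply: dh => //.
  by rewrite /ball/= sub0r normrN.
split=> [[df dl]|h].
  by apply/P; rewrite -dl; exact: df.
have /P cl := h.
have df : derivable f x v by apply: cvgP cl.
by split => //; apply: cvg_lim => //.
Qed.

Lemma is_derive_hasD (V : normedModType R) (f : V -> R) (x v : V) l I :
  is_derive x v f l -> hasD I (fun s => f (x + s *: v)) 0 l.
Proof.
move=> /is_deriveP h; apply/hasDP => e /h[d d0 dh]; exists d => // r _ r0.
by rewrite scale0r addr0 !subr0; exact: dh.
Qed.

Lemma is_derive_hasD_at (V : normedModType R) (f : V -> R) (x v : V) l I s :
  is_derive (x + s *: v) v f l -> hasD I (fun s => f (x + s *: v)) s l.
Proof.
move=> /is_deriveP h; apply/hasDP => e /h[d d0 dh]; exists d => // r _ rs rd.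
have -> : x + r *: v = x + s *: v + (r - s) *: v.
  by rewrite -addrA -scalerDl [s + _]addrC subrK.
by apply: dh => //; rewrite subr_eq0.
Qed.

Lemma hasD_is_derive (V : normedModType R) (f : V -> R) (x v : V) l c : 0 < c ->
  hasD `[- c, c] (fun s => f (x + s *: v)) 0 l -> is_derive x v f l.
Proof.
move=> c0 /hasDP h; apply/is_deriveP => e /h[d d0 dh].
exists (Num.min c d); first by rewrite lt_min c0.
move=> r r0; rewrite lt_min => /andP[rc rd].
have := dh r; rewrite scale0r addr0 !subr0; apply => //.
by rewrite /= in_itv/= -ler_norml ltW.
Qed.

(** Strictly between [a] and [b], convexity puts a whole neighbourhood into [I], so [hasD] is an
    ordinary derivative there; at the end points only one-sided continuity is called for. *)
Lemma hasD_MVT I f (f' : R -> R) a b : convex_set I -> I a -> I b -> a < b ->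
  (forall s, I s -> hasD I f s (f' s)) ->
  exists2 c, a < c < b & f b - f a = f' c * (b - a).
Proof.
move=> cI Ia Ib ab h.
have abI c : a <= c <= b -> I c by exact: cI.
have [||c] := @MVT R f f' a b ab.
- move=> x; rewrite in_itv/= => /andP[ax xb].
  apply/is_deriveP => e e0.
  have /hasDP/(_ _ e0)[d d0 dh] := h x (abI _ (introT andP (conj (ltW ax) (ltW xb)))).
  exists (Num.min d (Num.min (x - a) (b - x))).
    by rewrite !lt_min d0 !subr_gt0 ax xb.
  move=> r r0; rewrite !lt_min => /and3P[rd ra rb].
  have := dh (x + r); rewrite addrC addrK [r + x]addrC.
  rewrite -[r *: 1]/(r * 1) mulr1; apply => //.
    apply: abI; move: ra rb; rewrite !ltr_norml => /andP[? _] /andP[_ ?].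
    by apply/andP; split; lra.
  by apply: contra_neq r0 => /(canRL (addKr _)) ->; rewrite addrC subrr.
- apply/continuous_within_itvP => //; split.
  + move=> x; rewrite in_itv/= => /andP[ax xb]; apply/cvgrPdist_lt => e e0.
    have [d d0 dh] := hasD_continuous (h x (abI _ (introT andP (conj (ltW ax) (ltW xb))))) e0.
    apply/nbhs_ballP; exists (Num.min d (Num.min (x - a) (b - x))) => /=.
      by rewrite !lt_min d0 !subr_gt0 ax xb.
    move=> r; rewrite /ball/= !lt_min distrC => /and3P[rd ra rb].
    rewrite distrC; apply: dh => //; apply: abI.
    move: ra rb; rewrite !ltr_norml => /andP[? _] /andP[_ ?].
    by apply/andP; split; lra.
  + apply/cvgrPdist_lt => e e0; have [d d0 dh] := hasD_continuous (h a Ia) e0.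
    rewrite /at_right /within/=; apply/nbhs_ballP.
    exists (Num.min d (b - a)) => /=; first by rewrite lt_min d0 subr_gt0.
    move=> r; rewrite /ball/= lt_min distrC => /andP[rd rb] ar.
    rewrite distrC; apply: dh => //; apply: abI; rewrite (ltW ar)/=.
    by move: rb; rewrite ltr_norml => /andP[_ ?]; lra.
  + apply/cvgrPdist_lt => e e0; have [d d0 dh] := hasD_continuous (h b Ib) e0.
    rewrite /at_left /within/=; apply/nbhs_ballP.
    exists (Num.min d (b - a)) => /=; first by rewrite lt_min d0 subr_gt0.
    move=> r; rewrite /ball/= lt_min distrC => /andP[rd rb] ar.
    rewrite distrC; apply: dh => //; apply: abI; rewrite (ltW ar)/= andbT.
    by move: rb; rewrite ltr_norml => /andP[? _]; lra.
- by rewrite in_itv/= => cab E; exists c.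
Qed.

Lemma hasD_MVT_sym I f (f' : R -> R) a b : convex_set I -> I a -> I b -> a != b ->
  (forall s, I s -> hasD I f s (f' s)) ->
  exists c, [/\ I c, `|c - a| < `|b - a| & (f b - f a) / (b - a) = f' c].
Proof.
move=> cI Ia Ib; rewrite neq_lt => /orP[ab|ba] h.
  have [c /andP[ac cb] E] := hasD_MVT cI Ia Ib ab h.
  exists c; split; first by apply: cI Ia Ib _; rewrite !ltW.
    by rewrite !gtr0_norm ?subr_gt0// ltrD2r.
  by rewrite E mulfK// subr_eq0 gt_eqF.
have [c /andP[bc ca] E] := hasD_MVT cI Ib Ia ba h.
exists c; split; first by apply: cI Ib Ia _; rewrite !ltW.
  by rewrite !ltr0_norm ?subr_lt0// ltrN2 ltrD2r.
by rewrite -opprB E -mulrN opprB mulfK// subr_eq0 lt_eqF.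
Qed.

(** Only one order of mixed differentiation is assumed, with [phi21] continuous along sequences at
    the single point (a, b); the existence of the other order is part of the conclusion. The double
    increment of [phi], divided by both steps, is a value of [phi21] at a nearby point. *)
Lemma clairaut I J (phi : R -> R -> R) (phi1 : R -> R) (phi2 phi21 : R -> R -> R) a b :
  convex_set I -> convex_set J -> I a -> J b -> limit_pt I a ->
  (forall r, J r -> hasD I (phi^~ r) a (phi1 r)) ->
  (forall s r, I s -> J r -> hasD J (phi s) r (phi2 s r)) ->
  (forall s r, I s -> J r -> hasD I (phi2^~ r) s (phi21 s r)) ->
  (forall u v : nat -> R, (forall k, I (u k)) -> (forall k, J (v k)) ->
    u k @[k --> \oo] --> a -> v k @[k --> \oo] --> b ->
    phi21 (u k) (v k) @[k --> \oo] --> phi21 a b) ->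
  hasD J phi1 b (phi21 a b).
Proof.
move=> cI cJ Ia Jb la h1 h2 h21 c21; apply/hasDP => e e0.
have e2 : 0 < e / 2 by rewrite divr_gt0.
have [d d0 dh] : exists2 d, 0 < d & forall s r, I s -> J r ->
    `|s - a| < d -> `|r - b| < d -> `|phi21 s r - phi21 a b| < e / 2.
  have [|d d0 dh] := @seq_limit_eps (R * R)%type (fun z => I z.1 /\ J z.2)
    (fun z => phi21 z.1 z.2) (a, b) (phi21 a b) _ _ e2.
    move=> u Iu uab; apply: c21; try by move=> k; have [] := Iu k.
    - exact: (cvg_comp _ _ uab (@cvg_fst _ _ _ _ _)).
    - exact: (cvg_comp _ _ uab (@cvg_snd _ _ _ _ _)).
  exists d => // s r Is Jr sa rb; apply: (dh (s, r)) => //.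
  by split; rewrite /ball/= distrC.
exists d => // r Jr rb rd.
have rb0 : 0 < `|r - b| by rewrite normr_gt0 subr_eq0.
(* [s] is chosen after [r], so the errors of the quotients in the first variable can be made small
   relative to [|r - b|]; after division by r - b the two of them add up to e/4. *)
have e8 : 0 < e / 8 * `|r - b| by rewrite mulr_gt0// divr_gt0.
have /hasDP/(_ _ e8)[d1 d10 dh1] := h1 r Jr.
have /hasDP/(_ _ e8)[d2 d20 dh2] := h1 b Jb.
have [|s [Is sa]] := la (Num.min d (Num.min d1 d2)).
  by rewrite !lt_min d0 d10.
rewrite !lt_min => /and3P[sd sd1 sd2].
have q1 := dh1 s Is sa sd1; have q2 := dh2 s Is sa sd2.
have br : b != r by rewrite eq_sym.
(* The mean value theorem is used in the second variable for the increment between [a] and [s], then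
   in the first variable for [phi2] at the point [xi] so found. *)
have [xi [Jxi xib Exi]] := @hasD_MVT_sym J (fun r => phi s r - phi a r)
  (fun r => phi2 s r - phi2 a r) b r cJ Jb Jr br
  (fun r Jr => hasDB (h2 _ _ Is Jr) (h2 _ _ Ia Jr)).
have as_ : a != s by rewrite eq_sym.
have [eta [Ieta etaa Eeta]] := @hasD_MVT_sym I (phi2^~ xi) (phi21^~ xi) a s cI Ia
  Is as_ (fun s Is => h21 _ _ Is Jxi).
have q3 : `|phi21 eta xi - phi21 a b| < e / 2.
  by apply: dh => //; [exact: lt_trans sd|exact: lt_trans rd].
have s0 : s - a != 0 by rewrite subr_eq0.
have r0 : r - b != 0 by rewrite subr_eq0.
set A := (phi s r - phi a r) / (s - a) in q1.
set B := (phi s b - phi a b) / (s - a) in q2.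
have E : (A - B) / (r - b) = phi21 eta xi.
  rewrite -Eeta -Exi /A /B; field; exact/andP.
have -> : (phi1 r - phi1 b) / (r - b) - phi21 a b =
   (phi21 eta xi - phi21 a b) - ((A - phi1 r) - (B - phi1 b)) / (r - b).
  by rewrite -E; field.
apply: (le_lt_trans (ler_normB _ _)).
rewrite [ltRHS]splitr; apply: (ltr_leD q3).
rewrite normrM normfV ler_pdivrMr//.
apply: (le_trans (ler_normB _ _)); apply: (le_trans (lerD (ltW q1) (ltW q2))).
rewrite -mulrDl ler_wpM2r//; lra.
Qed.

End relative_derivative.

(** * Differentiation under the integral sign *)

Section differentiation_under_integral.
Context {R : realType} d (T : measurableType d) (mu : {measure set T -> \bar R}).

(** By the mean value theorem a bound on the derivative over all of [I] bounds the difference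
    quotients as well, and dominated convergence applies to them. *)
Lemma hasD_integral (I : set R) (K K' : R -> T -> R) (g : T -> R) s :
  convex_set I -> I s -> limit_pt I s ->
  (forall r, I r -> mu.-integrable setT (EFin \o K r)) ->
  (forall r y, I r -> hasD I (K^~ y) r (K' r y)) ->
  mu.-integrable setT (EFin \o g) ->
  (forall r y, I r -> `|K' r y| <= g y) ->
  hasD I (fun r => \int[mu]_y K r y) s (\int[mu]_y K' s y).
Proof.
move=> cI Is ls iK hK ig Kg; apply: seq_hasD => u Iu us.
have iq k : mu.-integrable setT (EFin \o (fun y => (K (u k) y - K s y) / (u k - s))).
  have := integrableZl measurableT (u k - s)^-1
    (integrableB measurableT (iK _ (Iu k).1) (iK _ Is)).
  by apply: eq_integrable => // y _; rewrite /= -EFinB -EFinM mulrC.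
have E k : (\int[mu]_y K (u k) y - \int[mu]_y K s y) / (u k - s) =
    \int[mu]_y ((K (u k) y - K s y) / (u k - s)).
  rewrite RintegralZr//.
    by rewrite RintegralB//; apply: iK => //; exact: (Iu k).1.
  have := integrableB measurableT (iK _ (Iu k).1) (iK _ Is).
  by apply: eq_integrable.
under eq_fun do rewrite E.
apply: (@dominated_convergence_real _ _ _ mu _ _ g) => //.
- by move=> k; apply/measurable_EFinP; case/integrableP : (iq k).
- by move=> y; exact: hasD_seq (hK s y Is) Iu us.
- move=> k y; have [Ik ks] := Iu k.
  have sk : s != u k by rewrite eq_sym.
  have [c [Ic _ ->]] := hasD_MVT_sym cI Is Ik sk (fun r Ir => hK r y Ir).
  exact: Kg.
Qed.

End differentiation_under_integral.

(** * Flat derivatives *)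

Section unit_interval.
Context {R : realType}.
Implicit Types a b s : R.

Lemma convex_itv a b : convex_set `[a, b].
Proof.
move=> c d e; rewrite /= !in_itv/= => /andP[ac _] /andP[_ db] /andP[ce ed].
by rewrite (le_trans ac ce) (le_trans ed db).
Qed.

Lemma limit_pt_itv a b s : a < b -> a <= s <= b -> limit_pt `[a, b] s.
Proof.
move=> ab /andP[as_ sb] d d0.
have [sb'|bs] := ltP s b.
  pose h := Num.min (d / 2) (b - s).
  have h0 : 0 < h by rewrite lt_min divr_gt0// subr_gt0.
  have hd : h <= d / 2 by rewrite ge_min lexx.
  have hb : h <= b - s by rewrite ge_min lexx orbT.
  exists (s + h); split; first by rewrite /= in_itv/=; lra.
    by rewrite -subr_eq0 addrC addKr gt_eqF.
  by rewrite addrC addKr gtr0_norm//; lra.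
pose h := Num.min (d / 2) (s - a).
have h0 : 0 < h by rewrite lt_min divr_gt0// subr_gt0 (lt_le_trans ab).
have hd : h <= d / 2 by rewrite ge_min lexx.
have hb : h <= s - a by rewrite ge_min lexx orbT.
exists (s - h); split; first by rewrite /= in_itv/=; lra.
  by rewrite -subr_eq0 addrC addKr oppr_eq0 gt_eqF.
by rewrite addrC addKr normrN gtr0_norm//; lra.
Qed.

End unit_interval.

Section flat_derivative.
Context {R : realType} {n : nat}.
Local Notation E := 'cV[R]_n.
Implicit Types (mu nu m : P2 R n) (F G : P2 R n -> R) (D K : E -> R).

Local Notation I01 := (`[0, 1]%classic : set R).

(** This is the integrability clause of [is_lfd]. Requiring it for all measures at once keeps it
    available for mixtures and for Dirac masses. *)
Definition aint K : Prop := forall m, (p2prob m).-integrable setT (EFin \o K).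

Lemma aint_measurable K : aint K -> measurable_fun setT K.
Proof.
by move=> /(_ (diracP2 0))/integrableP[mK _]; exact/measurable_EFinP.
Qed.

Lemma qgrow_aint K : qgrow K -> aint K.
Proof. by move=> qK m; exact: qgrow_integrable. Qed.

Lemma aintD K D : aint K -> aint D -> aint (fun y => K y + D y).
Proof.
move=> iK iD m; have := integrableD measurableT (iK m) (iD m).
by apply: eq_integrable => // y _; rewrite /= EFinD.
Qed.

Lemma aintZ K c : aint K -> aint (fun y => c * K y).
Proof.
move=> iK m; have := integrableZl measurableT c (iK m).
by apply: eq_integrable.
Qed.

Lemma aintZr K c : aint K -> aint (fun y => K y * c).
Proof. by move=> iK; under eq_fun do rewrite mulrC; exact: aintZ. Qed.

Lemma intZr m K c : aint K -> \int[m]_y (K y * c) = \int[m]_y K y * c.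
Proof. by move=> iK; apply: RintegralZr => //; exact: iK. Qed.

Lemma aintN K : aint K -> aint (fun y => - K y).
Proof. by move=> /(aintZ (-1)); under eq_fun do rewrite mulN1r. Qed.

Lemma aintB K D : aint K -> aint D -> aint (fun y => K y - D y).
Proof. by move=> iK iD; apply: aintD => //; exact: aintN. Qed.

Lemma aint_cst (c : R) : aint (fun=> c).
Proof. exact/qgrow_aint/qgrow_cst. Qed.

Lemma aint_sum (I : Type) (s : seq I) (K : I -> E -> R) :
  (forall i, aint (K i)) -> aint (fun y => \sum_(i <- s) K i y).
Proof.
move=> qK; elim: s => [|i s IH].
  by under eq_fun do rewrite big_nil; exact: aint_cst.
by under eq_fun do rewrite big_cons; exact: aintD.
Qed.

Lemma intD m K D : aint K -> aint D ->
  \int[m]_y (K y + D y) = \int[m]_y K y + \int[m]_y D y.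
Proof. by move=> iK iD; exact: (RintegralD measurableT (iK m) (iD m)). Qed.

Lemma intB m K D : aint K -> aint D ->
  \int[m]_y (K y - D y) = \int[m]_y K y - \int[m]_y D y.
Proof. by move=> iK iD; exact: (RintegralB measurableT (iK m) (iD m)). Qed.

Lemma intZ m K c : aint K -> \int[m]_y (c * K y) = c * \int[m]_y K y.
Proof. by move=> iK; apply: RintegralZl => //; exact: iK. Qed.

Lemma intN m K : aint K -> \int[m]_y (- K y) = - \int[m]_y K y.
Proof.
move=> iK; rewrite -mulN1r -intZ//.
by apply: eq_Rintegral => y _; rewrite mulN1r.
Qed.

Lemma int_cst m (c : R) : \int[m]_y c = c.
Proof. by rewrite Rintegral_cst// [X in fine X]probability_setT mulr1. Qed.

Lemma int_sum m (I : Type) (s : seq I) (K : I -> E -> R) :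
  (forall i, aint (K i)) ->
  \int[m]_y (\sum_(i <- s) K i y) = \sum_(i <- s) \int[m]_y K i y.
Proof.
move=> qK; elim: s => [|i s IH].
  by under eq_Rintegral do rewrite big_nil; rewrite big_nil int_cst.
under eq_Rintegral do rewrite big_cons.
by rewrite big_cons intD ?IH//; exact: aint_sum.
Qed.

Lemma is_lfd_hasD F mu D nu : is_lfd F mu D ->
  hasD I01 (fun e => F (mix e mu nu)) 0 (\int[nu]_y D y - \int[mu]_y D y).
Proof.
move=> [_ /(_ nu)/cvgrPdist_lt h _]; apply/hasDP => e e0.
have := h _ e0; rewrite /at_right/= /within/= => /nbhs_ballP[d /= d0 dh].
exists d => // r; rewrite /= in_itv/= subr0 => /andP[r0 _] rn0 rd.
rewrite mix0 distrC mulrC; apply: dh; last by rewrite lt_neqAle eq_sym rn0.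
by rewrite /ball/= sub0r normrN.
Qed.

Lemma hasD_is_lfd F mu D : aint D -> \int[mu]_y D y = 0 ->
  (forall nu, hasD I01 (fun e => F (mix e mu nu)) 0 (\int[nu]_y D y)) ->
  is_lfd F mu D.
Proof.
move=> iD D0 h; split => // nu; rewrite D0 subr0.
apply/cvgrPdist_lt => e e0; have /hasDP/(_ _ e0)[d d0 dh] := h nu.
rewrite /at_right/= /within/=; apply/nbhs_ballP.
exists (Num.min d 1) => /=; first by rewrite lt_min d0 ltr01.
move=> r; rewrite /ball/= lt_min sub0r normrN => /andP[rd r1] r0.
have := dh r; rewrite mix0 subr0 mulrC distrC; apply => //; last by rewrite gt_eqF.
by rewrite /= in_itv/= (ltW r0) (le_trans (ler_norm _))// ltW.
Qed.

Let lim0 : limit_pt I01 0.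
Proof. by apply: limit_pt_itv => //; rewrite lexx ler01. Qed.

(** Testing against Dirac masses determines the derivative up to an additive constant, and the
    normalisation fixes the constant. *)
Lemma is_lfd_unique F mu D D' : is_lfd F mu D -> is_lfd F mu D' -> D = D'.
Proof.
move=> h h'; apply/funext => y; have [iD _ D0] := h; have [iD' _ D0'] := h'.
have := hasD_unique lim0 (is_lfd_hasD (nu := diracP2 y) h) (is_lfd_hasD (nu := diracP2 y) h').
rewrite D0 D0' !subr0 !int_dirac//; exact: aint_measurable.
Qed.

Lemma is_lfd_aint F mu D : is_lfd F mu D -> aint D.
Proof. by case. Qed.

Lemma is_lfd0 F mu D : is_lfd F mu D -> \int[mu]_y D y = 0.
Proof. by case. Qed.

Lemma lfdP F mu : lfd_ex F mu -> is_lfd F mu (lfd F mu).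
Proof. by move=> [D hD]; rewrite /lfd; exact: (xgetPex (fun=> 0) (ex_intro _ D hD)). Qed.

Lemma lfdE F mu D : is_lfd F mu D -> lfd F mu = D.
Proof. by move=> h; apply: is_lfd_unique (lfdP (ex_intro _ D h)) h. Qed.

(** From an interior point [m] of the segment, the directions towards [nu] and towards [mu] are
    subsegments. After rescaling, the right derivative is [a / (1 - e)] and the left one [- b / e],
    with [a], [b] the integrals of [D m] against [nu], [mu]; the normalisation (1 - e) b + e a = 0
    makes both equal to [a - b]. *)
Lemma is_lfd_seg F (D : P2 R n -> E -> R) mu nu e :
  (forall m, is_lfd F m (D m)) -> I01 e ->
  hasD I01 (fun r => F (mix r mu nu)) e
    (\int[nu]_y D (mix e mu nu) y - \int[mu]_y D (mix e mu nu) y).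
Proof.
rewrite /= in_itv/= => h e01; have /andP[e0 e1] := e01.
set m := mix e mu nu; have hm := h m; have iD := is_lfd_aint hm.
have mE : (1 - e) * \int[mu]_y D m y + e * \int[nu]_y D m y = 0.
  by rewrite -int_mix//; exact: is_lfd0.
have /hasDP hr := is_lfd_hasD (nu := nu) hm; have /hasDP hl := is_lfd_hasD (nu := mu) hm.
move: hr hl; rewrite (is_lfd0 hm) !subr0; set a := \int[nu]_y _; set b := \int[mu]_y _.
move=> hr hl.
rewrite -/a -/b in mE.
apply/hasDP => eps eps0.
have [d1 d10 dh1] : exists2 d, 0 < d & forall r, e < r <= 1 -> r - e < d ->
    `|(F (mix r mu nu) - F m) / (r - e) - (a - b)| < eps.
  have [e1'|] := ltP e 1; last by exists 1 => // r; lra.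
  have e1p : 0 < 1 - e by rewrite subr_gt0.
  have [d d0 dh] := hr _ (mulr_gt0 eps0 e1p).
  exists (d * (1 - e)); first by rewrite mulr_gt0// subr_gt0.
  move=> r /andP[er r1] rd.
  have e1n : 1 - e != 0 by rewrite gt_eqF// subr_gt0.
  pose s := (r - e) / (1 - e).
  have s0 : 0 < s by rewrite divr_gt0; lra.
  have s1 : s <= 1 by rewrite ler_pdivrMr; lra.
  have sd : s < d by rewrite ltr_pdivrMr// subr_gt0.
  have := dh s; rewrite /= in_itv/= s1 (ltW s0) subr0 gtr0_norm// gt_eqF// => /(_ erefl erefl sd).
  rewrite mix0 -[X in mix s m X](mix1 mu nu) mix_mix ?ler01 ?lexx ?s1 ?(ltW s0)//.
  rewrite (_ : e + s * (1 - e) = r); last by rewrite divfK//; lra.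
  have rn : r - e != 0 by rewrite gt_eqF// subr_gt0.
  have -> : (F (mix r mu nu) - F m) / s - a =
     (1 - e) * ((F (mix r mu nu) - F m) / (r - e) - (a - b)).
    have -> : b = - (e * a) / (1 - e).
      by apply: (mulIf e1n); rewrite divfK//; lra.
    rewrite /s; field; exact/andP.
  by rewrite normrM (@gtr0_norm _ (1 - e)) ?subr_gt0// mulrC ltr_pM2r// subr_gt0.
have [d2 d20 dh2] : exists2 d, 0 < d & forall r, 0 <= r < e -> e - r < d ->
    `|(F (mix r mu nu) - F m) / (r - e) - (a - b)| < eps.
  have [e0'|] := ltP 0 e; last by exists 1 => // r; lra.
  have [d d0 dh] := hl _ (mulr_gt0 eps0 e0').
  exists (d * e); first by rewrite mulr_gt0.
  move=> r /andP[r0 re] rd.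
  have en : e != 0 by rewrite gt_eqF.
  pose s := (e - r) / e.
  have s0 : 0 < s by rewrite divr_gt0; lra.
  have s1 : s <= 1 by rewrite ler_pdivrMr; lra.
  have sd : s < d by rewrite ltr_pdivrMr.
  have := dh s; rewrite /= in_itv/= s1 (ltW s0) subr0 gtr0_norm// gt_eqF// => /(_ erefl erefl sd).
  rewrite mix0 -[X in mix s m X](mix0 mu nu) mix_mix ?ler01 ?lexx ?s1 ?(ltW s0)//.
  rewrite (_ : e + s * (0 - e) = r); last by rewrite sub0r mulrN divfK//; lra.
  have rn : r - e != 0 by rewrite lt_eqF// subr_lt0.
  have rn' : e - r != 0 by rewrite gt_eqF// subr_gt0.
  have -> : (F (mix r mu nu) - F m) / s - b =
     - e * ((F (mix r mu nu) - F m) / (r - e) - (a - b)).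
    have -> : a = - ((1 - e) * b) / e.
      by apply: (mulIf en); rewrite divfK//; lra.
    rewrite /s; field; rewrite en rn' rn.
    by [].
  by rewrite normrM normrN (@gtr0_norm _ e)// mulrC ltr_pM2r.
exists (Num.min d1 d2); first by rewrite lt_min d10.
move=> r; rewrite /= in_itv/= lt_min => /andP[r0 r1] re /andP[rd1 rd2].
have [er|] := ltP e r.
  apply: dh1; first by rewrite er.
  by move: rd1; rewrite gtr0_norm// subr_gt0.
rewrite le_eqVlt (negPf re)/= => re'; apply: dh2; first by rewrite r0.
by move: rd2; rewrite distrC gtr0_norm// subr_gt0.
Qed.

End flat_derivative.

Section growth.
Context {R : realType} {n : nat}.
Local Notation E := 'cV[R]_n.
Implicit Types (mu nu m : P2 R n).

Lemma fnorm_le_norm2 (x : E) : fnorm x <= (n%:R + 1) * (1 + `|x| ^+ 2).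
Proof.
have h := fnorm2_le_norm x; have f0 := fnorm_ge0 x.
have : fnorm x <= 1 + fnorm x ^+ 2.
  by have := sqr_ge0 (fnorm x - 1 / 2); rewrite !expr2; lra.
move/le_trans; apply.
have n0 : 0 <= n%:R :> R by [].
have x0 := sqr_ge0 `|x|.
by rewrite mulrDl mul1r mulrDr mulr1; lra.
Qed.

Lemma qgrow_fnorm : qgrow (fun x : E => fnorm x).
Proof.
apply: (@qgrowE _ _ _ (n%:R + 1)).
  by apply: continuous_borel; exact: continuous_fnorm.
by move=> y; rewrite ger0_norm ?fnorm_ge0// fnorm_le_norm2.
Qed.

Lemma mean_ge0 m : 0 <= mean m.
Proof. by apply: Rintegral_ge0 => x _; exact: fnorm_ge0. Qed.

Lemma mean_mix e mu nu : 0 <= e <= 1 -> mean (mix e mu nu) <= mean mu + mean nu.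
Proof.
move=> e01; have i := qgrow_aint qgrow_fnorm.
rewrite /mean int_mix//; have := mean_ge0 mu; have := mean_ge0 nu.
rewrite /mean; set a := \int[_]_y _; set b := \int[_]_y _.
by move: e01 => /andP[? ?] ? ?; nra.
Qed.

Lemma mean2_mix e mu nu : 0 <= e <= 1 ->
  mean (mix e mu nu) ^+ 2 <= (mean mu + mean nu) ^+ 2.
Proof.
move=> e01; rewrite ler_sqr ?nnegrE ?addr_ge0 ?mean_ge0//; exact: mean_mix.
Qed.

(** The measure enters through its first moment, which along a segment is at most the sum of the
    moments of the end points. Bounds in this class are therefore uniform in the segment
    parameter. *)
Definition qg {X : normedModType R} (K : X -> P2 R n -> R) : Prop :=
  exists2 C, 0 <= C & forall x m, `|K x m| <= C * (1 + `|x| ^+ 2 + mean m ^+ 2).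

Definition nm2 m : R := \int[m]_y `|y| ^+ 2.

Lemma qgrow_norm2 : qgrow (fun x : E => `|x| ^+ 2).
Proof.
apply: (@qgrowE _ _ _ 1).
  apply: continuous_borel; under eq_fun do rewrite expr2.
  by apply: cont_M; exact: norm_continuous.
by move=> y; rewrite ger0_norm ?sqr_ge0// mul1r lerDr.
Qed.

Lemma int_bound m (K : E -> R) C A : aint K ->
  (forall y, `|K y| <= C * (A + `|y| ^+ 2)) ->
  `|\int[m]_y K y| <= C * (A + nm2 m).
Proof.
move=> iK KC.
have i2 : aint (fun x : E => `|x| ^+ 2) by exact/qgrow_aint/qgrow_norm2.
apply: (le_trans (le_normr_Rintegral measurableT (iK m))).
have <- : \int[m]_y (C * (A + `|y| ^+ 2)) = C * (A + nm2 m).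
  rewrite intZ ?intD ?int_cst//; first exact: aint_cst.
  by apply: aintD => //; exact: aint_cst.
apply: le_Rintegral => //.
  have := integrable_abse (iK m).
  by apply: eq_integrable.
by apply: aintZ; apply: aintD => //; exact: aint_cst.
Qed.

Lemma norm_pair_le (X Y : normedModType R) (x : X) (y : Y) :
  `|(x, y)| ^+ 2 <= `|x| ^+ 2 + `|y| ^+ 2.
Proof.
rewrite prod_normE /= /Order.max; case: ifP => _.
  by rewrite lerDr sqr_ge0.
by rewrite lerDl sqr_ge0.
Qed.

Lemma norm_fst_le (X Y : normedModType R) (x : X) (y : Y) : `|x| <= `|(x, y)|.
Proof. by rewrite prod_normE/= le_max lexx. Qed.

Lemma norm_snd_le (X Y : normedModType R) (x : X) (y : Y) : `|y| <= `|(x, y)|.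
Proof. by rewrite prod_normE/= le_max lexx orbT. Qed.

Lemma qg_pair {X : normedModType R} (K : X * E -> P2 R n -> R) mu nu : qg K ->
  exists2 C, 0 <= C & forall x y e, 0 <= e <= 1 ->
    `|K (x, y) (mix e mu nu)| <= C * ((1 + `|x| ^+ 2) + `|y| ^+ 2).
Proof.
(* The moment is absorbed as a factor, by A + M <= (1 + M) A for A >= 1 and M >= 0. *)
move=> [C C0 KC]; exists (C * (1 + (mean mu + mean nu) ^+ 2)).
  by rewrite mulr_ge0// addr_ge0// sqr_ge0.
move=> x y e e01; apply: (le_trans (KC _ _)); rewrite -mulrA ler_wpM2l//.
have h := norm_pair_le x y; have h2 := mean2_mix mu nu e01.
have := sqr_ge0 `|x|; have := sqr_ge0 `|y|; have := sqr_ge0 (mean mu + mean nu).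
by move: h h2; rewrite !expr2; nra.
Qed.

Lemma qg_fix (K : E -> P2 R n -> R) mu nu : qg K ->
  exists2 C, 0 <= C & forall y e, 0 <= e <= 1 ->
    `|K y (mix e mu nu)| <= C * (1 + `|y| ^+ 2).
Proof.
move=> [C C0 KC]; exists (C * (1 + (mean mu + mean nu) ^+ 2)).
  by rewrite mulr_ge0// addr_ge0// sqr_ge0.
move=> y e e01; apply: (le_trans (KC _ _)); rewrite -mulrA ler_wpM2l//.
have h2 := mean2_mix mu nu e01.
have := sqr_ge0 `|y|; have := sqr_ge0 (mean mu + mean nu).
by move: h2; rewrite !expr2; nra.
Qed.

Lemma qg_aint (K : E -> P2 R n -> R) m : qg K -> measurable_fun setT (K^~ m) ->
  aint (K^~ m).
Proof.
move=> qK mK; have [C C0 KC] := qg_fix m m qK.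
apply/qgrow_aint/(@qgrowE _ _ _ C) => // y.
by have := KC y 0; rewrite mix0 lexx ler01; exact.
Qed.

End growth.

Section lfd_rules.
Context {R : realType} {n : nat}.
Local Notation E := 'cV[R]_n.
Implicit Types (mu nu m : P2 R n) (F G : P2 R n -> R) (D K : E -> R).
Local Notation I01 := (`[0, 1]%classic : set R).

Lemma mem01 (e : R) : I01 e = (0 <= e <= 1).
Proof. by rewrite /= in_itv/=. Qed.

Lemma I01_0 : I01 0. Proof. by rewrite mem01 lexx ler01. Qed.

Lemma lim01 : limit_pt I01 0.
Proof. by apply: limit_pt_itv => //; rewrite lexx ler01. Qed.

Let hasD0 F mu D nu : is_lfd F mu D ->
  hasD I01 (fun e => F (mix e mu nu)) 0 (\int[nu]_y D y).
Proof. by move=> h; have := is_lfd_hasD (nu := nu) h; rewrite (is_lfd0 h) subr0. Qed.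

Lemma is_lfd_cst mu c : is_lfd (fun=> c) mu (fun=> 0).
Proof.
apply: hasD_is_lfd; [exact: aint_cst|by rewrite int_cst|move=> nu].
by rewrite int_cst; exact: hasD_cst.
Qed.

Lemma is_lfdD F G mu D K : is_lfd F mu D -> is_lfd G mu K ->
  is_lfd (fun m => F m + G m) mu (fun y => D y + K y).
Proof.
move=> hF hG; have iD := is_lfd_aint hF; have iK := is_lfd_aint hG.
apply: hasD_is_lfd; first exact: aintD.
  by rewrite intD// (is_lfd0 hF) (is_lfd0 hG) addr0.
by move=> nu; rewrite intD//; apply: hasDD; exact: hasD0.
Qed.

Lemma is_lfdZ F mu D c : is_lfd F mu D ->
  is_lfd (fun m => c * F m) mu (fun y => c * D y).
Proof.
move=> hF; have iD := is_lfd_aint hF.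
apply: hasD_is_lfd; first exact: aintZ.
  by rewrite intZ// (is_lfd0 hF) mulr0.
by move=> nu; rewrite intZ//; apply: hasDZ; exact: hasD0.
Qed.

Lemma is_lfdN F mu D : is_lfd F mu D -> is_lfd (fun m => - F m) mu (fun y => - D y).
Proof.
move=> /(is_lfdZ (-1)); under eq_fun do rewrite mulN1r.
by under [X in is_lfd _ _ X -> _]eq_fun do rewrite mulN1r.
Qed.

Lemma is_lfdB F G mu D K : is_lfd F mu D -> is_lfd G mu K ->
  is_lfd (fun m => F m - G m) mu (fun y => D y - K y).
Proof. by move=> hF hG; apply: is_lfdD => //; exact: is_lfdN. Qed.

Lemma is_lfdM F G mu D K : is_lfd F mu D -> is_lfd G mu K ->
  is_lfd (fun m => F m * G m) mu (fun y => D y * G mu + F mu * K y).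
Proof.
move=> hF hG; have iD := is_lfd_aint hF; have iK := is_lfd_aint hG.
have -> : (fun y => D y * G mu + F mu * K y) =
  (fun y => F mu * K y + G mu * D y) by apply/funext => y; ring.
apply: hasD_is_lfd; first by apply: aintD; exact: aintZ.
  rewrite intD; [|exact: aintZ|exact: aintZ].
  by rewrite !intZ// (is_lfd0 hF) (is_lfd0 hG) !mulr0 addr0.
move=> nu; rewrite intD; [|exact: aintZ|exact: aintZ]; rewrite !intZ//.
by have := hasDM (hasD0 (nu := nu) hF) (hasD0 (nu := nu) hG); rewrite mix0.
Qed.

Lemma is_lfd_sum (I : Type) (s : seq I) (F : I -> P2 R n -> R) mu (D : I -> E -> R) :
  (forall i, is_lfd (F i) mu (D i)) ->
  is_lfd (fun m => \sum_(i <- s) F i m) mu (fun y => \sum_(i <- s) D i y).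
Proof.
move=> h; elim: s => [|i s IH].
  under eq_fun do rewrite big_nil.
  by under [X in is_lfd _ _ X]eq_fun do rewrite big_nil; exact: is_lfd_cst.
under eq_fun do rewrite big_cons.
by under [X in is_lfd _ _ X]eq_fun do rewrite big_cons; exact: is_lfdD.
Qed.

Lemma int_swap (K : E * E -> R) mu nu C : measurable_fun setT K ->
  (forall x y, `|K (x, y)| <= C * ((1 + `|x| ^+ 2) + `|y| ^+ 2)) ->
  [/\ (p2prob mu \x p2prob nu)%E.-integrable setT (EFin \o K),
      aint (fun x => \int[nu]_y K (x, y)),
      aint (fun y => \int[mu]_x K (x, y)),
      \int[(p2prob mu \x p2prob nu)%E]_z K z = \int[mu]_x \int[nu]_y K (x, y)
    & \int[mu]_x \int[nu]_y K (x, y) = \int[nu]_y \int[mu]_x K (x, y)].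
Proof.
move=> mK KC.
have i2 : aint (fun x : E => C * `|x| ^+ 2).
  by apply: aintZ; exact/qgrow_aint/qgrow_norm2.
have i1 : aint (fun x : E => C * (1 + `|x| ^+ 2)).
  by apply: aintZ; apply: aintD; [exact: aint_cst|exact/qgrow_aint/qgrow_norm2].
have KC1 x y : `|K (x, y)| <= C * (1 + `|x| ^+ 2) + C * `|y| ^+ 2.
  by apply: (le_trans (KC x y)); rewrite -mulrDr.
have KC2 x y : `|K (y, x)| <= C * (1 + `|x| ^+ 2) + C * `|y| ^+ 2.
  by apply: (le_trans (KC y x)); rewrite -mulrDr; rewrite addrAC.
have mK' : measurable_fun setT (fun z : E * E => K (z.2, z.1)).
  by apply: (measurableT_comp mK); exact: measurable_swap.
split.
- exact: (integrable_prod mK (i1 mu) (i2 nu) KC1).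
- by move=> m; exact: (integrable_sec1_int mK (i1 m) (i2 nu) KC1).
- by move=> m; exact: (integrable_sec1_int mK' (i1 m) (i2 mu) KC2).
- exact: (Rintegral_prod1 mK (i1 mu) (i2 nu) KC1).
- by rewrite -(Rintegral_prod1 mK (i1 mu) (i2 nu) KC1)
    -(Rintegral_prod2 mK (i1 mu) (i2 nu) KC1).
Qed.

(** The measure occurs twice, as integrator and as argument of [G]. Along a segment the integrator
    is affine in the parameter, so the product rule combines its slope with the derivative of [G]
    under a frozen integral. *)
Lemma is_lfd_integral (G : E -> P2 R n -> R) (dG : E * E -> P2 R n -> R) mu :
  (forall y m, is_lfd (G y) m (fun z => dG (y, z) m)) ->
  (forall m, measurable_fun setT (G^~ m)) ->
  (forall m, measurable_fun setT (dG^~ m)) -> qg G -> qg dG ->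
  is_lfd (fun m => \int[m]_y G y m) mu
    (fun z => G z mu - \int[mu]_y G y mu + \int[mu]_y dG (y, z) mu).
Proof.
move=> hG mG mdG qG qdG.
have iG m : aint (G^~ m) by exact: qg_aint.
have idG y m : aint (fun z => dG (y, z) m) by exact: is_lfd_aint (hG y m).
have sw m1 nu m2 : [/\ (p2prob m1 \x p2prob nu)%E.-integrable setT (EFin \o dG^~ m2),
      aint (fun x => \int[nu]_y dG (x, y) m2),
      aint (fun y => \int[m1]_x dG (x, y) m2),
      \int[(p2prob m1 \x p2prob nu)%E]_z dG z m2 = \int[m1]_x \int[nu]_y dG (x, y) m2
    & \int[m1]_x \int[nu]_y dG (x, y) m2 = \int[nu]_y \int[m1]_x dG (x, y) m2].
  have [C C0 dGC] := qg_pair m2 m2 qdG.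
  apply: (@int_swap (dG^~ m2) m1 nu C) => // x y.
  by have := dGC x y 0; rewrite mix0 lexx ler01; exact.
have iD0 : aint (fun z => G z mu - \int[mu]_y G y mu).
  by apply: aintB => //; exact: aint_cst.
have iD1 : aint (fun z => \int[mu]_y dG (y, z) mu) by have [] := sw mu mu mu.
have dG0 y m : \int[m]_z dG (y, z) m = 0 by exact: is_lfd0 (hG y m).
have intE nu : \int[nu]_z (G z mu - \int[mu]_y G y mu + \int[mu]_y dG (y, z) mu) =
    \int[nu]_y G y mu - \int[mu]_y G y mu + \int[mu]_y \int[nu]_z dG (y, z) mu.
  rewrite intD// intB//; last exact: aint_cst.
  by rewrite int_cst; have [_ _ _ _ ->] := sw mu nu mu.
apply: hasD_is_lfd; first exact: aintD.
  rewrite intE subrr add0r -[RHS](int_cst mu).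
  by apply: eq_Rintegral => y _; exact: dG0.
move=> nu; rewrite intE.
(* Here the integrating measure [m] is frozen; [g] bounds the segment derivative of [G y] for all
   parameters in [0, 1]. *)
have key m : hasD I01 (fun e => \int[m]_y G y (mix e mu nu)) 0
    (\int[m]_y (\int[nu]_z dG (y, z) mu)).
  have [C C0 dGC] := qg_pair mu nu qdG.
  pose g (y : E) := C * ((1 + `|y| ^+ 2) + nm2 nu) + C * ((1 + `|y| ^+ 2) + nm2 mu).
  have := @hasD_integral R _ E m I01 (fun e y => G y (mix e mu nu))
    (fun e y => \int[nu]_z dG (y, z) (mix e mu nu) - \int[mu]_z dG (y, z) (mix e mu nu))
    g 0 (@convex_itv _ _ _) I01_0 lim01.
  rewrite mix0; under [X in hasD _ _ _ X]eq_Rintegral do rewrite dG0 subr0.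
  apply.
  - by move=> r _; exact: iG.
  - by move=> r y rI; exact: (@is_lfd_seg R n (G y) (fun m z => dG (y, z) m) mu nu r (hG y) rI).
  - apply: aintD; apply: aintZ; apply: aintD; try exact: aint_cst;
      apply: aintD; try exact: aint_cst; exact/qgrow_aint/qgrow_norm2.
  - move=> r y; rewrite mem01 => r01; apply: (le_trans (ler_normB _ _)).
    by apply: lerD; apply: int_bound => // z; exact: dGC.
(* Product rule for (1 - e) times the integral against [mu] plus e times the integral against
   [nu]. *)
have h := hasDD (hasDM (hasDB (hasD_cst I01 1 0) (hasD_id I01 0)) (key mu))
  (hasDM (hasD_id I01 0) (key nu)).
rewrite !mix0 in h.
apply: hasD_ext (I01_0) _ _; last by apply: (hasD_eq h); ring.
move=> e; rewrite inE mem01 => e01 /=.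
by rewrite int_mix//; exact: iG.
Qed.

End lfd_rules.

Lemma limit_pt_convex {R : realType} (I : set R) s0 s :
  convex_set I -> I s0 -> limit_pt I s0 -> I s -> limit_pt I s.
Proof.
move=> cI Is0 ls0 Is d d0; have [->|ss0] := eqVneq s s0; first exact: ls0.
pose h := Num.min 1 (d / 2 / `|s0 - s|).
have ss0' : 0 < `|s0 - s| by rewrite normr_gt0 subr_eq0 eq_sym.
have h0 : 0 < h by rewrite lt_min ltr01 !divr_gt0.
have h1 : h <= 1 by rewrite ge_min lexx.
have hd : h * `|s0 - s| <= d / 2 by rewrite -ler_pdivlMr// ge_min lexx orbT.
exists (s + h * (s0 - s)); split.
- have [le|/ltW le] := leP s s0; first by apply: (cI s s0) => //; nra.
  by apply: (cI s0 s) => //; nra.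
- by rewrite -subr_eq0 addrC addKr mulf_eq0 negb_or gt_eqF//= subr_eq0 eq_sym.
- rewrite addrC addKr normrM (gtr0_norm h0); lra.
Qed.

Section lfd_commutation.
Context {R : realType} {n : nat}.
Local Notation E := 'cV[R]_n.
Implicit Types (mu nu m : P2 R n) (F G : P2 R n -> R).
Local Notation I01 := (`[0, 1]%classic : set R).

(* Clairaut's theorem for a real parameter and the segments of P2 *)
Lemma is_lfd_deriv (I : set R) s0 (F : R -> P2 R n -> R) (F' : P2 R n -> R)
    (dF dd : R -> P2 R n -> E -> R) mu :
  convex_set I -> I s0 -> limit_pt I s0 ->
  (forall m, hasD I (F^~ m) s0 (F' m)) ->
  (forall s m, I s -> is_lfd (F s) m (dF s m)) ->
  (forall s m z, I s -> hasD I (fun r => dF r m z) s (dd s m z)) ->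
  (forall s m, I s -> measurable_fun setT (dd s m)) ->
  (exists2 C, 0 <= C & forall s m z, I s ->
     `|dd s m z| <= C * (1 + `|z| ^+ 2 + mean m ^+ 2)) ->
  (forall nu z (u v : nat -> R), (forall k, I (u k)) -> (forall k, I01 (v k)) ->
     u k @[k --> \oo] --> s0 -> v k @[k --> \oo] --> 0 ->
     dd (u k) (mix (v k) mu nu) z @[k --> \oo] --> dd s0 mu z) ->
  is_lfd F' mu (dd s0 mu).
Proof.
move=> cI Is0 ls0 hF hdF hdd mdd [C C0 ddC] cdd.
have i2 : aint (fun x : E => `|x| ^+ 2) by exact/qgrow_aint/qgrow_norm2.
pose g M z : R := C * (1 + M) * (1 + `|z : E| ^+ 2).
have ig M : aint (g M).
  by apply: aintZ; apply: aintD => //; exact: aint_cst.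
have ddg s m M z : I s -> mean m ^+ 2 <= M -> `|dd s m z| <= g M z.
  move=> Is mM; apply: (le_trans (ddC s m z Is)).
  rewrite /g -mulrA ler_wpM2l//; have := sqr_ge0 `|z|; have := sqr_ge0 (mean m).
  nra.
have idd s m : I s -> aint (dd s m).
  move=> Is m'; apply: (@dominated_integrable_real _ _ _ _ _ (g (mean m ^+ 2))).
  - exact: mdd.
  - exact: ig.
  - by move=> z; exact: ddg.
have idF s m : I s -> aint (dF s m) by move=> Is; exact: is_lfd_aint (hdF s m Is).
have hint s m m' : I s -> hasD I (fun r => \int[m']_z dF r m z) s (\int[m']_z dd s m z).
  move=> Is; have ls := limit_pt_convex cI Is0 ls0 Is.
  apply: (@hasD_integral R _ _ m' I (fun r z => dF r m z) (fun r z => dd r m z)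
    (g (mean m ^+ 2)) s cI Is ls) => //.
  - by move=> r Ir; exact: idF.
  - by move=> r y Ir; exact: hdd.
  - exact: ig.
  - by move=> r y Ir; exact: ddg.
(* The zero mean of [dF s mu] holds for every [s], so its derivative in [s] vanishes. *)
have dd0 : \int[mu]_z dd s0 mu z = 0.
  apply: (hasD_unique ls0 (hint s0 mu mu Is0)).
  apply: hasD_ext (Is0) _ (hasD_cst I 0 s0) => r; rewrite inE => Ir.
  by rewrite (is_lfd0 (hdF r mu Ir)).
apply: hasD_is_lfd => //; first exact: idd.
move=> nu.
(* The mixed derivative in the order segment first, parameter second; at the origin its second term
   vanishes by [dd0]. *)
pose phi21 s e := \int[nu]_z dd s (mix e mu nu) z - \int[mu]_z dd s (mix e mu nu) z.
have E0 : phi21 s0 0 = \int[nu]_z dd s0 mu z by rewrite /phi21 mix0 dd0 subr0.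
rewrite -E0.
apply: (@clairaut R I I01 (fun s e => F s (mix e mu nu)) (fun e => F' (mix e mu nu))
  (fun s e => \int[nu]_z dF s (mix e mu nu) z - \int[mu]_z dF s (mix e mu nu) z)
  phi21 s0 0 cI (@convex_itv _ _ _) Is0 I01_0 ls0).
- by move=> r _; exact: hF.
- move=> s r Is Ir.
  exact: (@is_lfd_seg R n (F s) (dF s) mu nu r (fun m => hdF s m Is) Ir).
- by move=> s r Is Ir; apply: hasDB; exact: hint.
- move=> u v Iu Iv us v0; rewrite /phi21.
  have cv m' : \int[m']_z dd (u k) (mix (v k) mu nu) z @[k --> \oo] -->
      \int[m']_z dd s0 (mix 0 mu nu) z.
    rewrite mix0; apply: (@dominated_convergence_real _ _ _ m' _ _
      (g ((mean mu + mean nu) ^+ 2))) => //.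
    + by move=> k; exact: mdd.
    + by move=> z; exact: cdd.
    + exact: ig.
    + move=> k z; apply: ddg => //; apply: mean2_mix.
      by have := Iv k; rewrite mem01.
  exact: cvgB (cv nu) (cv mu).
Qed.

End lfd_commutation.

(** * Symmetry of the second flat derivative *)

Section lfd_symmetry.
Context {R : realType} {n : nat}.
Local Notation E := 'cV[R]_n.
Implicit Types (mu nu m : P2 R n).
Local Notation I01 := (`[0, 1]%classic : set R).

Lemma moment2_mix e mu nu : 0 <= e <= 1 ->
  moment2 (mix e mu nu) = (1 - e) * moment2 mu + e * moment2 nu.
Proof.
move=> e01; rewrite /moment2 int_mix//.
- apply: (@qgrow_integrable R n mu (fun x => fnorm x ^+ 2)); split.
    by apply/measurable_EFinP; exact: measurable_fnorm2.
  exists n%:R => y; rewrite ger0_norm ?sqr_ge0//.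
  by rewrite (le_trans (fnorm2_le_norm y))// ler_wpM2l// lerDr.
- apply: (@qgrow_integrable R n nu (fun x => fnorm x ^+ 2)); split.
    by apply/measurable_EFinP; exact: measurable_fnorm2.
  exists n%:R => y; rewrite ger0_norm ?sqr_ge0//.
  by rewrite (le_trans (fnorm2_le_norm y))// ler_wpM2l// lerDr.
Qed.

Lemma mix_seq_cvg (v : nat -> R) mu nu : (forall k, I01 (v k)) ->
  v k @[k --> \oo] --> 0 -> mix (v k) mu nu @[k --> \oo] --> mu.
Proof.
move=> Iv v0; apply: mix_cvg.
  by apply: nearW => k; have := Iv k; rewrite mem01.
rewrite -[X in _ --> X](mul0r (moment2 mu + moment2 nu)).
by apply: cvgM v0 _; exact: cvg_cst.
Qed.

Lemma mix_mix_cvg (a b : nat -> R) mu nu pi :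
  (forall k, I01 (a k)) -> (forall k, I01 (b k)) ->
  a k @[k --> \oo] --> 0 -> b k @[k --> \oo] --> 0 ->
  mix (a k) (mix (b k) mu nu) pi @[k --> \oo] --> mu.
Proof.
move=> Ia Ib a0 b0.
have a01 k : 0 <= a k <= 1 by have := Ia k; rewrite mem01.
have b01 k : 0 <= b k <= 1 by have := Ib k; rewrite mem01.
(* The weights of [mix_assoc]. If [c k] is zero then so is [a k], and the convention that division
   by zero gives zero keeps [a k / c k] a legitimate weight. *)
pose c k := a k + b k - a k * b k.
have c01 k : 0 <= c k <= 1.
  have /andP[? ?] := a01 k; have /andP[? ?] := b01 k.
  by rewrite /c; apply/andP; split; nra.
have d01 k : 0 <= a k / c k <= 1.
  have /andP[? ?] := a01 k; have /andP[? ?] := b01 k; have /andP[c0 _] := c01 k.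
  have [->|cn] := eqVneq (c k) 0; first by rewrite invr0 mulr0 lexx ler01.
  have cp : 0 < c k by rewrite lt_neqAle eq_sym cn.
  by rewrite divr_ge0//= ler_pdivrMr// mul1r /c; nra.
have cd k : c k * (a k / c k) = a k.
  have /andP[? ?] := a01 k; have /andP[? ?] := b01 k.
  have [c0|cn] := eqVneq (c k) 0; last by rewrite mulrC divfK.
  by rewrite c0 mul0r; move: c0; rewrite /c; nra.
have E k : mix (a k) (mix (b k) mu nu) pi = mix (c k) mu (mix (a k / c k) nu pi).
  by apply: mix_assoc => //; rewrite /c; ring.
rewrite (funext E); apply: mix_cvg; first exact: nearW.
(* The moment of the moving endpoint is split so that the quotient a / c disappears; each of the
   three coefficients left tends to zero. *)
have E2 k : c k * (moment2 mu + moment2 (mix (a k / c k) nu pi)) =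
   c k * moment2 mu + (c k - a k) * moment2 nu + a k * moment2 pi.
  rewrite moment2_mix// mulrDr -addrA; congr (_ + _).
  rewrite -[in RHS](cd k) mulrDr !mulrA; congr (_ + _); ring.
rewrite (funext E2).
have c0 : c k @[k --> \oo] --> 0.
  rewrite (_ : 0 = 0 + 0 - 0 * 0); last by ring.
  exact: cvgB (cvgD a0 b0) (cvgM a0 b0).
rewrite (_ : 0 = 0 * moment2 mu + (0 - 0) * moment2 nu + 0 * moment2 pi); last by ring.
exact: cvgD (cvgD (cvgM c0 (cvg_cst (moment2 mu)))
  (cvgM (cvgB c0 a0) (cvg_cst (moment2 nu)))) (cvgM a0 (cvg_cst (moment2 pi))).
Qed.

(* Both mixed derivatives of (a, b) |-> F ((1-a)((1-b)mu + b delta_z) + a delta_y)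
   at the origin are computed; the normalisation of the flat derivative accounts
   for the first-order terms. *)
Lemma lfd2_sym (F : P2 R n -> R) (dF : E -> P2 R n -> R) (d2F : E * E -> P2 R n -> R)
    mu y z :
  (forall m, is_lfd F m (dF^~ m)) ->
  (forall x m, is_lfd (dF x) m (fun w => d2F (x, w) m)) ->
  (forall m, measurable_fun setT (d2F^~ m)) -> qg dF -> qg d2F ->
  (forall x, {for mu, continuous (dF x)}) ->
  (forall x, {for mu, continuous (d2F x)}) ->
  d2F (y, z) mu + dF z mu = d2F (z, y) mu + dF y mu.
Proof.
move=> hF hdF md2 qd qd2 cd cd2.
have idF m : aint (dF^~ m) by exact: is_lfd_aint (hF m).
have id2 x m : aint (fun w => d2F (x, w) m) by exact: is_lfd_aint (hdF x m).
have mdF m : measurable_fun setT (dF^~ m) by exact: aint_measurable.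
(* the normalisation of dF, differentiated *)
have nrm w : \int[mu]_u d2F (u, w) mu = - dF w mu.
  have h := is_lfd_integral mu hdF mdF md2 qd qd2.
  have E0 : (fun m => \int[m]_u dF u m) = (fun=> 0).
    by apply/funext => m; exact: is_lfd0 (hF m).
  rewrite E0 in h.
  have := congr1 (@^~ w) (is_lfd_unique h (is_lfd_cst mu 0)) => /=.
  rewrite (is_lfd0 (hF mu)) subr0 => /eqP.
  by rewrite addr_eq0 -eqr_oppLR => /eqP <-.
have nrm2 u : \int[mu]_w d2F (u, w) mu = 0 by exact: is_lfd0 (hdF u mu).
have i2 : aint (fun x : E => `|x| ^+ 2) by exact/qgrow_aint/qgrow_norm2.
have ig C M : aint (fun w : E => C * (M + `|w| ^+ 2)).
  by apply: aintZ; apply: aintD => //; exact: aint_cst.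
have sw m1 m2 m : [/\ aint (fun x => \int[m2]_y d2F (x, y) m),
      aint (fun y => \int[m1]_x d2F (x, y) m)
    & \int[m1]_x \int[m2]_y d2F (x, y) m = \int[m2]_y \int[m1]_x d2F (x, y) m].
  have [C C0 dGC] := qg_pair m m qd2.
  have [|_ h1 h2 _ h3] := @int_swap R n (d2F^~ m) m1 m2 C (md2 m).
    by move=> x w; have := dGC x w 0; rewrite mix0 lexx ler01; exact.
  by split.
pose ma a b := mix a (mix b mu (diracP2 z)) (diracP2 y).
pose phi1 b := dF y (mix b mu (diracP2 z)).
(* For fixed [a], moving [b] follows a segment whose end points differ by (1 - a)(delta_z - mu);
   hence the factor. Its own derivative in [a] is the source of the last term of [phi21]. *)
pose phi2 a b := (1 - a) * (dF z (ma a b) - \int[mu]_u dF u (ma a b)).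
pose in2 a b u := d2F (u, y) (ma a b) - \int[mix b mu (diracP2 z)]_w d2F (u, w) (ma a b).
pose phi21 a b := (1 - a) * (in2 a b z - \int[mu]_u in2 a b u)
   + (dF z (ma a b) - \int[mu]_u dF u (ma a b)) * (- 1).
have ma0 b : ma 0 b = mix b mu (diracP2 z) by rewrite /ma mix0.
have in2E a b u : 0 <= b <= 1 -> in2 a b u = d2F (u, y) (ma a b)
    - ((1 - b) * \int[mu]_w d2F (u, w) (ma a b) + b * d2F (u, z) (ma a b)).
  move=> b01; rewrite /in2 int_mix//; try exact: id2.
  by rewrite int_dirac//; apply: aint_measurable.
have meanma a b : 0 <= a <= 1 -> 0 <= b <= 1 ->
    mean (ma a b) ^+ 2 <= (mean mu + mean (diracP2 z) + mean (diracP2 y)) ^+ 2.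
  move=> a01 b01; apply: (le_trans (mean2_mix _ _ a01)).
  rewrite ler_sqr ?nnegrE ?addr_ge0 ?mean_ge0// lerD2r.
  exact: mean_mix.
set MM := (_ + _ + _) ^+ 2 in meanma.
have [C C0 dC] := qd2; have [D D0 dD] := qd.
have MM0 : 0 <= MM by exact: sqr_ge0.
have d2b a b u w : 0 <= a <= 1 -> 0 <= b <= 1 ->
    `|d2F (u, w) (ma a b)| <= C * ((1 + `|u| ^+ 2 + MM) + `|w| ^+ 2).
  move=> a01 b01; apply: (le_trans (dC _ _)); rewrite ler_wpM2l//.
  by have := norm_pair_le u w; have := meanma _ _ a01 b01; lra.
have db a b u : 0 <= a <= 1 -> 0 <= b <= 1 ->
    `|dF u (ma a b)| <= D * ((1 + MM) + `|u| ^+ 2).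
  move=> a01 b01; apply: (le_trans (dD _ _)); rewrite ler_wpM2l//.
  by have := meanma _ _ a01 b01; lra.
have in2b a b u : 0 <= a <= 1 -> 0 <= b <= 1 -> `|in2 a b u| <=
    C * ((1 + `|u| ^+ 2 + MM) + `|y| ^+ 2) +
    (C * ((1 + `|u| ^+ 2 + MM) + nm2 mu) + C * ((1 + `|u| ^+ 2 + MM) + `|z| ^+ 2)).
  move=> a01 b01; rewrite in2E//; apply: (le_trans (ler_normB _ _)).
  apply: lerD; first exact: d2b.
  apply: (le_trans (ler_normD _ _)); have /andP[b0 b1] := b01.
  apply: lerD.
    rewrite normrM; apply: (@le_trans _ _ (1 * `|\int[mu]_w d2F (u, w) (ma a b)|)).
      by rewrite ler_wpM2r// ger0_norm; lra.
    by rewrite mul1r; apply: int_bound => // w; exact: d2b.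
  rewrite normrM; apply: (@le_trans _ _ (1 * `|d2F (u, z) (ma a b)|)).
    by rewrite ler_wpM2r// ger0_norm.
  by rewrite mul1r; exact: d2b.
(* A section in the first variable is an integral against a Dirac mass in the second, so the Fubini
   statement [sw] covers it. *)
have isec w m : aint (fun u => d2F (u, w) m).
  have -> : (fun u => d2F (u, w) m) = (fun u => \int[diracP2 w]_v d2F (u, v) m).
    by apply/funext => u; rewrite int_dirac//; exact: aint_measurable.
  by have [] := sw mu (diracP2 w) m.
have iin2 a b : 0 <= a <= 1 -> 0 <= b <= 1 -> aint (in2 a b).
  by move=> a01 b01; apply: aintB => //; have [] := sw mu (mix b mu (diracP2 z)) (ma a b).
pose gin2 (u : E) := C * ((1 + `|u| ^+ 2 + MM) + `|y| ^+ 2) +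
    (C * ((1 + `|u| ^+ 2 + MM) + nm2 mu) + C * ((1 + `|u| ^+ 2 + MM) + `|z| ^+ 2)).
have igin2 : aint gin2.
  have ii A : aint (fun u : E => C * ((1 + `|u| ^+ 2 + MM) + A)).
    by apply: aintZ; do 2 (apply: aintD; last exact: aint_cst);
      apply: aintD => //; exact: aint_cst.
  by apply: aintD => //; exact: aintD.
have lim := hasD_unique (@lim01 R).
have main : hasD I01 phi1 0 (phi21 0 0).
  apply: (@clairaut R I01 I01 (fun a b => F (ma a b)) phi1 phi2 phi21 0 0
    (@convex_itv _ _ _) (@convex_itv _ _ _) I01_0 I01_0 (@lim01 R)).
  - move=> b _; have := is_lfd_hasD (nu := diracP2 y) (hF (mix b mu (diracP2 z))).
    rewrite int_dirac// (is_lfd0 (hF _)) subr0; exact.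
  - move=> a b Ia Ib; have a01 : 0 <= a <= 1 by rewrite -mem01.
    have b01 : 0 <= b <= 1 by rewrite -mem01.
    (* By [mix_comm], [ma a b] is the mixture with weight [b] of [mix a mu (diracP2 y)] and
       [mix a (diracP2 z) (diracP2 y)], so [is_lfd_seg] applies in [b]. *)
    apply: hasD_ext (Ib) _ _; last first.
      apply: hasD_eq; first exact: (is_lfd_seg (mu := mix a mu (diracP2 y))
        (nu := mix a (diracP2 z) (diracP2 y)) hF Ib).
      rewrite !(int_mix a01 (idF _ _) (idF _ _)) !(int_dirac _ (mdF _)).
      rewrite /phi2 /ma (mix_comm _ _ _ a01 b01); ring.
    by move=> r; rewrite inE mem01 => r01 /=; rewrite /ma (mix_comm mu _ _ a01 r01).
  - move=> a b Ia Ib; have a01 : 0 <= a <= 1 by rewrite -mem01.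
    have b01 : 0 <= b <= 1 by rewrite -mem01.
    have h2 u r : I01 r -> hasD I01 (fun a => dF u (ma a b)) r (in2 r b u).
      move=> Ir; have := is_lfd_seg (mu := mix b mu (diracP2 z)) (nu := diracP2 y)
        (hdF u) Ir.
      by rewrite int_dirac//; exact: aint_measurable.
    apply: hasD_eq.
      apply: hasDM (hasDB (hasD_cst I01 1 a) (hasD_id I01 a)) (hasDB (h2 z a Ia) _).
      apply: (@hasD_integral R _ _ mu I01 (fun r u => dF u (ma r b))
        (fun r u => in2 r b u) gin2 a (@convex_itv _ _ _) Ia) => //.
      + exact: (limit_pt_convex (@convex_itv R 0 1) I01_0 (@lim01 R) Ia).
      + by move=> r _; exact: idF.
      + by move=> r u Ir; exact: h2.
      + exact: igin2.
      + by move=> r u Ir; apply: in2b => //; rewrite -mem01.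
    by rewrite /phi21 sub0r.
  - move=> a b Ia Ib a0 b0.
    have a01 k : 0 <= a k <= 1 by rewrite -mem01.
    have b01 k : 0 <= b k <= 1 by rewrite -mem01.
    have cm := @mix_mix_cvg a b mu (diracP2 z) (diracP2 y) Ia Ib a0 b0.
    have m00 : ma 0 0 = mu by rewrite ma0 mix0.
    have cd' u : dF u (ma (a k) (b k)) @[k --> \oo] --> dF u (ma 0 0).
      by rewrite m00; exact: (cvg_comp _ _ cm (cd u)).
    have cd2' u : d2F u (ma (a k) (b k)) @[k --> \oo] --> d2F u (ma 0 0).
      by rewrite m00; exact: (cvg_comp _ _ cm (cd2 u)).
    have cin2 u : in2 (a k) (b k) u @[k --> \oo] --> in2 0 0 u.
      rewrite in2E ?lexx ?ler01//; under eq_fun do rewrite in2E//.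
      apply: cvgB; first exact: cd2'.
      apply: cvgD; apply: cvgM.
      + by apply: cvgB b0; exact: cvg_cst.
      + apply: (@dominated_convergence_real _ _ _ mu _ _
          (fun w => C * ((1 + `|u| ^+ 2 + MM) + `|w| ^+ 2))).
        * by move=> k; apply: aint_measurable.
        * by move=> w; exact: cd2'.
        * exact: ig.
        * by move=> k w; exact: d2b.
      + exact: b0.
      + exact: cd2'.
    apply: cvgD; apply: cvgM.
    + by apply: cvgB a0; exact: cvg_cst.
    + apply: cvgB; first exact: cin2.
      apply: (@dominated_convergence_real _ _ _ mu _ _ gin2).
      * by move=> k; apply: aint_measurable; exact: iin2.
      * exact: cin2.
      * exact: igin2.
      * by move=> k w; exact: in2b.
    + apply: cvgB; first exact: cd'.
      apply: (@dominated_convergence_real _ _ _ mu _ _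
          (fun w => D * ((1 + MM) + `|w| ^+ 2))).
      * by move=> k.
      * by move=> w; exact: cd'.
      * exact: ig.
      * by move=> k w; exact: db.
    + exact: cvg_cst.
(* Differentiated directly, [phi1] has slope [d2F (y, z) mu]; comparison with Clairaut's value,
   where [nrm] evaluates the averages in the first variable, is the claim. *)
have := hasD_unique (@lim01 R) main (is_lfd_hasD (nu := diracP2 z) (hdF y mu)).
rewrite int_dirac; last exact: aint_measurable.
rewrite nrm2 /phi21 (ma0 0) mix0 (is_lfd0 (hF mu)).
have in20 u : in2 0 0 u = d2F (u, y) mu.
  by rewrite in2E ?lexx ?ler01// (ma0 0) mix0 nrm2 mulr0 mul0r addr0 subr0.
have -> : \int[mu]_u in2 0 0 u = \int[mu]_u d2F (u, y) mu.
  by apply: eq_Rintegral => u _; exact: in20.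
rewrite in20 nrm; lra.
Qed.

End lfd_symmetry.

(** * Derivatives in space *)

Section directional_derivatives.
Context {R : realType}.
Implicit Types X Y : normedModType R.
Local Notation I11 := (`[- 1, 1]%classic : set R).

Let lim11 : limit_pt I11 0.
Proof. by apply: limit_pt_itv; [lra|rewrite lerN10 ler01]. Qed.

Let I11_0 : I11 0.
Proof. by rewrite /= in_itv/= lerN10 ler01. Qed.

Lemma seq_line_cvg X (x u v : X) (a b : nat -> R) :
  a k @[k --> \oo] --> 0 -> b k @[k --> \oo] --> 0 ->
  x + a k *: u + b k *: v @[k --> \oo] --> x.
Proof.
move=> a0 b0; rewrite -[X in _ --> X]addr0 -[X in _ --> X + _]addr0.
apply: cvgD; first apply: cvgD.
- exact: cvg_cst.
- by rewrite -(scale0r u); apply: cvgZr_tmp.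
- by rewrite -(scale0r v); apply: cvgZr_tmp.
Qed.

(** The real-variable theorem on the plane of points x + r v + s u with both parameters in
    [-1, 1]. *)
Lemma clairaut_dir X (u v : X) (K Ku Kv W : X -> R) :
  (forall x, is_derive x u K (Ku x)) -> (forall x, is_derive x v K (Kv x)) ->
  (forall x, is_derive x u Kv (W x)) -> continuous W ->
  forall x, is_derive x v Ku (W x).
Proof.
move=> hu hv hW cW x; apply: (@hasD_is_derive R X Ku x v (W x) 1 ltr01).
have := @clairaut R I11 I11 (fun s r => K (x + r *: v + s *: u))
  (fun r => Ku (x + r *: v)) (fun s r => Kv (x + r *: v + s *: u))
  (fun s r => W (x + r *: v + s *: u)) 0 0 (@convex_itv R _ _) (@convex_itv R _ _)
  I11_0 I11_0 lim11.
rewrite !scale0r !addr0; apply.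
- by move=> r _; exact: is_derive_hasD.
- move=> s r _ _.
  have -> : (fun r => K (x + r *: v + s *: u)) = (fun r => K (x + s *: u + r *: v)).
    by apply/funext => q; rewrite addrAC.
  by rewrite addrAC; exact: is_derive_hasD_at.
- by move=> s r _ _; exact: is_derive_hasD_at.
- move=> a b _ _ a0 b0.
  exact: (cvg_comp (fun k => x + b k *: v + a k *: u) W
    (@seq_line_cvg X x v u b a b0 a0) (cW x)).
Qed.

(** Directional derivatives need not be additive in the direction. Continuity of the one along [u]
    suffices: the mean value theorem along [u], started at x + r v, writes the missing increment as
    r times a value of [Ku] near x. *)
Lemma is_derive_addv X (u v : X) (K Ku : X -> R) x l :
  (forall x, is_derive x u K (Ku x)) -> is_derive x v K l ->
  continuous Ku -> is_derive x (u + v) K (Ku x + l).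
Proof.
move=> hu hv cu.
apply: (@hasD_is_derive R X K x (u + v) _ 1 ltr01).
have mv r : r != 0 -> exists c : R, `|c| < `|r| /\
    K (x + r *: (u + v)) = K (x + r *: v) + r * Ku (x + c *: u + r *: v).
  move=> r0; have [|||||c [_ cr E]] := @hasD_MVT_sym R setT
    (fun s => K (x + r *: v + s *: u)) (fun s => Ku (x + r *: v + s *: u)) 0 r => //.
  - by rewrite eq_sym.
  - by move=> s _; exact: is_derive_hasD_at.
  rewrite !subr0 in cr E; exists c; split => //.
  rewrite [x + c *: u + _]addrAC -E scale0r addr0 mulrC divfK//.
  by rewrite [RHS]addrC subrK scalerDr addrA addrAC.
apply: seq_hasD => w Iw w0.
have w_n0 k : w k != 0 by have [] := Iw k.
have [c cP] := choice (fun k => mv (w k) (w_n0 k)).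
have c0 : c k @[k --> \oo] --> 0.
  apply/cvgrPdist_lt => e e0; have /cvgrPdist_lt /(_ _ e0) := w0.
  apply: filterS => k; rewrite !sub0r !normrN; apply: lt_trans.
  by have [] := cP k.
have E k : (K (x + w k *: (u + v)) - K (x + 0 *: (u + v))) / (w k - 0) =
    Ku (x + c k *: u + w k *: v) + (K (x + w k *: v) - K (x + 0 *: v)) / (w k - 0).
  have [_ ->] := cP k; rewrite !scale0r subr0.
  by field.
rewrite (funext E); apply: cvgD.
  exact: (cvg_comp (fun k => x + c k *: u + w k *: v) Ku (@seq_line_cvg X x u v c w c0 w0) (cu x)).
apply: (@hasD_seq R I11 (fun s => K (x + s *: v)) 0 l w) => //.
exact: is_derive_hasD.
Qed.

Lemma is_derive_affine X Y (phi : Y -> X) (w : Y) (v : X) (K : X -> R) y l :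
  (forall s : R, phi (y + s *: w) = phi y + s *: v) ->
  is_derive (phi y) v K l -> is_derive y w (fun y => K (phi y)) l.
Proof.
move=> hphi /is_deriveP h; apply/is_deriveP => e /h[d d0 dh].
by exists d => // r r0 rd; rewrite hphi; exact: dh.
Qed.

(** Partial derivatives become directional derivatives on the product, where [clairaut_dir] and
    [is_derive_addv] apply. *)
Lemma is_derive_fst X Y (K : X * Y -> R) x y v l :
  is_derive x v (fun x => K (x, y)) l <-> is_derive (x, y) (v, 0) K l.
Proof.
by split=> /is_deriveP h; apply/is_deriveP => e /h[d d0 dh]; exists d => // r r0 rd;
  have := dh r r0 rd; rewrite (_ : (x, y) + r *: (v, 0) = (x + r *: v, y))//;
  congr pair; rewrite /= scaler0 addr0.
Qed.

Lemma is_derive_snd X Y (K : X * Y -> R) x y v l :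
  is_derive y v (fun y => K (x, y)) l <-> is_derive (x, y) (0, v) K l.
Proof.
by split=> /is_deriveP h; apply/is_deriveP => e /h[d d0 dh]; exists d => // r r0 rd;
  have := dh r r0 rd; rewrite (_ : (x, y) + r *: (0, v) = (x, y + r *: v))//;
  congr pair; rewrite /= scaler0 addr0.
Qed.

Lemma is_derive_real X (K L : X -> R) x v k l : is_derive x v K k -> is_derive x v L l ->
  is_derive x v (fun x => K x + L x) (k + l).
Proof. by move=> hK hL; exact: is_deriveD. Qed.

Lemma is_derive_addc X (K : X -> R) x v k c : is_derive x v K k ->
  is_derive x v (fun x => K x + c) k.
Proof.
by move=> h; rewrite -[k]addr0; apply: is_derive_real.
Qed.

End directional_derivatives.

Section derivative_of_integrals.
Context {R : realType} {n : nat} {X : normedModType R}.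
Local Notation E := 'cV[R]_n.
Local Notation I11 := (`[- 1, 1]%classic : set R).

Lemma is_derive_int (m : P2 R n) (K K' : X * E -> R) (v : X) C :
  0 <= C ->
  (forall x, aint (fun y => K (x, y))) ->
  (forall x y, is_derive (x, y) (v, 0) K (K' (x, y))) ->
  (forall x y, `|K' (x, y)| <= C * (1 + `|x| ^+ 2 + `|y| ^+ 2)) ->
  forall x, is_derive x v (fun x => \int[m]_y K (x, y)) (\int[m]_y K' (x, y)).
Proof.
move=> C0 iK hK KC x; apply: (@hasD_is_derive R X _ x v _ 1 ltr01).
have I0 : I11 0 by rewrite /= in_itv/= lerN10 ler01.
have l0 : limit_pt I11 0 by apply: limit_pt_itv; [lra|rewrite lerN10 ler01].
have := @hasD_integral R _ _ m I11 (fun s y => K (x + s *: v, y))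
  (fun s y => K' (x + s *: v, y)) (fun y => C * ((1 + (`|x| + `|v|) ^+ 2) + `|y| ^+ 2))
  0 (@convex_itv R _ _) I0 l0.
rewrite scale0r addr0; apply.
- by move=> r _; exact: iK.
- move=> r y _; apply: (@is_derive_hasD_at R X (fun x => K (x, y))).
  exact/is_derive_fst.
- by apply: aintZ; apply: aintD; [exact: aint_cst|exact/qgrow_aint/qgrow_norm2].
- move=> r y; rewrite /= in_itv/= -ler_norml => r1; apply: (le_trans (KC _ _)).
  rewrite ler_wpM2l// lerD2r lerD2l ler_sqr ?nnegrE ?addr_ge0//.
  apply: (le_trans (ler_normD _ _)); rewrite lerD2l normrZ.
  by rewrite ler_piMl.
Qed.

End derivative_of_integrals.

(** * Jets and the second-order operator *)

Section jets.
Context {R : realType} {n : nat}.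
Local Notation E := 'cV[R]_n.
Local Notation P := (P2 R n).
Implicit Types (mu m : P) (i j : 'I_n) (x y z w : E).

(** The trace of a matrix product, with a function of entries in place of the first matrix, so that
    integrals and flat derivatives act entry by entry. *)
Definition tr2 (a : 'I_n -> 'I_n -> R) (S : 'M[R]_n) : R :=
  \sum_i \sum_j a i j * S j i.

Lemma trE (A S : 'M[R]_n) : \tr (A *m S) = tr2 A S.
Proof. by apply: eq_bigr => i _; rewrite mxE. Qed.

Lemma eq_tr2 (a b : 'I_n -> 'I_n -> R) S : a =2 b -> tr2 a S = tr2 b S.
Proof. by move=> ab; apply: eq_bigr => i _; apply: eq_bigr => j _; rewrite ab. Qed.

Lemma tr2D (a b : 'I_n -> 'I_n -> R) S :
  tr2 (fun i j => a i j + b i j) S = tr2 a S + tr2 b S.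
Proof.
rewrite -big_split; apply: eq_bigr => i _; rewrite -big_split.
by apply: eq_bigr => j _; rewrite mulrDl.
Qed.

Lemma tr2N (a : 'I_n -> 'I_n -> R) S : tr2 (fun i j => - a i j) S = - tr2 a S.
Proof.
rewrite /tr2 -sumrN; apply: eq_bigr => i _; rewrite -sumrN.
by apply: eq_bigr => j _; rewrite mulNr.
Qed.

Lemma tr2B (a b : 'I_n -> 'I_n -> R) S :
  tr2 (fun i j => a i j - b i j) S = tr2 a S - tr2 b S.
Proof. by rewrite tr2D tr2N. Qed.

Lemma tr2Z (a : 'I_n -> 'I_n -> R) c S : tr2 (fun i j => c * a i j) S = c * tr2 a S.
Proof.
rewrite /tr2 mulr_sumr; apply: eq_bigr => i _; rewrite mulr_sumr.
by apply: eq_bigr => j _; rewrite mulrA.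
Qed.

Lemma tr2S (a : 'I_n -> 'I_n -> R) S S' : tr2 a (S + S') = tr2 a S + tr2 a S'.
Proof.
rewrite -big_split; apply: eq_bigr => i _; rewrite -big_split.
by apply: eq_bigr => j _; rewrite mxE mulrDr.
Qed.

Lemma tr2T (a : 'I_n -> 'I_n -> R) S : S^T = S -> tr2 (fun i j => a j i) S = tr2 a S.
Proof.
move=> symS; rewrite /tr2 exchange_big/=; apply: eq_bigr => i _.
by apply: eq_bigr => j _; rewrite -{1}symS mxE.
Qed.

Lemma is_lfd_tr2 (a : 'I_n -> 'I_n -> P -> R) mu (D : 'I_n -> 'I_n -> E -> R) S :
  (forall i j, is_lfd (a i j) mu (D i j)) ->
  is_lfd (fun m => tr2 (fun i j => a i j m) S) mu (fun y => tr2 (fun i j => D i j y) S).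
Proof.
move=> h; apply: is_lfd_sum => i; apply: is_lfd_sum => j.
under eq_fun do rewrite mulrC; under [X in is_lfd _ _ X]eq_fun do rewrite mulrC.
exact: is_lfdZ.
Qed.

Lemma aint_tr2 (a : 'I_n -> 'I_n -> E -> R) S : (forall i j, aint (a i j)) ->
  aint (fun y => tr2 (fun i j => a i j y) S).
Proof.
move=> h; apply: aint_sum => i; apply: aint_sum => j.
by under eq_fun do rewrite mulrC; exact: aintZ.
Qed.

Lemma int_tr2 (a : 'I_n -> 'I_n -> E -> R) S mu : (forall i j, aint (a i j)) ->
  \int[mu]_y tr2 (fun i j => a i j y) S = tr2 (fun i j => \int[mu]_y a i j y) S.
Proof.
move=> h; have h' i j : aint (fun y => a i j y * S j i).
  by under eq_fun do rewrite mulrC; exact: aintZ.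
rewrite /tr2 int_sum; last by move=> i; exact: aint_sum.
apply: eq_bigr => i _; rewrite int_sum//; apply: eq_bigr => j _.
by rewrite RintegralZr//; exact: h.
Qed.

Lemma is_derive_D (X : normedModType R) (K : X -> R) (x v : X) l :
  is_derive x v K l -> derivable K x v /\ 'D_v K x = l.
Proof. by case. Qed.

(* a function of (x, mu) with its derivatives: jx, jxx in x; jl = delta_mu with
   derivatives jlz, jlzz, jlxz; jl2 = delta_mumu with derivatives jl2w (in the
   last variable) and jl2zw *)
Record jet := Jet {
  jF : E -> P -> R ;
  jx : 'I_n -> E -> P -> R ;
  jxx : 'I_n -> 'I_n -> E -> P -> R ;
  jl : E -> P -> E -> R ;
  jlz : 'I_n -> E -> P -> E -> R ;
  jlzz : 'I_n -> 'I_n -> E -> P -> E -> R ;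
  jlxz : 'I_n -> 'I_n -> E -> P -> E -> R ;
  jl2 : E -> P -> E -> E -> R ;
  jl2w : 'I_n -> E -> P -> E -> E -> R ;
  jl2zw : 'I_n -> 'I_n -> E -> P -> E -> E -> R }.

Record jet_ok (q : jet) : Prop := {
  okx : forall i x mu, is_derive x (Defs.basis i) (jF q ^~ mu) (jx q i x mu) ;
  okxx : forall i j x mu, is_derive x (Defs.basis i) (jx q j ^~ mu) (jxx q i j x mu) ;
  okl : forall x mu, is_lfd (jF q x) mu (jl q x mu) ;
  oklz : forall i x mu z, is_derive z (Defs.basis i) (jl q x mu) (jlz q i x mu z) ;
  oklzz : forall i j x mu z,
    is_derive z (Defs.basis i) (jlz q j x mu) (jlzz q i j x mu z) ;
  oklxz : forall i j x mu z,
    is_derive x (Defs.basis i) (fun x => jlz q j x mu z) (jlxz q i j x mu z) ;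
  okl2 : forall x mu z, is_lfd (fun m => jl q x m z) mu (jl2 q x mu z) ;
  okl2w : forall j x mu z w,
    is_derive w (Defs.basis j) (jl2 q x mu z) (jl2w q j x mu z w) ;
  okl2zw : forall i j x mu z w,
    is_derive z (Defs.basis i) (fun z => jl2w q j x mu z w) (jl2zw q i j x mu z w) }.

Definition jet_add (p q : jet) : jet := Jet
  (fun x mu => jF p x mu + jF q x mu)
  (fun i x mu => jx p i x mu + jx q i x mu)
  (fun i j x mu => jxx p i j x mu + jxx q i j x mu)
  (fun x mu z => jl p x mu z + jl q x mu z)
  (fun i x mu z => jlz p i x mu z + jlz q i x mu z)
  (fun i j x mu z => jlzz p i j x mu z + jlzz q i j x mu z)
  (fun i j x mu z => jlxz p i j x mu z + jlxz q i j x mu z)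
  (fun x mu z w => jl2 p x mu z w + jl2 q x mu z w)
  (fun i x mu z w => jl2w p i x mu z w + jl2w q i x mu z w)
  (fun i j x mu z w => jl2zw p i j x mu z w + jl2zw q i j x mu z w).

Lemma jet_ok_add p q : jet_ok p -> jet_ok q -> jet_ok (jet_add p q).
Proof.
by move=> [? ? ? ? ? ? ? ? ?] [? ? ? ? ? ? ? ? ?]; split => * /=;
  try exact: is_derive_real; exact: is_lfdD.
Qed.

Section jet_operator.
Variables (f : E -> P -> E) (S S0 : 'M[R]_n).

Record jet_int (q : jet) : Prop := {
  intz : forall x mu, aint (fun z => \sum_i jlz q i x mu z * f z mu i 0) ;
  intzz : forall x mu, aint (fun z => tr2 (fun i j => jlzz q i j x mu z) S) ;
  intxz : forall x mu, aint (fun z => tr2 (fun i j => jlxz q i j x mu z) S0) ;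
  intzw : forall x mu, (p2prob mu \x p2prob mu)%E.-integrable setT
    (fun a => (tr2 (fun i j => jl2zw q i j x mu a.1 a.2) S0)%:E) }.

Definition jetL (q : jet) x mu : R :=
  \sum_i jx q i x mu * f x mu i 0
  + 2^-1 * tr2 (fun i j => jxx q i j x mu) S
  + \int[mu]_z (\sum_i jlz q i x mu z * f z mu i 0)
  + 2^-1 * \int[mu]_z tr2 (fun i j => jlzz q i j x mu z) S
  + \int[mu]_z tr2 (fun i j => jlxz q i j x mu z) S0
  + 2^-1 * \int[(p2prob mu \x p2prob mu)%E]_a
      tr2 (fun i j => jl2zw q i j x mu a.1 a.2) S0.

Let addz (p q : 'I_n -> E -> P -> E -> R) x mu z :
  \sum_i (p i x mu z + q i x mu z) * f z mu i 0 =
  \sum_i p i x mu z * f z mu i 0 + \sum_i q i x mu z * f z mu i 0.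
Proof. by rewrite -big_split; apply: eq_bigr => i _; rewrite mulrDl. Qed.

Lemma jet_int_add p q : jet_int p -> jet_int q -> jet_int (jet_add p q).
Proof.
move=> [h1 h2 h3 h4] [k1 k2 k3 k4]; split=> x mu /=.
- by under eq_fun do rewrite addz; exact: aintD.
- by under eq_fun do rewrite tr2D; exact: aintD.
- by under eq_fun do rewrite tr2D; exact: aintD.
- have := integrableD measurableT (h4 x mu) (k4 x mu).
  by apply: eq_integrable => // a _ /=; rewrite tr2D EFinD.
Qed.

Lemma jetL_add p q x mu : jet_int p -> jet_int q ->
  jetL (jet_add p q) x mu = jetL p x mu + jetL q x mu.
Proof.
move=> [h1 h2 h3 h4] [k1 k2 k3 k4]; rewrite /jetL /=.
have -> : \sum_i (jx p i x mu + jx q i x mu) * f x mu i 0 =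
  \sum_i jx p i x mu * f x mu i 0 + \sum_i jx q i x mu * f x mu i 0.
  by rewrite -big_split; apply: eq_bigr => i _; rewrite mulrDl.
have Ez : \int[mu]_z (\sum_i (jlz p i x mu z + jlz q i x mu z) * f z mu i 0) =
    \int[mu]_z (\sum_i jlz p i x mu z * f z mu i 0) +
    \int[mu]_z (\sum_i jlz q i x mu z * f z mu i 0).
  by rewrite -(intD _ (h1 x mu) (k1 x mu)); apply: eq_Rintegral => z _; exact: addz.
have Ezz : \int[mu]_z tr2 (fun i j => jlzz p i j x mu z + jlzz q i j x mu z) S =
    \int[mu]_z tr2 (fun i j => jlzz p i j x mu z) S +
    \int[mu]_z tr2 (fun i j => jlzz q i j x mu z) S.
  by rewrite -(intD _ (h2 x mu) (k2 x mu)); apply: eq_Rintegral => z _; exact: tr2D.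
have Exz : \int[mu]_z tr2 (fun i j => jlxz p i j x mu z + jlxz q i j x mu z) S0 =
    \int[mu]_z tr2 (fun i j => jlxz p i j x mu z) S0 +
    \int[mu]_z tr2 (fun i j => jlxz q i j x mu z) S0.
  by rewrite -(intD _ (h3 x mu) (k3 x mu)); apply: eq_Rintegral => z _; exact: tr2D.
have Ezw : \int[(p2prob mu \x p2prob mu)%E]_a
      tr2 (fun i j => jl2zw p i j x mu a.1 a.2 + jl2zw q i j x mu a.1 a.2) S0 =
    \int[(p2prob mu \x p2prob mu)%E]_a tr2 (fun i j => jl2zw p i j x mu a.1 a.2) S0 +
    \int[(p2prob mu \x p2prob mu)%E]_a tr2 (fun i j => jl2zw q i j x mu a.1 a.2) S0.
  rewrite -(RintegralD measurableT (h4 x mu) (k4 x mu)).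
  by apply: eq_Rintegral => a _; exact: tr2D.
rewrite tr2D Ez Ezz Exz Ezw; ring.
Qed.

End jet_operator.

Section jet_Lop.
Variables (T : R) (fs : R -> E -> P -> E) (Sigma Sigma0 : 'M[R]_n).
Variables (F : R -> E -> P -> R) (t : R) (q : jet).
Hypotheses (T0 : 0 < T) (t0T : 0 <= t <= T) (okq : jet_ok q) (Fq : F t = jF q).

(** Uniqueness of the flat derivative identifies the chosen value with the jet entry; the lemmas
    that follow do the same for each derivative occurring in [Lop]. *)
Lemma jet_lfd x mu : lfd (F t x) mu = jl q x mu.
Proof. by rewrite Fq; apply: lfdE; exact: okl. Qed.

Lemma jet_lfd2 x mu : lfd2 (F t x) mu = jl2 q x mu.
Proof.
apply/funext => z; rewrite /lfd2.
under eq_fun do rewrite jet_lfd.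
by apply: lfdE; exact: okl2.
Qed.

Lemma jet_Dl j x mu : 'D_(Defs.basis j) (jl q x mu) = jlz q j x mu.
Proof. by apply/funext => z; have [] := is_derive_D (oklz okq j x mu z). Qed.

Lemma jet_grad x mu : grad (fun x' => F t x' mu) x = \row_i jx q i x mu.
Proof.
by apply/rowP => i; rewrite !mxE Fq; have [] := is_derive_D (okx okq i x mu).
Qed.

Lemma jet_hess x mu : hess (fun x' => F t x' mu) x = \matrix_(i, j) jxx q i j x mu.
Proof.
apply/matrixP => i j; rewrite !mxE Fq.
have -> : 'D_(Defs.basis j) (jF q ^~ mu) = jx q j ^~ mu.
  by apply/funext => y; have [] := is_derive_D (okx okq j y mu).
by have [] := is_derive_D (okxx okq i j x mu).
Qed.

Lemma jet_gradl x mu z : grad (lfd (F t x) mu) z = \row_i jlz q i x mu z.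
Proof.
by apply/rowP => i; rewrite !mxE jet_lfd; have [] := is_derive_D (oklz okq i x mu z).
Qed.

Lemma jet_hessl x mu z : hess (lfd (F t x) mu) z = \matrix_(i, j) jlzz q i j x mu z.
Proof.
apply/matrixP => i j; rewrite !mxE jet_lfd jet_Dl.
by have [] := is_derive_D (oklzz okq i j x mu z).
Qed.

Lemma jet_crossl x mu z : cross (fun x' y' => lfd (F t x') mu y') x z =
  \matrix_(i, j) jlxz q i j x mu z.
Proof.
apply/matrixP => i j; rewrite !mxE.
have -> : (fun x' => 'D_(Defs.basis j) (lfd (F t x') mu) z) = (fun x' => jlz q j x' mu z).
  by apply/funext => x'; rewrite jet_lfd; have [] := is_derive_D (oklz okq j x' mu z).
by have [] := is_derive_D (oklxz okq i j x mu z).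
Qed.

Lemma jet_cross2 x mu z w : cross (lfd2 (F t x) mu) z w =
  \matrix_(i, j) jl2zw q i j x mu z w.
Proof.
apply/matrixP => i j; rewrite !mxE jet_lfd2.
have -> : (fun z' => 'D_(Defs.basis j) (jl2 q x mu z') w) = (fun z' => jl2w q j x mu z' w).
  by apply/funext => z'; have [] := is_derive_D (okl2w okq j x mu z' w).
by have [] := is_derive_D (okl2zw okq i j x mu z w).
Qed.

Lemma dt_hasD (h : R -> R) l : hasD `[0, T] h t l -> dt_ex T h t /\ dt T h t = l.
Proof.
move=> hl; have ex : dt_ex T h t by apply: cvgP hl.
split => //; apply: (hasD_unique (limit_pt_itv T0 t0T)) hl; exact: ex.
Qed.

Lemma jet_Lop x mu l : hasD `[0, T] (fun s => F s x mu) t l ->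
  Lop T fs Sigma Sigma0 F t x mu = l + jetL (fs t) (Sigma + Sigma0) Sigma0 q x mu.
Proof.
move=> hl.
have [_ dtl] := dt_hasD hl.
have rowE (r : 'I_n -> R) (v : E) : rowapp (\row_i r i) v = \sum_i r i * v i 0.
  by rewrite /rowapp mxE; apply: eq_bigr => i _; rewrite mxE.
have trM (a : 'I_n -> 'I_n -> R) S : \tr ((\matrix_(i, j) a i j) *m S) = tr2 a S.
  by rewrite trE; apply: eq_tr2 => i j; rewrite mxE.
rewrite /Lop dtl jet_grad jet_hess rowE trM.
under eq_Rintegral do rewrite jet_gradl rowE.
under [X in _ + _ * X + _ + _]eq_Rintegral do rewrite jet_hessl trM.
under [X in _ + X + _ * _]eq_Rintegral do rewrite jet_crossl trM.
under [X in _ + _ * X = _]eq_Rintegral do rewrite jet_cross2 trM.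
by rewrite /jetL !addrA.
Qed.

Lemma jet_Lop_wf : (forall x mu, exists l, hasD `[0, T] (fun s => F s x mu) t l) ->
  jet_int (fs t) (Sigma + Sigma0) Sigma0 q -> Lop_wf T fs Sigma Sigma0 F t.
Proof.
move=> hl [h1 h2 h3 h4] mu.
have rowE (r : 'I_n -> R) (v : E) : rowapp (\row_i r i) v = \sum_i r i * v i 0.
  by rewrite /rowapp mxE; apply: eq_bigr => i _; rewrite mxE.
have trM (a : 'I_n -> 'I_n -> R) S : \tr ((\matrix_(i, j) a i j) *m S) = tr2 a S.
  by rewrite trE; apply: eq_tr2 => i j; rewrite mxE.
split.
- by move=> x; have [l /cvgP] := hl x mu.
- rewrite Fq; split=> [x i|j x i]; first by have [] := is_derive_D (okx okq i x mu).
  have -> : 'D_(Defs.basis j) (jF q ^~ mu) = jx q j ^~ mu.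
    by apply/funext => y; have [] := is_derive_D (okx okq j y mu).
  by have [] := is_derive_D (okxx okq i j x mu).
- move=> x; split.
  + by exists (jl q x mu); rewrite Fq; exact: okl.
  + rewrite jet_lfd; split=> [z i|j z i]; first by have [] := is_derive_D (oklz okq i x mu z).
    by rewrite jet_Dl; have [] := is_derive_D (oklzz okq i j x mu z).
  + move=> z; exists (jl2 q x mu z); under eq_fun do rewrite jet_lfd.
    exact: okl2.
  + rewrite jet_lfd2; split=> [z w j|j w z i].
      by have [] := is_derive_D (okl2w okq j x mu z w).
    have -> : (fun z' => 'D_(Defs.basis j) (jl2 q x mu z') w) = (fun z' => jl2w q j x mu z' w).
      by apply/funext => z'; have [] := is_derive_D (okl2w okq j x mu z' w).
    by have [] := is_derive_D (okl2zw okq i j x mu z w).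
- split=> [x z i|j z x i].
    by rewrite jet_lfd; have [] := is_derive_D (oklz okq i x mu z).
  have -> : (fun x' => 'D_(Defs.basis j) (lfd (F t x') mu) z) = (fun x' => jlz q j x' mu z).
    by apply/funext => x'; rewrite jet_lfd; have [] := is_derive_D (oklz okq j x' mu z).
  by have [] := is_derive_D (oklxz okq i j x mu z).
- move=> x; split.
  + by under eq_fun do rewrite jet_gradl rowE; exact: h1.
  + by under eq_fun do rewrite jet_hessl trM; exact: h2.
  + by under eq_fun do rewrite jet_crossl trM; exact: h3.
  + by under eq_fun do rewrite jet_cross2 trM; exact: h4.
Qed.

End jet_Lop.
End jets.

(** * Regularity classes and averaged jets *)

Section regularity.
Context {R : realType} {n : nat}.
Local Notation E := 'cV[R]_n.
Local Notation P := (P2 R n).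
Implicit Types (X Y Z : normedModType R) (mu m : P).

Definition lg {X} (K : X -> P -> R) : Prop :=
  exists2 C, 0 <= C & forall x m, `|K x m| <= C * (1 + `|x| + mean m).

(** Continuity in space at each fixed measure is what measurability, Fubini and differentiation
    under the integral call for. Continuity in the measure is reserved for [jreg], where derivatives
    are exchanged with the flat derivative. *)
Definition creg {X} (K : X -> P -> R) : Prop :=
  (forall m, continuous (K^~ m)) /\ qg K.

Definition lreg {X} (K : X -> P -> R) : Prop :=
  (forall m, continuous (K^~ m)) /\ lg K.

(** With the sup norm on products, permuting, repeating or freezing coordinates gives maps of this
    kind, and substituting them preserves the growth classes. The tactic [slope] recognises them by
    their syntax. *)
Definition slope1 {X Y} (phi : X -> Y) : Prop :=
  continuous phi /\ exists2 A, 0 <= A & forall x, `|phi x| <= A + `|x|.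

Lemma slope1_id X : slope1 (fun x : X => x).
Proof. by split; [exact: cont_id|exists 0 => // x; rewrite add0r]. Qed.

Lemma slope1_cst X Y (y : Y) : slope1 (fun _ : X => y).
Proof. by split; [exact: cont_cst|exists `|y| => // x; rewrite lerDl]. Qed.

Lemma slope1_pair X Y Z (phi : X -> Y) (psi : X -> Z) :
  slope1 phi -> slope1 psi -> slope1 (fun x => (phi x, psi x) : (Y * Z)%type).
Proof.
move=> [cp [A A0 pA]] [cq [B B0 qB]]; split; first exact: cont_pair.
exists (A + B); first exact: addr_ge0.
move=> x; rewrite prod_normE/= ge_max; apply/andP; split.
  by apply: (le_trans (pA x)); lra.
by apply: (le_trans (qB x)); lra.
Qed.

Lemma slope1_fst X Y Z (phi : X -> (Y * Z)%type) : slope1 phi ->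
  slope1 (fun x => (phi x).1).
Proof.
move=> [cp [A A0 pA]]; split.
  by move=> x; apply: (cvg_comp phi fst (cp x)); exact: cvg_fst.
exists A => // x; apply: le_trans (pA x).
by rewrite prod_normE le_max lexx.
Qed.

Lemma slope1_snd X Y Z (phi : X -> (Y * Z)%type) : slope1 phi ->
  slope1 (fun x => (phi x).2).
Proof.
move=> [cp [A A0 pA]]; split.
  by move=> x; apply: (cvg_comp phi snd (cp x)); exact: cvg_snd.
exists A => // x; apply: le_trans (pA x).
by rewrite prod_normE le_max lexx orbT.
Qed.

Lemma creg_comp X Y (phi : X -> Y) (K : Y -> P -> R) : slope1 phi -> creg K ->
  creg (fun x m => K (phi x) m).
Proof.
move=> [cp [A A0 pA]] [cK [C C0 KC]]; split.
  by move=> m; exact: cont_comp cp (cK m).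
exists (C * (2 + 2 * A ^+ 2)); first by rewrite mulr_ge0// addr_ge0 ?mulr_ge0 ?sqr_ge0.
move=> x m; apply: (le_trans (KC _ _)); rewrite -mulrA ler_wpM2l//.
have h : `|phi x| ^+ 2 <= (A + `|x|) ^+ 2.
  by rewrite ler_sqr ?nnegrE ?addr_ge0//; exact: pA.
have := sqr_ge0 (A - `|x|); have := sqr_ge0 A; have := sqr_ge0 `|x|.
have := sqr_ge0 (mean m); move: h.
set a := A ^+ 2; set b := `|x| ^+ 2; set c := mean m ^+ 2.
rewrite sqrrD sqrrB -/a -/b => h c0 b0 a0 h2.
have : 0 <= a * b by rewrite mulr_ge0.
have : 0 <= a * c by rewrite mulr_ge0.
nra.
Qed.

Lemma lreg_comp X Y (phi : X -> Y) (K : Y -> P -> R) : slope1 phi -> lreg K ->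
  lreg (fun x m => K (phi x) m).
Proof.
move=> [cp [A A0 pA]] [cK [C C0 KC]]; split.
  by move=> m; exact: cont_comp cp (cK m).
exists (C * (1 + A)); first by rewrite mulr_ge0// addr_ge0.
move=> x m; apply: (le_trans (KC _ _)); rewrite -mulrA ler_wpM2l//.
have := pA x; have := normr_ge0 x; have := mean_ge0 m; nra.
Qed.

Lemma lreg_creg X (K : X -> P -> R) : lreg K -> creg K.
Proof.
move=> [cK [C C0 KC]]; split => //; exists (C * 2); first by rewrite mulr_ge0.
move=> x m; apply: (le_trans (KC _ _)); rewrite -mulrA ler_wpM2l//.
have := sqr_ge0 (`|x| - 1); have := sqr_ge0 (mean m - 1).
by rewrite !sqrrB expr1n; nra.
Qed.

Lemma cregD X (K L : X -> P -> R) : creg K -> creg L ->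
  creg (fun x m => K x m + L x m).
Proof.
move=> [cK [C C0 KC]] [cL [D D0 LD]]; split; first by move=> m; exact: cont_D.
exists (C + D); first exact: addr_ge0.
by move=> x m; rewrite mulrDl (le_trans (ler_normD _ _))// lerD.
Qed.

Lemma lregD X (K L : X -> P -> R) : lreg K -> lreg L ->
  lreg (fun x m => K x m + L x m).
Proof.
move=> [cK [C C0 KC]] [cL [D D0 LD]]; split; first by move=> m; exact: cont_D.
exists (C + D); first exact: addr_ge0.
by move=> x m; rewrite mulrDl (le_trans (ler_normD _ _))// lerD.
Qed.

Lemma creg_cst X (c : R) : creg (fun (_ : X) (_ : P) => c).
Proof.
split; first by move=> m; exact: cont_cst.
exists `|c| => // x m; rewrite ler_peMr// -addrA lerDl addr_ge0 ?sqr_ge0//.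
Qed.

Lemma cregZ X (K : X -> P -> R) c : creg K -> creg (fun x m => c * K x m).
Proof.
move=> [cK [C C0 KC]]; split; first by move=> m; apply: cont_M => //; exact: cont_cst.
by exists (`|c| * C); [rewrite mulr_ge0|move=> x m; rewrite normrM -mulrA ler_wpM2l].
Qed.

Lemma lregN X (K : X -> P -> R) : lreg K -> lreg (fun x m => - K x m).
Proof.
move=> [cK [C C0 KC]]; split; first by move=> m; exact: cont_N.
by exists C => // x m; rewrite normrN.
Qed.

Lemma cregN X (K : X -> P -> R) : creg K -> creg (fun x m => - K x m).
Proof.
move=> [cK [C C0 KC]]; split; first by move=> m; exact: cont_N.
by exists C => // x m; rewrite normrN.
Qed.

Lemma cregB X (K L : X -> P -> R) : creg K -> creg L ->
  creg (fun x m => K x m - L x m).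
Proof. by move=> rK rL; apply: cregD => //; exact: cregN. Qed.

Lemma lregB X (K L : X -> P -> R) : lreg K -> lreg L ->
  lreg (fun x m => K x m - L x m).
Proof. by move=> rK rL; apply: lregD => //; exact: lregN. Qed.

(** The factor 3 is that of (1 + a + b)^2 <= 3 (1 + a^2 + b^2). Typically one factor is a gradient
    and the other the drift. *)
Lemma cregM X (K L : X -> P -> R) : lreg K -> lreg L ->
  creg (fun x m => K x m * L x m).
Proof.
move=> [cK [C C0 KC]] [cL [D D0 LD]]; split; first by move=> m; exact: cont_M.
exists (C * D * 3); first by rewrite !mulr_ge0.
move=> x m; rewrite normrM; have h := ler_pM (normr_ge0 _) (normr_ge0 _) (KC x m) (LD x m).
apply: (le_trans h); rewrite mulrACA -[leRHS]mulrA ler_wpM2l ?mulr_ge0//.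
have := sqr_ge0 (`|x| - 1); have := sqr_ge0 (mean m - 1); have := sqr_ge0 (`|x| - mean m).
by rewrite !sqrrB expr1n; nra.
Qed.

Lemma creg_sum X (I : Type) (s : seq I) (K : I -> X -> P -> R) :
  (forall i, creg (K i)) -> creg (fun x m => \sum_(i <- s) K i x m).
Proof.
move=> rK; elim: s => [|i s IH].
  suff -> : (fun (x : X) m => \sum_(i <- [::]) K i x m) = (fun _ _ => 0).
    exact: creg_cst.
  by apply/funext => x; apply/funext => m; rewrite big_nil.
suff -> : (fun (x : X) m => \sum_(i <- i :: s) K i x m) =
  (fun x m => K i x m + \sum_(i <- s) K i x m) by exact: cregD.
by apply/funext => x; apply/funext => m; rewrite big_cons.
Qed.

Lemma creg_tr2 X (K : 'I_n -> 'I_n -> X -> P -> R) S :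
  (forall i j, creg (K i j)) -> creg (fun x m => tr2 (fun i j => K i j x m) S).
Proof.
move=> rK; apply: creg_sum => i; apply: creg_sum => j.
have := cregZ (S j i) (rK i j).
suff -> : (fun x m => S j i * K i j x m) = (fun x m => K i j x m * S j i) by [].
by apply/funext => x; apply/funext => m; rewrite mulrC.
Qed.

Lemma creg_aint (K : E -> P -> R) m : creg K -> aint (K^~ m).
Proof. by move=> [cK qK]; apply: qg_aint => //; exact: continuous_borel. Qed.

Lemma creg_aint_comp X (phi : E -> X) (K : X -> P -> R) m :
  slope1 phi -> creg K -> aint (fun y => K (phi y) m).
Proof. by move=> sp rK; exact: (@creg_aint (fun y m => K (phi y) m) m (creg_comp sp rK)). Qed.

Lemma cont2_measurable (K : E * E -> R) : continuous K -> measurable_fun setT K.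
Proof.
move=> cK; apply: caratheodory_measurable => [x|y].
  apply: continuous_borel; apply: cont_comp cK.
  by apply: cont_pair; [exact: cont_cst|exact: cont_id].
by apply: cont_comp cK; apply: cont_pair; [exact: cont_id|exact: cont_cst].
Qed.

Lemma creg_bound2 X (K : X * E -> P -> R) m : creg K -> exists2 C, 0 <= C &
  forall x y, `|K (x, y) m| <= C * ((1 + `|x| ^+ 2) + `|y| ^+ 2).
Proof.
move=> [_ qK]; have [C C0 KC] := qg_pair m m qK; exists C => // x y.
by have := KC x y 0; rewrite mix0 lexx ler01; exact.
Qed.

Lemma creg_swap (K : E * E -> P -> R) m mu nu : creg K ->
  [/\ (p2prob mu \x p2prob nu)%E.-integrable setT (EFin \o K^~ m),
      aint (fun x => \int[nu]_y K (x, y) m),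
      aint (fun y => \int[mu]_x K (x, y) m),
      \int[(p2prob mu \x p2prob nu)%E]_z K z m = \int[mu]_x \int[nu]_y K (x, y) m
    & \int[mu]_x \int[nu]_y K (x, y) m = \int[nu]_y \int[mu]_x K (x, y) m].
Proof.
move=> rK; have [C C0 KC] := creg_bound2 m rK.
by apply: (@int_swap R n (K^~ m) mu nu C) => //; apply: cont2_measurable; exact: rK.1.
Qed.

Lemma creg_swap3 (K : E * E * E -> P -> R) m mu : creg K ->
  [/\ (p2prob mu \x p2prob mu)%E.-integrable setT
        (fun a => (\int[mu]_y K (a.1, a.2, y) m)%:E),
      aint (fun y => \int[(p2prob mu \x p2prob mu)%E]_a K (a.1, a.2, y) m),
      forall y, (p2prob mu \x p2prob mu)%E.-integrable setT
        (fun a => (K (a.1, a.2, y) m)%:E)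
    & \int[(p2prob mu \x p2prob mu)%E]_a \int[mu]_y K (a.1, a.2, y) m =
      \int[mu]_y \int[(p2prob mu \x p2prob mu)%E]_a K (a.1, a.2, y) m].
Proof.
move=> rK; have [C C0 KC] := creg_bound2 m rK.
(* The three variables are regrouped as one vector against a pair, so that the rounding argument
   acts on the vector and the two-factor Fubini theorem applies. *)
pose H (q : E * (E * E)) := K (q.2.1, q.2.2, q.1) m.
have mH : measurable_fun setT H.
  apply: caratheodory_measurable => [y|[z w]].
    apply: (@cont2_measurable (fun a : E * E => K (a.1, a.2, y) m)).
    have sp : slope1 (fun a : E * E => (a.1, a.2, y)).
      apply: slope1_pair; last exact: slope1_cst.
      by apply: slope1_pair; [apply: slope1_fst|apply: slope1_snd]; exact: slope1_id.
    exact: cont_comp sp.1 (rK.1 m).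
  have sp : slope1 (fun y : E => (z, w, y)).
    by apply: slope1_pair; [exact: slope1_cst|exact: slope1_id].
  exact: cont_comp sp.1 (rK.1 m).
have mH' : measurable_fun setT (fun q : (E * E) * E => H (q.2, q.1)).
  by apply: (measurableT_comp mH); exact: measurable_swap.
have i2 : aint (fun x : E => C * `|x| ^+ 2).
  by apply: aintZ; exact/qgrow_aint/qgrow_norm2.
pose b (a : E * E) := C * (1 + `|a| ^+ 2).
have ib : (p2prob mu \x p2prob mu)%E.-integrable setT (EFin \o b).
  have rb : creg (fun (a : E * E) (_ : P) => b a).
    split.
      move=> _; apply: cont_M; first exact: cont_cst.
      apply: cont_D; first exact: cont_cst.
      by under eq_fun do rewrite expr2; apply: cont_M; exact: norm_continuous.
    exists C => // a m'; rewrite /b ger0_norm ?mulr_ge0 ?addr_ge0 ?sqr_ge0//.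
    by rewrite ler_wpM2l// lerDl sqr_ge0.
  by have [] := creg_swap mu mu mu rb.
have KH1 y a : `|H (y, a)| <= C * `|y| ^+ 2 + b a.
  by rewrite /H /b addrC -mulrDr; case: a => z w /=; exact: KC.
have KH2 a y : `|H (y, a)| <= b a + C * `|y| ^+ 2 by rewrite addrC.
have HE a y : K (a.1, a.2, y) m = H (y, a) by [].
split.
- exact: (integrable_sec1_int mH' ib (i2 mu) KH2).
- by move=> m'; exact: (integrable_sec1_int mH (i2 m') ib KH1).
- by move=> y; exact: (integrable_sec1 mH ib KH1 y).
- have := Rintegral_prod1 mH (i2 mu) ib KH1.
  by rewrite (Rintegral_prod2 mH (i2 mu) ib KH1).
Qed.

Lemma is_derive_int_creg X (K K' : X * E -> P -> R) v m : creg K -> creg K' ->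
  (forall x y, is_derive x v (fun x => K (x, y) m) (K' (x, y) m)) ->
  forall x, is_derive x v (fun x => \int[m]_y K (x, y) m) (\int[m]_y K' (x, y) m).
Proof.
move=> rK rK' hK; have [C C0 KC] := creg_bound2 m rK'.
apply: (@is_derive_int R n X m (K^~ m) (K'^~ m) v C C0) => //.
  move=> x; apply: creg_aint_comp rK.
  by apply: slope1_pair; [exact: slope1_cst|exact: slope1_id].
by move=> x y; apply/is_derive_fst.
Qed.

Lemma clairaut2 X Y (K Kx Ky W : X * Y -> R) u v :
  (forall x y, is_derive x u (fun x => K (x, y)) (Kx (x, y))) ->
  (forall x y, is_derive y v (fun y => K (x, y)) (Ky (x, y))) ->
  (forall x y, is_derive x u (fun x => Ky (x, y)) (W (x, y))) ->
  continuous W ->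
  forall x y, is_derive y v (fun y => Kx (x, y)) (W (x, y)).
Proof.
move=> hx hy hW cW x y; apply/is_derive_snd.
apply: (@clairaut_dir R _ (u, 0) (0, v) K Kx Ky W _ _ _ cW).
- by case=> x' y'; apply/is_derive_fst.
- by case=> x' y'; apply/is_derive_snd.
- by case=> x' y'; apply/is_derive_fst.
Qed.

End regularity.

Ltac slope := lazymatch goal with
  | |- slope1 (fun x => x) => exact: slope1_id
  | |- slope1 (fun x => (@?f x, @?g x)) => apply: slope1_pair; slope
  | |- slope1 (fun x => fst (@?f x)) => apply: slope1_fst; slope
  | |- slope1 (fun x => snd (@?f x)) => apply: slope1_snd; slope
  | |- slope1 (@fst _ _) => exact: (slope1_fst (slope1_id _))
  | |- slope1 (@snd _ _) => exact: (slope1_snd (slope1_id _))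
  | |- slope1 (@pair ?A ?B ?a) =>
      exact: (slope1_pair (slope1_cst _ a) (slope1_id _))
  | |- slope1 (fun x => ?c) => exact: slope1_cst
  end.

(** * The operator on averages of families *)

Section averaged_jet.
Context {R : realType} {n : nat}.
Local Notation E := 'cV[R]_n.
Local Notation P := (P2 R n).
Local Notation b := Defs.basis.
Implicit Types (mu m : P) (i j : 'I_n) (x y z w : E).

(* a function G((x, y), mu), to be averaged over y, with its derivatives; the
   variables of delta_mu G and delta_mumu G are z and w *)
Record family := Family {
  G : E * E -> P -> R ;
  Gx : 'I_n -> E * E -> P -> R ;
  Gy : 'I_n -> E * E -> P -> R ;
  Gxx : 'I_n -> 'I_n -> E * E -> P -> R ;
  Gyy : 'I_n -> 'I_n -> E * E -> P -> R ;
  Gxy : 'I_n -> 'I_n -> E * E -> P -> R ;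
  dG : E * E * E -> P -> R ;
  dGy : 'I_n -> E * E * E -> P -> R ;
  dGz : 'I_n -> E * E * E -> P -> R ;
  dGzz : 'I_n -> 'I_n -> E * E * E -> P -> R ;
  dGxz : 'I_n -> 'I_n -> E * E * E -> P -> R ;
  dGyz : 'I_n -> 'I_n -> E * E * E -> P -> R ;
  d2G : E * E * E * E -> P -> R ;
  d2Gw : 'I_n -> E * E * E * E -> P -> R ;
  d2Gzw : 'I_n -> 'I_n -> E * E * E * E -> P -> R }.

(** Linear growth is asked of [Gy] and [dGz], which multiply the drift at an integrated point. [Gx]
    multiplies the drift at the fixed point x, a constant for the integration, so quadratic growth
    is enough. *)
Record family_ok (q : family) : Prop := {
  rG : creg (G q) ; rGx : forall i, creg (Gx q i) ;
  rGy : forall i, lreg (Gy q i) ;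
  rGxx : forall i j, creg (Gxx q i j) ; rGyy : forall i j, creg (Gyy q i j) ;
  rGxy : forall i j, creg (Gxy q i j) ;
  rdG : creg (dG q) ; rdGz : forall i, lreg (dGz q i) ;
  rdGzz : forall i j, creg (dGzz q i j) ; rdGxz : forall i j, creg (dGxz q i j) ;
  rdGyz : forall i j, creg (dGyz q i j) ;
  rd2G : creg (d2G q) ; rd2Gw : forall i, creg (d2Gw q i) ;
  rd2Gzw : forall i j, creg (d2Gzw q i j) ;
  lG : forall x y m, is_lfd (G q (x, y)) m (fun z => dG q (x, y, z) m) ;
  ldG : forall x y z m,
    is_lfd (dG q (x, y, z)) m (fun w => d2G q (x, y, z, w) m) ;
  DGx : forall i x y m,
    is_derive x (b i) (fun x => G q (x, y) m) (Gx q i (x, y) m) ;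
  DGy : forall i x y m,
    is_derive y (b i) (fun y => G q (x, y) m) (Gy q i (x, y) m) ;
  DGxx : forall i j x y m,
    is_derive x (b i) (fun x => Gx q j (x, y) m) (Gxx q i j (x, y) m) ;
  DGyy : forall i j x y m,
    is_derive y (b i) (fun y => Gy q j (x, y) m) (Gyy q i j (x, y) m) ;
  DGxy : forall i j x y m,
    is_derive x (b i) (fun x => Gy q j (x, y) m) (Gxy q i j (x, y) m) ;
  DdGy : forall i x y z m,
    is_derive y (b i) (fun y => dG q (x, y, z) m) (dGy q i (x, y, z) m) ;
  DdGz : forall i x y z m,
    is_derive z (b i) (fun z => dG q (x, y, z) m) (dGz q i (x, y, z) m) ;
  DdGzz : forall i j x y z m,
    is_derive z (b i) (fun z => dGz q j (x, y, z) m) (dGzz q i j (x, y, z) m) ;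
  DdGxz : forall i j x y z m,
    is_derive x (b i) (fun x => dGz q j (x, y, z) m) (dGxz q i j (x, y, z) m) ;
  DdGyz : forall i j x y z m,
    is_derive y (b i) (fun y => dGz q j (x, y, z) m) (dGyz q i j (x, y, z) m) ;
  Dd2Gw : forall j x y z w m,
    is_derive w (b j) (fun w => d2G q (x, y, z, w) m) (d2Gw q j (x, y, z, w) m) ;
  Dd2Gzw : forall i j x y z w m,
    is_derive z (b i) (fun z => d2Gw q j (x, y, z, w) m)
      (d2Gzw q i j (x, y, z, w) m) }.

Variable q : family.
Hypothesis qok : family_ok q.

(** Two applications of [is_lfd_integral]: [l] is the flat derivative of the average, and [jl2]
    differentiates the three terms of [l] in turn. Terms free of the variable of differentiation
    disappear from [jl2w] and [jl2zw]. *)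
Definition avg_jet : jet :=
  let l x mu z := G q (x, z) mu - \int[mu]_y G q (x, y) mu
    + \int[mu]_y dG q (x, y, z) mu in
  let lz i x mu z := Gy q i (x, z) mu + \int[mu]_y dGz q i (x, y, z) mu in
  Jet (fun x mu => \int[mu]_y G q (x, y) mu)
    (fun i x mu => \int[mu]_y Gx q i (x, y) mu)
    (fun i j x mu => \int[mu]_y Gxx q i j (x, y) mu)
    l lz
    (fun i j x mu z => Gyy q i j (x, z) mu + \int[mu]_y dGzz q i j (x, y, z) mu)
    (fun i j x mu z => Gxy q i j (x, z) mu + \int[mu]_y dGxz q i j (x, y, z) mu)
    (fun x mu z w => dG q (x, z, w) mu - l x mu w
      + (dG q (x, w, z) mu - \int[mu]_y dG q (x, y, z) mu
         + \int[mu]_y d2G q (x, y, z, w) mu))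
    (fun j x mu z w => dGz q j (x, z, w) mu - lz j x mu w
      + (dGy q j (x, w, z) mu + \int[mu]_y d2Gw q j (x, y, z, w) mu))
    (fun i j x mu z w => dGyz q i j (x, z, w) mu
      + (dGyz q j i (x, w, z) mu + \int[mu]_y d2Gzw q i j (x, y, z, w) mu)).

Let creg2 (K : E * E -> P -> R) x : creg K -> creg (fun y m => K (x, y) m).
Proof. by move=> rK; apply: creg_comp rK; slope. Qed.

Let lfd_avg x m : is_lfd (fun m => \int[m]_y G q (x, y) m) m
  (fun z => G q (x, z) m - \int[m]_y G q (x, y) m + \int[m]_y dG q (x, y, z) m).
Proof.
apply: (@is_lfd_integral R n (fun y m => G q (x, y) m)
  (fun a m => dG q (x, a.1, a.2) m)) => //=.
- by move=> y m'; exact: lG.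
- by move=> m'; apply: continuous_borel; exact: (creg2 x (rG qok)).1.
- have h : creg (fun (a : E * E) m => dG q (x, a.1, a.2) m).
    by apply: creg_comp (rdG qok); slope.
  by move=> m'; apply: cont2_measurable; exact: h.1.
- exact: (creg2 x (rG qok)).2.
- have h : creg (fun (a : E * E) m => dG q (x, a.1, a.2) m).
    by apply: creg_comp (rdG qok); slope.
  exact: h.2.
Qed.

Let lfd_avg2 x z m : is_lfd (fun m => \int[m]_y dG q (x, y, z) m) m
  (fun w => dG q (x, w, z) m - \int[m]_y dG q (x, y, z) m
    + \int[m]_y d2G q (x, y, z, w) m).
Proof.
have h1 : creg (fun (y : E) m => dG q (x, y, z) m).
  by apply: creg_comp (rdG qok); slope.
have h2 : creg (fun (a : E * E) m => d2G q (x, a.1, z, a.2) m).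
  by apply: creg_comp (rd2G qok); slope.
apply: (@is_lfd_integral R n (fun y m => dG q (x, y, z) m)
  (fun a m => d2G q (x, a.1, z, a.2) m)) => //=.
- by move=> y m'; exact: ldG.
- by move=> m'; apply: continuous_borel; exact: h1.1.
- by move=> m'; apply: cont2_measurable; exact: h2.1.
- exact: h1.2.
- exact: h2.2.
Qed.

Lemma avg_jet_ok : jet_ok avg_jet.
Proof.
split=> /=.
- move=> i x mu; apply: (is_derive_int_creg (rG qok) (rGx qok i)) => x' y.
  exact: DGx.
- move=> i j x mu; apply: (is_derive_int_creg (rGx qok j) (rGxx qok i j)) => x' y.
  exact: DGxx.
- by move=> x mu; exact: lfd_avg.
- move=> i x mu z; apply: is_derive_real.
    by apply: is_derive_addc; exact: DGy.
  apply: (@is_derive_int_creg R n E (fun a m => dG q (x, a.2, a.1) m)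
    (fun a m => dGz q i (x, a.2, a.1) m)).
  + by apply: creg_comp (rdG qok); slope.
  + by apply: lreg_creg; apply: lreg_comp (rdGz qok i); slope.
  + by move=> z' y; exact: DdGz.
- move=> i j x mu z; apply: is_derive_real; first exact: DGyy.
  apply: (@is_derive_int_creg R n E (fun a m => dGz q j (x, a.2, a.1) m)
    (fun a m => dGzz q i j (x, a.2, a.1) m)).
  + by apply: lreg_creg; apply: lreg_comp (rdGz qok j); slope.
  + by apply: creg_comp (rdGzz qok i j); slope.
  + by move=> z' y; exact: DdGzz.
- move=> i j x mu z; apply: is_derive_real; first exact: DGxy.
  apply: (@is_derive_int_creg R n E (fun a m => dGz q j (a.1, a.2, z) m)
    (fun a m => dGxz q i j (a.1, a.2, z) m)).
  + by apply: lreg_creg; apply: lreg_comp (rdGz qok j); slope.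
  + by apply: creg_comp (rdGxz qok i j); slope.
  + by move=> x' y; exact: DdGxz.
- move=> x mu z; apply: is_lfdD; last exact: lfd_avg2.
  by apply: is_lfdB; [exact: lG|exact: lfd_avg].
- move=> j x mu z w; apply: is_derive_real; last first.
    apply: is_derive_real; last first.
      apply: (@is_derive_int_creg R n E (fun a m => d2G q (x, a.2, z, a.1) m)
        (fun a m => d2Gw q j (x, a.2, z, a.1) m)).
      + by apply: creg_comp (rd2G qok); slope.
      + by apply: creg_comp (rd2Gw qok j); slope.
      + by move=> w' y; exact: Dd2Gw.
    by apply: is_derive_addc; exact: DdGy.
  apply: is_derive_real; first exact: DdGz.
  apply: is_deriveN; apply: is_derive_real.
    by apply: is_derive_addc; exact: DGy.
  apply: (@is_derive_int_creg R n E (fun a m => dG q (x, a.2, a.1) m)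
    (fun a m => dGz q j (x, a.2, a.1) m)).
  + by apply: creg_comp (rdG qok); slope.
  + by apply: lreg_creg; apply: lreg_comp (rdGz qok j); slope.
  + by move=> z' y; exact: DdGz.
- move=> i j x mu z w; apply: is_derive_real; last first.
    apply: is_derive_real.
      (* [dGy] is given only as a derivative in y; that it is differentiable in z follows by
         exchanging the order in [dGyz]. *)
      apply: (@clairaut2 R E E (fun a => dG q (x, a.1, a.2) mu)
        (fun a => dGy q j (x, a.1, a.2) mu) (fun a => dGz q i (x, a.1, a.2) mu)
        (fun a => dGyz q j i (x, a.1, a.2) mu) (b j) (b i)) => /=.
      + by move=> *; exact: DdGy.
      + by move=> *; exact: DdGz.
      + by move=> *; exact: DdGyz.
      + have h : creg (fun (a : E * E) m => dGyz q j i (x, a.1, a.2) m).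
          by apply: creg_comp (rdGyz qok j i); slope.
        exact: h.1.
    apply: (@is_derive_int_creg R n E (fun a m => d2Gw q j (x, a.2, a.1, w) m)
      (fun a m => d2Gzw q i j (x, a.2, a.1, w) m)).
    + by apply: creg_comp (rd2Gw qok j); slope.
    + by apply: creg_comp (rd2Gzw qok i j); slope.
    + by move=> z' y; exact: Dd2Gzw.
  by apply: is_derive_addc; exact: DdGyz.
Qed.

Variables (f : E -> P -> E) (S S0 : 'M[R]_n).
Hypothesis rf : forall i, lreg (fun x m => f x m i 0).
Hypothesis symS0 : S0^T = S0.

(** The second-order operator for two space variables and a measure. Each variable carries the full
    covariance [S]; distinct variables share only the common noise [S0], and the coefficient 1 of
    [Gxy], [dGxz] and [dGyz] accounts for both orders of a mixed derivative. *)
Definition family_L x y mu : R :=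
  \sum_i Gx q i (x, y) mu * f x mu i 0
  + 2^-1 * tr2 (fun i j => Gxx q i j (x, y) mu) S
  + \sum_i Gy q i (x, y) mu * f y mu i 0
  + 2^-1 * tr2 (fun i j => Gyy q i j (x, y) mu) S
  + tr2 (fun i j => Gxy q i j (x, y) mu) S0
  + \int[mu]_z (\sum_i dGz q i (x, y, z) mu * f z mu i 0)
  + 2^-1 * \int[mu]_z tr2 (fun i j => dGzz q i j (x, y, z) mu) S
  + \int[mu]_z tr2 (fun i j => dGxz q i j (x, y, z) mu) S0
  + \int[mu]_z tr2 (fun i j => dGyz q i j (x, y, z) mu) S0
  + 2^-1 * \int[(p2prob mu \x p2prob mu)%E]_a
      tr2 (fun i j => d2Gzw q i j (x, y, a.1, a.2) mu) S0.

Let A1 (a : E * E) m := \sum_i Gy q i a m * f a.2 m i 0.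
Let A2 (a : E * E * E) m := \sum_i dGz q i a m * f a.2 m i 0.

Let rA1 : creg A1.
Proof.
apply: creg_sum => i; apply: cregM; first exact: rGy.
by apply: (@lreg_comp R n (E * E)%type E (fun a => a.2)) (rf i); slope.
Qed.

Let rA2 : creg A2.
Proof.
apply: creg_sum => i; apply: cregM; first exact: rdGz.
by apply: (@lreg_comp R n (E * E * E)%type E (fun a => a.2)) (rf i); slope.
Qed.

Let sec3 (K : E * E * E -> P -> R) x : creg K ->
  creg (fun (a : E * E) m => K (x, a.1, a.2) m).
Proof. by move=> rK; apply: creg_comp rK; slope. Qed.

Let sec3' (K : E * E * E -> P -> R) x z m : creg K -> aint (fun y => K (x, y, z) m).
Proof. by move=> rK; apply: creg_aint_comp rK; slope. Qed.

Let Ez x mu z : \sum_i jlz avg_jet i x mu z * f z mu i 0 =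
  A1 (x, z) mu + \int[mu]_y A2 (x, y, z) mu.
Proof.
have h i : aint (fun y => dGz q i (x, y, z) mu).
  by apply: sec3'; exact/lreg_creg/rdGz.
rewrite /A2 int_sum; last first.
  by move=> i /=; exact: aintZr.
rewrite /A1 -big_split; apply: eq_bigr => i _ /=; rewrite mulrDl; congr (_ + _).
by rewrite intZr.
Qed.

Let tr_avg (K : 'I_n -> 'I_n -> E * E -> P -> R)
    (L : 'I_n -> 'I_n -> E * E * E -> P -> R) S' x mu z :
  (forall i j, creg (L i j)) ->
  tr2 (fun i j => K i j (x, z) mu + \int[mu]_y L i j (x, y, z) mu) S' =
  tr2 (fun i j => K i j (x, z) mu) S' +
  \int[mu]_y tr2 (fun i j => L i j (x, y, z) mu) S'.
Proof.
by move=> rL; rewrite tr2D int_tr2// => i j; exact: sec3'.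
Qed.

Let rtr (X : normedModType R) (K : 'I_n -> 'I_n -> X -> P -> R) S' :
  (forall i j, creg (K i j)) -> creg (fun a m => tr2 (fun i j => K i j a m) S').
Proof. exact: creg_tr2. Qed.

Let aint_avg (K : E * E -> P -> R) (L : E * E * E -> P -> R) x mu :
  creg K -> creg L -> aint (fun z => K (x, z) mu + \int[mu]_y L (x, y, z) mu).
Proof.
move=> rK rL; apply: aintD; first exact: creg_aint (creg2 x rK).
by have [] := creg_swap mu mu mu (sec3 x rL).
Qed.

Let B1 (a : E * E * E) m := tr2 (fun i j => dGyz q i j a m) S0.
Let B3 (a : E * E * E * E) m := tr2 (fun i j => d2Gzw q i j a m) S0.

Let rB1 : creg B1. Proof. by apply: rtr; exact: rdGyz. Qed.

Let rB3 x : creg (fun (a : E * E * E) m => B3 (x, a.2, a.1.1, a.1.2) m).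
Proof.
by apply: (creg_comp _ (rtr S0 (rd2Gzw qok))); slope.
Qed.

Let Ezw x mu a : tr2 (fun i j => jl2zw avg_jet i j x mu a.1 a.2) S0 =
  B1 (x, a.1, a.2) mu + (B1 (x, a.2, a.1) mu + \int[mu]_y B3 (x, y, a.1, a.2) mu).
Proof.
rewrite /= !tr2D [in X in _ + (X + _)](@tr2T R n (fun i j => dGyz q i j (x, a.2, a.1) mu))//.
congr (_ + (_ + _)); rewrite int_tr2// => i j.
by apply: creg_aint_comp (rd2Gzw qok i j); slope.
Qed.

Let swp x : creg (fun (a : E * E) m => B1 (x, a.2, a.1) m).
Proof. by apply: creg_comp rB1; slope. Qed.

Let int_zw x mu : [/\
  (p2prob mu \x p2prob mu)%E.-integrable setT (fun a => (B1 (x, a.1, a.2) mu)%:E),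
  (p2prob mu \x p2prob mu)%E.-integrable setT (fun a => (B1 (x, a.2, a.1) mu)%:E)
  & (p2prob mu \x p2prob mu)%E.-integrable setT
     (fun a => (\int[mu]_y B3 (x, y, a.1, a.2) mu)%:E)].
Proof.
split.
- by have [] := creg_swap mu mu mu (sec3 x rB1).
- by have [] := creg_swap mu mu mu (swp x).
- by have [] := creg_swap3 mu mu (rB3 x).
Qed.

Lemma avg_jet_int : jet_int f S S0 avg_jet.
Proof.
split=> x mu.
- by under eq_fun do rewrite Ez; exact: aint_avg.
- under eq_fun do rewrite /= (tr_avg (Gyy q) S x mu _ (rdGzz qok)).
  by apply: (aint_avg x mu (rtr S (rGyy qok)) (rtr S (rdGzz qok))).
- under eq_fun do rewrite /= (tr_avg (Gxy q) S0 x mu _ (rdGxz qok)).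
  by apply: (aint_avg x mu (rtr S0 (rGxy qok)) (rtr S0 (rdGxz qok))).
- have [h1 h2 h3] := int_zw x mu.
  have := integrableD measurableT h1 (integrableD measurableT h2 h3).
  by apply: eq_integrable => // a _; rewrite Ezw !EFinD.
Qed.

(** The averaged variable y becomes a point of the measure: derivatives of [G] in y reappear in the
    flat derivative of the average, and after Fubini the two operators agree term by term. *)
Lemma avg_jetL x mu :
  aint (fun y => family_L x y mu) /\
  jetL f S S0 avg_jet x mu = \int[mu]_y family_L x y mu.
Proof.
have ax (K : E * E -> P -> R) : creg K -> aint (fun y => K (x, y) mu).
  by move=> rK; exact: creg_aint (creg2 x rK).
have hx i : aint (fun y => Gx q i (x, y) mu) by apply: ax; exact: rGx.
have hx' i : aint (fun y => Gx q i (x, y) mu * f x mu i 0).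
  exact: aintZr.
have i1 : aint (fun y => \sum_i Gx q i (x, y) mu * f x mu i 0) by exact: aint_sum.
have e1 : \int[mu]_y (\sum_i Gx q i (x, y) mu * f x mu i 0) =
    \sum_i jx avg_jet i x mu * f x mu i 0.
  by rewrite int_sum//; apply: eq_bigr => i _ /=; rewrite intZr.
have ixx i j : aint (fun y => Gxx q i j (x, y) mu) by apply: ax; exact: rGxx.
have i2' := aint_tr2 S ixx; have i2 := aintZ (2^-1) i2'.
have i3 := ax _ rA1.
have i4' := ax _ (rtr S (rGyy qok)); have i4 := aintZ (2^-1) i4'.
have i5 := ax _ (rtr S0 (rGxy qok)).
have sw (K : E * E * E -> P -> R) : creg K ->
    [/\ aint (fun y => \int[mu]_z K (x, y, z) mu),
        aint (fun z => \int[mu]_y K (x, y, z) mu) &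
        \int[mu]_y \int[mu]_z K (x, y, z) mu = \int[mu]_z \int[mu]_y K (x, y, z) mu].
  by move=> rK; have [_ ? ? _ ?] := creg_swap mu mu mu (sec3 x rK).
have [i6 i6' e6] := sw _ rA2.
have [i7 i7' e7] := sw _ (rtr S (rdGzz qok)); have i7Z := aintZ (2^-1) i7.
have [i8 i8' e8] := sw _ (rtr S0 (rdGxz qok)).
have [i9 i9' e9] := sw _ rB1.
have [_ i10 i10y e10] := creg_swap3 mu mu (rB3 x); have i10Z := aintZ (2^-1) i10.
have j2 := aintD i1 i2; have j3 := aintD j2 i3; have j4 := aintD j3 i4.
have j5 := aintD j4 i5; have j6 := aintD j5 i6; have j7 := aintD j6 i7Z.
have j8 := aintD j7 i8; have j9 := aintD j8 i9; have j10 := aintD j9 i10Z.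
split; first exact: j10.
rewrite /family_L (intD mu j9 i10Z) (intD mu j8 i9) (intD mu j7 i8) (intD mu j6 i7Z).
rewrite (intD mu j5 i6) (intD mu j4 i5) (intD mu j3 i4) (intD mu j2 i3) (intD mu i1 i2).
rewrite e1 (intZ _ _ i2') (intZ _ _ i4') (intZ _ _ i7) (intZ _ _ i10) e6 e7 e8 e9.
rewrite -[X in _ = _ + 2^-1 * X]e10 (int_tr2 _ _ ixx) /jetL.
have -> : \int[mu]_z (\sum_i jlz avg_jet i x mu z * f z mu i 0) =
    \int[mu]_z A1 (x, z) mu + \int[mu]_z \int[mu]_y A2 (x, y, z) mu.
  by rewrite -(intD mu i3 i6'); apply: eq_Rintegral => z _; exact: Ez.
have -> : \int[mu]_z tr2 (fun i j => jlzz avg_jet i j x mu z) S =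
    \int[mu]_z tr2 (fun i j => Gyy q i j (x, z) mu) S +
    \int[mu]_z \int[mu]_y tr2 (fun i j => dGzz q i j (x, y, z) mu) S.
  by rewrite -(intD mu i4' i7'); apply: eq_Rintegral => z _; apply: tr_avg; exact: rdGzz.
have -> : \int[mu]_z tr2 (fun i j => jlxz avg_jet i j x mu z) S0 =
    \int[mu]_z tr2 (fun i j => Gxy q i j (x, z) mu) S0 +
    \int[mu]_z \int[mu]_y tr2 (fun i j => dGxz q i j (x, y, z) mu) S0.
  by rewrite -(intD mu i5 i8'); apply: eq_Rintegral => z _; apply: tr_avg; exact: rdGxz.
have [h1 h2 h3] := int_zw x mu.
(* The two mixed terms of the second flat derivative are exchanged by swapping the variables; with
   the factor 1/2 in front they amount to a single [dGyz] term. *)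
have -> : \int[(p2prob mu \x p2prob mu)%E]_a
      tr2 (fun i j => jl2zw avg_jet i j x mu a.1 a.2) S0 =
    2 * \int[mu]_z \int[mu]_y B1 (x, y, z) mu +
    \int[(p2prob mu \x p2prob mu)%E]_a \int[mu]_y B3 (x, y, a.1, a.2) mu.
  under eq_Rintegral do rewrite Ezw.
  rewrite (RintegralD measurableT h1 (integrableD measurableT h2 h3)).
  rewrite (RintegralD measurableT h2 h3) addrA; congr (_ + _).
  have [_ _ _ -> ->] := creg_swap mu mu mu (sec3 x rB1).
  have [_ _ _ -> _] := creg_swap mu mu mu (swp x).
  by rewrite mulr_natl mulr2n.
rewrite /=; move: (\sum_i _) (tr2 _ S) => s1 s2.
repeat match goal with |- context [Rintegral ?m ?D ?K] =>
  move: (Rintegral m D K) => ? end.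
by field.
Qed.

End averaged_jet.

Lemma seq_cvg_pair (S T : topologicalType) (f : nat -> S) (g : nat -> T) s t :
  f k @[k --> \oo] --> s -> g k @[k --> \oo] --> t ->
  (f k, g k) @[k --> \oo] --> nbhs ((s, t) : (S * T)%type).
Proof. by move=> fs gt; exact: cvg_pair fs gt. Qed.

Section joint_regularity.
Context {R : realType} {n : nat}.
Local Notation E := 'cV[R]_n.
Local Notation P := (P2 R n).
Implicit Types (X Y : normedModType R) (mu m : P).

Definition jcontinuous {X} (K : X -> P -> R) : Prop :=
  continuous (fun a : X * P => K a.1 a.2).

Definition jreg {X} (K : X -> P -> R) : Prop := jcontinuous K /\ qg K.
Definition jlreg {X} (K : X -> P -> R) : Prop := jcontinuous K /\ lg K.

Definition bounded_fun2 {X} (K : X -> P -> R) : Prop :=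
  exists2 C, 0 <= C & forall x m, `|K x m| <= C.

Lemma bounded_qg X (K : X -> P -> R) : bounded_fun2 K -> qg K.
Proof.
move=> [C C0 KC]; exists C => // a m; apply: (le_trans (KC a m)).
by rewrite ler_peMr// -addrA lerDl addr_ge0// sqr_ge0.
Qed.

Lemma jcontinuous_sec X (K : X -> P -> R) m : jcontinuous K -> continuous (K^~ m).
Proof.
move=> cK; apply: (@cont_comp _ _ _ (fun x => (x, m)) _ _ cK).
by apply: cont_pair; [exact: cont_id|exact: cont_cst].
Qed.

Lemma jcontinuous_mu X (K : X -> P -> R) x m : jcontinuous K ->
  {for m, continuous (K x)}.
Proof.
move=> cK; apply: (@cont_comp _ _ _ (fun m => (x, m)) _ _ cK).
by apply: cont_pair; [exact: cont_cst|exact: cont_id].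
Qed.

Lemma jreg_creg X (K : X -> P -> R) : jreg K -> creg K.
Proof. by move=> [cK qK]; split => // m; exact: jcontinuous_sec. Qed.

Lemma jlreg_lreg X (K : X -> P -> R) : jlreg K -> lreg K.
Proof. by move=> [cK qK]; split => // m; exact: jcontinuous_sec. Qed.

Lemma lg_qg X (K : X -> P -> R) : lg K -> qg K.
Proof.
move=> [C C0 KC]; exists (C * 2); first by rewrite mulr_ge0.
move=> x m; apply: (le_trans (KC _ _)); rewrite -mulrA ler_wpM2l//.
have := sqr_ge0 (`|x| - 1); have := sqr_ge0 (mean m - 1).
by rewrite !sqrrB expr1n; nra.
Qed.

Lemma jlreg_jreg X (K : X -> P -> R) : jlreg K -> jreg K.
Proof. by move=> [cK lK]; split => //; exact: lg_qg. Qed.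

Lemma jcontinuous_comp X Y (phi : X -> Y) (K : Y -> P -> R) :
  slope1 phi -> jcontinuous K -> jcontinuous (fun x m => K (phi x) m).
Proof.
move=> [cp _] cK; apply: (@cont_comp _ _ _ (fun a : X * P => (phi a.1, a.2)) _ _ cK).
apply: cont_pair; last by move=> a; exact: cvg_snd.
by apply: (@cont_comp _ _ _ fst phi) cp => a; exact: cvg_fst.
Qed.

Lemma jreg_comp X Y (phi : X -> Y) (K : Y -> P -> R) :
  slope1 phi -> jreg K -> jreg (fun x m => K (phi x) m).
Proof.
move=> sp [cK qK]; split; first exact: jcontinuous_comp.
have [] := @creg_comp R n X Y phi (fun y m => K y m) sp => //.
by split => // m; exact: jcontinuous_sec.
Qed.

Lemma jlreg_comp X Y (phi : X -> Y) (K : Y -> P -> R) :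
  slope1 phi -> jlreg K -> jlreg (fun x m => K (phi x) m).
Proof.
move=> sp [cK qK]; split; first exact: jcontinuous_comp.
have [] := @lreg_comp R n X Y phi (fun y m => K y m) sp => //.
by split => // m; exact: jcontinuous_sec.
Qed.

Lemma jlregB X (K L : X -> P -> R) : jlreg K -> jlreg L ->
  jlreg (fun x m => K x m - L x m).
Proof.
move=> rK rL; split; first by apply: cont_B; [exact: rK.1|exact: rL.1].
by have [] := lregB (jlreg_lreg rK) (jlreg_lreg rL).
Qed.

(** [is_lfd_deriv] with a parameter in [-1, 1] that moves x along [v]; joint continuity of [dK']
    gives the required continuity at the origin. *)
Lemma lfd_derive_comm (v : E) (K K' : E -> P -> R) (dK dK' : E * E -> P -> R) x mu :
  (forall x m, is_derive x v (K^~ m) (K' x m)) ->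
  (forall x m, is_lfd (K x) m (fun z => dK (x, z) m)) ->
  (forall x z m, is_derive x v (fun x => dK (x, z) m) (dK' (x, z) m)) ->
  jreg dK' -> is_lfd (K' x) mu (fun z => dK' (x, z) mu).
Proof.
move=> hK hdK hdK' [cK' qK'].
have I0 : (`[- 1, 1]%classic : set R) 0 by rewrite /= in_itv/= lerN10 ler01.
have l0 : limit_pt (`[- 1, 1]%classic : set R) 0.
  by apply: limit_pt_itv; [lra|rewrite lerN10 ler01].
have := @is_lfd_deriv R n `[- 1, 1] 0 (fun s m => K (x + s *: v) m) (K' x)
  (fun s m z => dK (x + s *: v, z) m) (fun s m z => dK' (x + s *: v, z) m) mu
  (@convex_itv R _ _) I0 l0.
rewrite scale0r addr0; apply.
- by move=> m; exact: (@is_derive_hasD R E (K^~ m)).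
- by move=> s m _; exact: hdK.
- by move=> s m z _; exact: (@is_derive_hasD_at R E (fun x => dK (x, z) m)).
- move=> s m _; apply: continuous_borel.
  have h : creg (fun (z : E) m => dK' (x + s *: v, z) m).
    by apply: (creg_comp _ (jreg_creg (conj cK' qK'))); slope.
  exact: h.1.
- have [C C0 KC] := qK'; exists (C * (1 + (`|x| + `|v|) ^+ 2)).
    by rewrite mulr_ge0// addr_ge0// sqr_ge0.
  move=> s m z; rewrite /= in_itv/= -ler_norml => s1.
  apply: (le_trans (KC _ _)); rewrite -mulrA ler_wpM2l//.
  have h1 : `|x + s *: v| ^+ 2 <= (`|x| + `|v|) ^+ 2.
    rewrite ler_sqr ?nnegrE ?addr_ge0//; apply: (le_trans (ler_normD _ _)).
    by rewrite lerD2l normrZ ler_piMl.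
  have h2 := norm_pair_le (x + s *: v) z.
  have := sqr_ge0 `|z|; have := sqr_ge0 (mean m); have := sqr_ge0 (`|x| + `|v|).
  by move: h1 h2; set A := (_ + _) ^+ 2; set B := _ ^+ 2; set D := `|z| ^+ 2; nra.
- move=> nu z a e Ia Ie a0 e0.
  have c0 : x + a k *: v @[k --> \oo] --> x.
    have := @seq_line_cvg R E x v 0 a a a0 a0.
    by under eq_fun do rewrite scaler0 addr0.
  have cz : (fun _ : nat => z) k @[k --> \oo] --> z by exact: cvg_cst.
  have c1 := seq_cvg_pair c0 cz.
  have c2 := @mix_seq_cvg R n e mu nu Ie e0.
  exact: (cvg_comp _ _ (seq_cvg_pair c1 c2) (cK' ((x, z), mu))).
Qed.

Lemma int_bounded m (K : E -> R) C : aint K -> (forall y, `|K y| <= C) ->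
  `|\int[m]_y K y| <= C.
Proof.
move=> iK KC; apply: (le_trans (le_normr_Rintegral measurableT (iK m))).
rewrite -[leRHS](int_cst m); apply: le_Rintegral => //.
  by have := integrable_abse (iK m); apply: eq_integrable.
exact: aint_cst.
Qed.

End joint_regularity.

(** * The value function at a fixed time *)

Section value_function.
Context {R : realType} {n : nat}.
Local Notation E := 'cV[R]_n.
Local Notation P := (P2 R n).
Local Notation b := Defs.basis.
Implicit Types (mu m : P) (i j : 'I_n) (x y z w : E).

(* V at a fixed time with its flat derivatives h, k, l of order 1, 2, 3 *)
Record base := Base {
  v : E -> P -> R ; vx : 'I_n -> E -> P -> R ; vxx : 'I_n -> 'I_n -> E -> P -> R ;
  h : E * E -> P -> R ;
  hx : 'I_n -> E * E -> P -> R ; hy : 'I_n -> E * E -> P -> R ;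
  hxx : 'I_n -> 'I_n -> E * E -> P -> R ;
  hyy : 'I_n -> 'I_n -> E * E -> P -> R ;
  hxy : 'I_n -> 'I_n -> E * E -> P -> R ;
  k : E * E * E -> P -> R ;
  kx : 'I_n -> E * E * E -> P -> R ; ky : 'I_n -> E * E * E -> P -> R ;
  kz : 'I_n -> E * E * E -> P -> R ;
  kyy : 'I_n -> 'I_n -> E * E * E -> P -> R ;
  kxy : 'I_n -> 'I_n -> E * E * E -> P -> R ;
  kyz : 'I_n -> 'I_n -> E * E * E -> P -> R ;
  l : E * E * E * E -> P -> R ;
  ly : 'I_n -> E * E * E * E -> P -> R ; lz : 'I_n -> E * E * E * E -> P -> R ;
  lyz : 'I_n -> 'I_n -> E * E * E * E -> P -> R }.

Record base_ok (q : base) : Prop := {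
  rv : jreg (v q) ; rvx : forall i, jlreg (vx q i) ; rvxx : forall i j, jreg (vxx q i j) ;
  rh : jreg (h q) ; rhx : forall i, jlreg (hx q i) ; rhy : forall i, jlreg (hy q i) ;
  rhxx : forall i j, jreg (hxx q i j) ; rhyy : forall i j, jreg (hyy q i j) ;
  rhxy : forall i j, jreg (hxy q i j) ;
  rk : jreg (k q) ; rky : forall i, jlreg (ky q i) ;
  rkyy : forall i j, jreg (kyy q i j) ; rkxy : forall i j, jreg (kxy q i j) ;
  rkyz : forall i j, jreg (kyz q i j) ; bkyz : forall i j, bounded_fun2 (kyz q i j) ;
  rl : jreg (l q) ; rly : forall i, jlreg (ly q i) ;
  rlyz : forall i j, jreg (lyz q i j) ; blyz : forall i j, bounded_fun2 (lyz q i j) ;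
  lv : forall x m, is_lfd (v q x) m (fun y => h q (x, y) m) ;
  lh : forall x y m, is_lfd (h q (x, y)) m (fun z => k q (x, y, z) m) ;
  lk : forall x y z m, is_lfd (k q (x, y, z)) m (fun w => l q (x, y, z, w) m) ;
  Dvx : forall i x m, is_derive x (b i) (fun x => v q x m) (vx q i x m) ;
  Dvxx : forall i j x m, is_derive x (b i) (fun x => vx q j x m) (vxx q i j x m) ;
  Dhx : forall i x y m, is_derive x (b i) (fun x => h q (x, y) m) (hx q i (x, y) m) ;
  Dhy : forall i x y m, is_derive y (b i) (fun y => h q (x, y) m) (hy q i (x, y) m) ;
  Dhxx : forall i j x y m,
    is_derive x (b i) (fun x => hx q j (x, y) m) (hxx q i j (x, y) m) ;
  Dhyy : forall i j x y m,
    is_derive y (b i) (fun y => hy q j (x, y) m) (hyy q i j (x, y) m) ;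
  Dhxy : forall i j x y m,
    is_derive x (b i) (fun x => hy q j (x, y) m) (hxy q i j (x, y) m) ;
  Dkx : forall i x y z m,
    is_derive x (b i) (fun x => k q (x, y, z) m) (kx q i (x, y, z) m) ;
  Dky : forall i x y z m,
    is_derive y (b i) (fun y => k q (x, y, z) m) (ky q i (x, y, z) m) ;
  Dkz : forall i x y z m,
    is_derive z (b i) (fun z => k q (x, y, z) m) (kz q i (x, y, z) m) ;
  Dkyy : forall i j x y z m,
    is_derive y (b i) (fun y => ky q j (x, y, z) m) (kyy q i j (x, y, z) m) ;
  Dkxy : forall i j x y z m,
    is_derive x (b i) (fun x => ky q j (x, y, z) m) (kxy q i j (x, y, z) m) ;
  Dkyz : forall i j x y z m,
    is_derive y (b i) (fun y => kz q j (x, y, z) m) (kyz q i j (x, y, z) m) ;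
  Dly : forall i x y z w m,
    is_derive y (b i) (fun y => l q (x, y, z, w) m) (ly q i (x, y, z, w) m) ;
  Dlz : forall i x y z w m,
    is_derive z (b i) (fun z => l q (x, y, z, w) m) (lz q i (x, y, z, w) m) ;
  Dlyz : forall i j x y z w m,
    is_derive y (b i) (fun y => lz q j (x, y, z, w) m) (lyz q i j (x, y, z, w) m) }.

Variable q : base.
Hypothesis qok : base_ok q.

Lemma is_derive_unique (X : normedModType R) (K : X -> R) (x u : X) r s :
  is_derive x u K r -> is_derive x u K s -> r = s.
Proof. by move=> [_ <-] [_ <-]. Qed.

Lemma k_sym x y z m : k q (x, y, z) m + h q (x, z) m = k q (x, z, y) m + h q (x, y) m.
Proof.
have r1 : jreg (fun y m => h q (x, y) m) by apply: jreg_comp (rh qok); slope.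
have r2 : jreg (fun (a : E * E) m => k q (x, a.1, a.2) m).
  by apply: jreg_comp (rk qok); slope.
apply: (@lfd2_sym R n (v q x) (fun y m => h q (x, y) m)
  (fun a m => k q (x, a.1, a.2) m) m y z) => /=.
- by move=> m'; exact: lv.
- by move=> y' m'; exact: lh.
- by move=> m'; apply: cont2_measurable; exact: (jreg_creg r2).1.
- exact: r1.2.
- exact: r2.2.
- by move=> y'; exact: (@jcontinuous_mu R n E (fun y m => h q (x, y) m) y' m r1.1).
- by move=> a; exact: (@jcontinuous_mu R n _
    (fun (a : E * E) m => k q (x, a.1, a.2) m) a m r2.1).
Qed.

(** The identity [k_sym] holds for every measure, so it may be differentiated in the measure. *)
Lemma l_sym12 x y z w m :
  l q (x, y, z, w) m + k q (x, z, w) m = l q (x, z, y, w) m + k q (x, y, w) m.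
Proof.
have h1 := is_lfdD (lk qok x y z m) (lh qok x z m).
have h2 := is_lfdD (lk qok x z y m) (lh qok x y m).
rewrite (funext (k_sym x y z)) in h1.
exact: (congr1 (@^~ w) (is_lfd_unique h1 h2)).
Qed.

(** The symmetry theorem for [h q (x, y)] in place of V. *)
Lemma l_sym23 x y z w m :
  l q (x, y, z, w) m + k q (x, y, w) m = l q (x, y, w, z) m + k q (x, y, z) m.
Proof.
have r1 : jreg (fun z m => k q (x, y, z) m) by apply: jreg_comp (rk qok); slope.
have r2 : jreg (fun (a : E * E) m => l q (x, y, a.1, a.2) m).
  by apply: jreg_comp (rl qok); slope.
apply: (@lfd2_sym R n (h q (x, y)) (fun z m => k q (x, y, z) m)
  (fun a m => l q (x, y, a.1, a.2) m) m z w) => /=.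
- by move=> m'; exact: lh.
- by move=> y' m'; exact: lk.
- by move=> m'; apply: cont2_measurable; exact: (jreg_creg r2).1.
- exact: r1.2.
- exact: r2.2.
- by move=> y'; exact: (@jcontinuous_mu R n E (fun z m => k q (x, y, z) m) y' m r1.1).
- by move=> a; exact: (@jcontinuous_mu R n _
    (fun (a : E * E) m => l q (x, y, a.1, a.2) m) a m r2.1).
Qed.

(** [l_sym12] moves y past z, then [l_sym23] moves it past w. Regularity of [l] is recorded in its
    second and third variables, while the jets differentiate the last two. *)
Lemma l_rot x y z w m : l q (x, y, z, w) m =
  l q (x, z, w, y) m + k q (x, y, w) m + k q (x, z, y) m - 2 * k q (x, z, w) m.
Proof. by have := l_sym12 x y z w m; have := l_sym23 x z y w m; lra. Qed.

Lemma is_derive_sub (X : normedModType R) (K L : X -> R) (x u : X) r s :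
  is_derive x u K r -> is_derive x u L s -> is_derive x u (fun a => K a - L a) (r - s).
Proof. by move=> hK hL; exact: is_deriveB. Qed.

(** [k_sym] turns the last variable into the middle one, up to [h]. This is how [kz] acquires linear
    growth and second derivatives in x and z, from those of [ky] and [hy]. *)
Lemma kzE j x y z m : kz q j (x, y, z) m = ky q j (x, z, y) m - hy q j (x, z) m.
Proof.
apply: (is_derive_unique (Dkz qok j x y z m)).
have -> : (fun z => k q (x, y, z) m) =
   (fun z => (k q (x, z, y) m - h q (x, z) m) + h q (x, y) m).
  by apply/funext => z'; have := k_sym x y z' m; lra.
apply: is_derive_addc; apply: is_derive_sub; [exact: Dky|exact: Dhy].
Qed.

Lemma lzE j x y z w m :
  lz q j (x, y, z, w) m = ly q j (x, z, y, w) m - ky q j (x, z, w) m.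
Proof.
apply: (is_derive_unique (Dlz qok j x y z w m)).
have -> : (fun z => l q (x, y, z, w) m) =
   (fun z => (l q (x, z, y, w) m - k q (x, z, w) m) + k q (x, y, w) m).
  by apply/funext => z'; have := l_sym12 x y z' w m; lra.
apply: is_derive_addc; apply: is_derive_sub; [exact: Dly|exact: Dky].
Qed.

Lemma rkz j : jlreg (kz q j).
Proof.
have -> : kz q j = (fun a m => ky q j (a.1.1, a.2, a.1.2) m - hy q j (a.1.1, a.2) m).
  by apply/funext => -[[x y] z]; apply/funext => m; exact: kzE.
apply: jlregB.
  by apply: (jlreg_comp _ (rky qok j)); slope.
by apply: (jlreg_comp _ (rhy qok j)); slope.
Qed.

Lemma rlz j : jlreg (lz q j).
Proof.
have -> : lz q j = (fun a m => ly q j (a.1.1.1, a.1.2, a.1.1.2, a.2) m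
    - ky q j (a.1.1.1, a.1.2, a.2) m).
  by apply/funext => -[[[x y] z] w]; apply/funext => m; exact: lzE.
apply: jlregB.
  by apply: (jlreg_comp _ (rly qok j)); slope.
by apply: (jlreg_comp _ (rky qok j)); slope.
Qed.

Lemma hxy_swap i j x y m :
  is_derive y (b j) (fun y => hx q i (x, y) m) (hxy q i j (x, y) m).
Proof.
apply: (@clairaut2 R E E (h q ^~ m) (hx q i ^~ m) (hy q j ^~ m) (hxy q i j ^~ m)
  (b i) (b j)).
- by move=> *; exact: Dhx.
- by move=> *; exact: Dhy.
- by move=> *; exact: Dhxy.
- exact: (jreg_creg (rhxy qok i j)).1.
Qed.

Lemma kyz_swap i j x y z m :
  is_derive z (b j) (fun z => ky q i (x, y, z) m) (kyz q i j (x, y, z) m).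
Proof.
apply: (@clairaut2 R E E (fun a => k q (x, a.1, a.2) m)
  (fun a => ky q i (x, a.1, a.2) m) (fun a => kz q j (x, a.1, a.2) m)
  (fun a => kyz q i j (x, a.1, a.2) m) (b i) (b j)) => /=.
- by move=> *; exact: Dky.
- by move=> *; exact: Dkz.
- by move=> *; exact: Dkyz.
- have hr : creg (fun (a : E * E) m => kyz q i j (x, a.1, a.2) m).
    by apply: (creg_comp _ (jreg_creg (rkyz qok i j))); slope.
  exact: hr.1.
Qed.

(** The correction term in [kzE] is free of y, so it vanishes in the mixed derivative and the
    symmetry is exact. *)
Lemma kyz_sym i j x y z m : kyz q i j (x, y, z) m = kyz q j i (x, z, y) m.
Proof.
apply: (is_derive_unique (Dkyz qok i j x y z m)).
have -> : (fun y => kz q j (x, y, z) m) =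
   (fun y => ky q j (x, z, y) m + - hy q j (x, z) m).
  by apply/funext => y'; exact: kzE.
apply: is_derive_addc; exact: kyz_swap.
Qed.

Lemma Dkzx i j x y z m : is_derive x (b i) (fun x => kz q j (x, y, z) m)
  (kxy q i j (x, z, y) m - hxy q i j (x, z) m).
Proof.
rewrite (_ : (fun x => _) = (fun x => ky q j (x, z, y) m - hy q j (x, z) m)).
  by apply: is_derive_sub; [exact: Dkxy|exact: Dhxy].
by apply/funext => x'; exact: kzE.
Qed.

Lemma Dkzz i j x y z m : is_derive z (b i) (fun z => kz q j (x, y, z) m)
  (kyy q i j (x, z, y) m - hyy q i j (x, z) m).
Proof.
rewrite (_ : (fun z => _) = (fun z => ky q j (x, z, y) m - hy q j (x, z) m)).
  by apply: is_derive_sub; [exact: Dkyy|exact: Dhyy].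
by apply/funext => z'; exact: kzE.
Qed.

(* the derivative of l in its last variable, read off from l_rot *)
Definition lw j (x y z w : E) m : R :=
  lz q j (x, z, w, y) m + kz q j (x, y, w) m - 2 * kz q j (x, z, w) m.

Lemma Dlw j x y z w m :
  is_derive w (b j) (fun w => l q (x, y, z, w) m) (lw j x y z w m).
Proof.
rewrite (_ : (fun w => _) = (fun w => l q (x, z, w, y) m
  + k q (x, y, w) m - 2 * k q (x, z, w) m + k q (x, z, y) m)); last first.
  by apply/funext => w'; rewrite l_rot; ring.
apply: is_derive_addc; apply: is_derive_sub.
  by apply: is_derive_real; [exact: Dlz|exact: Dkz].
have hk := Dkz qok j x z w m; exact: (is_deriveZ 2 hk).
Qed.

Lemma Dlzw i j x y z w m : is_derive z (b i) (fun z => lw j x y z w m)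
  (lyz q i j (x, z, w, y) m - 2 * kyz q i j (x, z, w) m).
Proof.
rewrite (_ : (fun z => _) = (fun z => lz q j (x, z, w, y) m
  - 2 * kz q j (x, z, w) m + kz q j (x, y, w) m)); last first.
  by apply/funext => z'; rewrite /lw; ring.
apply: is_derive_addc; apply: is_derive_sub; first exact: Dlyz.
have hk := Dkyz qok i j x z w m; exact: (is_deriveZ 2 hk).
Qed.

End value_function.

(** * The families behind Ubar and the correction term *)

Section families.
Context {R : realType} {n : nat}.
Local Notation E := 'cV[R]_n.
Local Notation P := (P2 R n).
Local Notation b := Defs.basis.
Implicit Types (mu m : P) (i j : 'I_n) (x y z w : E).
Variable q : base (R := R) (n := n).
Hypothesis qok : base_ok q.

Let c0 (X : normedModType R) : X -> P -> R := fun _ _ => 0.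

Let rc0 (X : normedModType R) : creg (@c0 X). Proof. exact: creg_cst. Qed.

Let is_derive0 (X : normedModType R) (r : R) (a u : X) : is_derive a u (fun=> r) 0.
Proof. exact: (is_derive_cst r a u). Qed.

Let jc (X Y : normedModType R) (phi : X -> Y) (K : Y -> P -> R) :
  slope1 phi -> jreg K -> creg (fun a m => K (phi a) m).
Proof. by move=> sp rK; apply: (creg_comp sp); exact: jreg_creg. Qed.

Let jlc (X Y : normedModType R) (phi : X -> Y) (K : Y -> P -> R) :
  slope1 phi -> jlreg K -> lreg (fun a m => K (phi a) m).
Proof. by move=> sp rK; apply: (lreg_comp sp); exact: jlreg_lreg. Qed.

Definition value_jet : jet := Jet (v q) (vx q) (vxx q)
  (fun x mu z => h q (x, z) mu) (fun i x mu z => hy q i (x, z) mu)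
  (fun i j x mu z => hyy q i j (x, z) mu) (fun i j x mu z => hxy q i j (x, z) mu)
  (fun x mu z w => k q (x, z, w) mu) (fun j x mu z w => kz q j (x, z, w) mu)
  (fun i j x mu z w => kyz q i j (x, z, w) mu).

Lemma value_jet_ok : jet_ok value_jet.
Proof.
split=> /=; move=> *; [exact: Dvx|exact: Dvxx|exact: lv|exact: Dhy|exact: Dhyy|
  exact: Dhxy|exact: lh|exact: Dkz|exact: Dkyz].
Qed.

(* (x, y) |-> V(y), whose average is Ubar *)
Definition value_family : family := Family
  (fun a m => v q a.2 m) (fun _ => @c0 _) (fun i a m => vx q i a.2 m)
  (fun _ _ => @c0 _) (fun i j a m => vxx q i j a.2 m) (fun _ _ => @c0 _)
  (fun a m => h q (a.1.2, a.2) m) (fun i a m => hx q i (a.1.2, a.2) m)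
  (fun i a m => hy q i (a.1.2, a.2) m) (fun i j a m => hyy q i j (a.1.2, a.2) m)
  (fun _ _ => @c0 _) (fun i j a m => hxy q i j (a.1.2, a.2) m)
  (fun a m => k q (a.1.1.2, a.1.2, a.2) m)
  (fun j a m => kz q j (a.1.1.2, a.1.2, a.2) m)
  (fun i j a m => kyz q i j (a.1.1.2, a.1.2, a.2) m).

Lemma value_family_ok : family_ok value_family.
Proof.
split=> /=.
- by apply: (jc _ (rv qok)); slope.
- by move=> i; exact: rc0.
- by move=> i; apply: (jlc _ (rvx qok i)); slope.
- by move=> i j; exact: rc0.
- by move=> i j; apply: (jc _ (rvxx qok i j)); slope.
- by move=> i j; exact: rc0.
- by apply: (jc _ (rh qok)); slope.
- by move=> i; apply: (jlc _ (rhy qok i)); slope.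
- by move=> i j; apply: (jc _ (rhyy qok i j)); slope.
- by move=> i j; exact: rc0.
- by move=> i j; apply: (jc _ (rhxy qok i j)); slope.
- by apply: (jc _ (rk qok)); slope.
- by move=> i; apply: lreg_creg; apply: (jlc _ (rkz qok i)); slope.
- by move=> i j; apply: (jc _ (rkyz qok i j)); slope.
- by move=> x y m; exact: lv.
- by move=> x y z m; exact: lh.
- by move=> i x y m; exact: is_derive0.
- by move=> i x y m; exact: Dvx.
- by move=> i j x y m; exact: is_derive0.
- by move=> i j x y m; exact: Dvxx.
- by move=> i j x y m; exact: is_derive0.
- by move=> i x y z m; exact: Dhx.
- by move=> i x y z m; exact: Dhy.
- by move=> i j x y z m; exact: Dhyy.
- by move=> i j x y z m; exact: is_derive0.
- by move=> i j x y z m; exact: Dhxy.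
- by move=> j x y z w m; exact: Dkz.
- by move=> i j x y z w m; exact: Dkyz.
Qed.

(* the averages of delta_mu V(y; x) and, below, of delta_mu V(y; y) make up the
   correction term of U *)
Definition lin_family : family := Family
  (fun a m => h q (a.2, a.1) m) (fun i a m => hy q i (a.2, a.1) m)
  (fun i a m => hx q i (a.2, a.1) m) (fun i j a m => hyy q i j (a.2, a.1) m)
  (fun i j a m => hxx q i j (a.2, a.1) m) (fun i j a m => hxy q j i (a.2, a.1) m)
  (fun a m => k q (a.1.2, a.1.1, a.2) m)
  (fun i a m => kx q i (a.1.2, a.1.1, a.2) m)
  (fun i a m => kz q i (a.1.2, a.1.1, a.2) m)
  (fun i j a m => kyy q i j (a.1.2, a.2, a.1.1) m - hyy q i j (a.1.2, a.2) m)
  (fun i j a m => kyz q i j (a.1.2, a.1.1, a.2) m)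
  (fun i j a m => kxy q i j (a.1.2, a.2, a.1.1) m - hxy q i j (a.1.2, a.2) m)
  (fun a m => l q (a.1.1.2, a.1.1.1, a.1.2, a.2) m)
  (fun j a m => lw q j a.1.1.2 a.1.1.1 a.1.2 a.2 m)
  (fun i j a m => lyz q i j (a.1.1.2, a.1.2, a.2, a.1.1.1) m
     - 2 * kyz q i j (a.1.1.2, a.1.2, a.2) m).

Let rlw (X : normedModType R) j (p1 p2 p3 p4 : X -> E) :
  slope1 p1 -> slope1 p2 -> slope1 p3 -> slope1 p4 ->
  creg (fun a m => lw q j (p1 a) (p2 a) (p3 a) (p4 a) m).
Proof.
move=> s1 s2 s3 s4; apply: cregB; first apply: cregD.
- apply: lreg_creg; apply: (@jlc X _ (fun a => (p1 a, p3 a, p4 a, p2 a)) _ _ (rlz qok j)).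
  by do 3 (apply: slope1_pair => //).
- apply: lreg_creg; apply: (@jlc X _ (fun a => (p1 a, p2 a, p4 a)) _ _ (rkz qok j)).
  by do 2 (apply: slope1_pair => //).
- apply: cregZ; apply: lreg_creg.
  apply: (@jlc X _ (fun a => (p1 a, p3 a, p4 a)) _ _ (rkz qok j)).
  by do 2 (apply: slope1_pair => //).
Qed.

Lemma lin_family_ok : family_ok lin_family.
Proof.
split=> /=.
- by apply: (jc _ (rh qok)); slope.
- by move=> i; apply: lreg_creg; apply: (jlc _ (rhy qok i)); slope.
- by move=> i; apply: (jlc _ (rhx qok i)); slope.
- by move=> i j; apply: (jc _ (rhyy qok i j)); slope.
- by move=> i j; apply: (jc _ (rhxx qok i j)); slope.
- by move=> i j; apply: (jc _ (rhxy qok j i)); slope.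
- by apply: (jc _ (rk qok)); slope.
- by move=> i; apply: (jlc _ (rkz qok i)); slope.
- move=> i j; apply: cregB; first by apply: (jc _ (rkyy qok i j)); slope.
  by apply: (jc _ (rhyy qok i j)); slope.
- by move=> i j; apply: (jc _ (rkyz qok i j)); slope.
- move=> i j; apply: cregB; first by apply: (jc _ (rkxy qok i j)); slope.
  by apply: (jc _ (rhxy qok i j)); slope.
- by apply: (jc _ (rl qok)); slope.
- by move=> j; apply: rlw; slope.
- move=> i j; apply: cregB; first by apply: (jc _ (rlyz qok i j)); slope.
  by apply: cregZ; apply: (jc _ (rkyz qok i j)); slope.
- by move=> x y m; exact: lh.
- by move=> x y z m; exact: lk.
- by move=> i x y m; exact: Dhy.
- by move=> i x y m; exact: Dhx.
- by move=> i j x y m; exact: Dhyy.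
- by move=> i j x y m; exact: Dhxx.
- by move=> i j x y m; exact: hxy_swap.
- by move=> i x y z m; exact: Dkx.
- by move=> i x y z m; exact: Dkz.
- by move=> i j x y z m; exact: Dkzz.
- by move=> i j x y z m; exact: Dkyz.
- by move=> i j x y z m; exact: Dkzx.
- by move=> j x y z w m; exact: Dlw.
- by move=> i j x y z w m; exact: Dlzw.
Qed.

(** The function is y |-> delta_mu V(y; y), extended by a dummy x. Derivatives in y follow the chain
    rule along the diagonal; those in z and w are the ones of [lin_family] with both arguments
    equal. *)
Definition diag_family : family := Family
  (fun a m => h q (a.2, a.2) m) (fun _ => @c0 _)
  (fun i a m => hx q i (a.2, a.2) m + hy q i (a.2, a.2) m)
  (fun _ _ => @c0 _)
  (fun i j a m => hxx q i j (a.2, a.2) m + hxy q j i (a.2, a.2) m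
    + (hxy q i j (a.2, a.2) m + hyy q i j (a.2, a.2) m))
  (fun _ _ => @c0 _)
  (fun a m => k q (a.1.2, a.1.2, a.2) m)
  (fun i a m => ky q i (a.1.2, a.1.2, a.2) m + kx q i (a.1.2, a.1.2, a.2) m)
  (fun i a m => kz q i (a.1.2, a.1.2, a.2) m)
  (fun i j a m => kyy q i j (a.1.2, a.2, a.1.2) m - hyy q i j (a.1.2, a.2) m)
  (fun _ _ => @c0 _)
  (fun i j a m => kxy q i j (a.1.2, a.2, a.1.2) m - hxy q i j (a.1.2, a.2) m
     + kyz q i j (a.1.2, a.1.2, a.2) m)
  (fun a m => l q (a.1.1.2, a.1.1.2, a.1.2, a.2) m)
  (fun j a m => lw q j a.1.1.2 a.1.1.2 a.1.2 a.2 m)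
  (fun i j a m => lyz q i j (a.1.1.2, a.1.2, a.2, a.1.1.2) m
     - 2 * kyz q i j (a.1.1.2, a.1.2, a.2) m).

(** The direction (u, u) is the sum of (u, 0) and (0, u); only the first partial derivative has to
    be continuous. *)
Let is_derive_diag (K Kx : E * E -> R) u x r :
  (forall x y, is_derive x u (fun x => K (x, y)) (Kx (x, y))) ->
  continuous Kx -> is_derive x u (fun y => K (x, y)) r ->
  is_derive x u (fun x => K (x, x)) (Kx (x, x) + r).
Proof.
move=> hK cK hr.
apply: (@is_derive_affine R _ E (fun x : E => (x, x)) u ((u, 0) + (0, u)) K).
  by move=> s; rewrite scalerDr; congr pair; rewrite /= scaler0 ?addr0 ?add0r.
apply: (@is_derive_addv R _ (u, 0) (0, u) K Kx) => //.
  by case=> x' y'; apply/is_derive_fst.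
by apply/is_derive_snd.
Qed.

(** The mirror image, with continuity asked of the second partial derivative: for [k], regularity is
    recorded for [ky] and not for [kx]. *)
Let is_derive_diag' (K Ky : E * E -> R) u x r :
  (forall x y, is_derive y u (fun y => K (x, y)) (Ky (x, y))) ->
  continuous Ky -> is_derive x u (fun x' => K (x', x)) r ->
  is_derive x u (fun x => K (x, x)) (Ky (x, x) + r).
Proof.
move=> hK cK hr.
apply: (@is_derive_affine R _ E (fun x : E => (x, x)) u ((0, u) + (u, 0)) K).
  by move=> s; rewrite scalerDr; congr pair; rewrite /= scaler0 ?addr0 ?add0r.
apply: (@is_derive_addv R _ (0, u) (u, 0) K Ky) => //.
  by case=> x' y'; apply/is_derive_snd.
by apply/is_derive_fst.
Qed.

Let cont_of (X : normedModType R) (K : X -> P -> R) m : jreg K -> continuous (K^~ m).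
Proof. by move=> /jreg_creg[]. Qed.

Lemma diag_family_ok : family_ok diag_family.
Proof.
split=> /=.
- by apply: (jc _ (rh qok)); slope.
- by move=> i; exact: rc0.
- move=> i; apply: lregD; first by apply: (jlc _ (rhx qok i)); slope.
  by apply: (jlc _ (rhy qok i)); slope.
- by move=> i j; exact: rc0.
- move=> i j; apply: cregD; apply: cregD.
  + by apply: (jc _ (rhxx qok i j)); slope.
  + by apply: (jc _ (rhxy qok j i)); slope.
  + by apply: (jc _ (rhxy qok i j)); slope.
  + by apply: (jc _ (rhyy qok i j)); slope.
- by move=> i j; exact: rc0.
- by apply: (jc _ (rk qok)); slope.
- by move=> i; apply: (jlc _ (rkz qok i)); slope.
- move=> i j; apply: cregB; first by apply: (jc _ (rkyy qok i j)); slope.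
  by apply: (jc _ (rhyy qok i j)); slope.
- by move=> i j; exact: rc0.
- move=> i j; apply: cregD; last by apply: (jc _ (rkyz qok i j)); slope.
  apply: cregB; first by apply: (jc _ (rkxy qok i j)); slope.
  by apply: (jc _ (rhxy qok i j)); slope.
- by apply: (jc _ (rl qok)); slope.
- by move=> j; apply: rlw; slope.
- move=> i j; apply: cregB; first by apply: (jc _ (rlyz qok i j)); slope.
  by apply: cregZ; apply: (jc _ (rkyz qok i j)); slope.
- by move=> x y m; exact: lh.
- by move=> x y z m; exact: lk.
- by move=> i x y m; exact: is_derive0.
- move=> i x y m; apply: (@is_derive_diag (h q ^~ m) (hx q i ^~ m)).
  + by move=> *; exact: Dhx.
  + exact: (cont_of (jlreg_jreg (rhx qok i))).
  + exact: Dhy.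
- by move=> i j x y m; exact: is_derive0.
- move=> i j x y m; apply: is_derive_real.
    apply: (@is_derive_diag (hx q j ^~ m) (hxx q i j ^~ m)).
    + by move=> *; exact: Dhxx.
    + exact: (cont_of (rhxx qok i j)).
    + exact: hxy_swap.
  apply: (@is_derive_diag (hy q j ^~ m) (hxy q i j ^~ m)).
  + by move=> *; exact: Dhxy.
  + exact: (cont_of (rhxy qok i j)).
  + exact: Dhyy.
- by move=> i j x y m; exact: is_derive0.
- move=> i x y z m.
  apply: (@is_derive_diag' (fun a => k q (a.1, a.2, z) m) (fun a => ky q i (a.1, a.2, z) m)).
  + by move=> *; exact: Dky.
  + have hr : creg (fun (a : E * E) m => ky q i (a.1, a.2, z) m).
      by apply: (jc _ (jlreg_jreg (rky qok i))); slope.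
    exact: hr.1.
  + exact: Dkx.
- by move=> i x y z m; exact: Dkz.
- by move=> i j x y z m; exact: Dkzz.
- by move=> i j x y z m; exact: is_derive0.
- move=> i j x y z m.
  apply: (@is_derive_diag (fun a => kz q j (a.1, a.2, z) m)
    (fun a => kxy q i j (a.1, z, a.2) m - hxy q i j (a.1, z) m)).
  + by move=> *; exact: Dkzx.
  + have hr : creg (fun (a : E * E) m => kxy q i j (a.1, z, a.2) m - hxy q i j (a.1, z) m).
      apply: cregB; first by apply: (jc _ (rkxy qok i j)); slope.
      by apply: (jc _ (rhxy qok i j)); slope.
    exact: hr.1.
  + exact: Dkyz.
- by move=> j x y z w m; exact: Dlw.
- by move=> i j x y z w m; exact: Dlzw.
Qed.

End families.

(** * The equation of V differentiated in the measure *)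

Section linearised_equation.
Context {R : realType} {n : nat}.
Local Notation E := 'cV[R]_n.
Local Notation P := (P2 R n).
Implicit Types (mu m : P) (i j : 'I_n) (x y z w u : E).
Variable q : base (R := R) (n := n).
Hypothesis qok : base_ok q.

(** First of a series exchanging space derivatives with the flat derivative; a second-order exchange
    takes the first-order one as its hypothesis. *)
Lemma lfd_vx i x m : is_lfd (vx q i x) m (fun u => hx q i (x, u) m).
Proof.
apply: (@lfd_derive_comm R n (Defs.basis i) (v q) (vx q i) (h q) (hx q i)).
- by move=> x' m'; exact: Dvx.
- by move=> x' m'; exact: lv.
- by move=> x' z m'; exact: Dhx.
- exact/jlreg_jreg/rhx.
Qed.

Lemma lfd_vxx i j x m : is_lfd (vxx q i j x) m (fun u => hxx q i j (x, u) m).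
Proof.
apply: (@lfd_derive_comm R n (Defs.basis i) (vx q j) (vxx q i j) (hx q j) (hxx q i j)).
- by move=> x' m'; exact: Dvxx.
- by move=> x' m'; exact: lfd_vx.
- by move=> x' z m'; exact: Dhxx.
- exact: rhxx.
Qed.

Lemma lfd_hy i x y m : is_lfd (hy q i (x, y)) m (fun u => ky q i (x, y, u) m).
Proof.
apply: (@lfd_derive_comm R n (Defs.basis i) (fun y => h q (x, y))
  (fun y => hy q i (x, y)) (fun a m => k q (x, a.1, a.2) m)
  (fun a m => ky q i (x, a.1, a.2) m)) => /=.
- by move=> y' m'; exact: Dhy.
- by move=> y' m'; exact: lh.
- by move=> y' z m'; exact: Dky.
- by apply: (jreg_comp _ (jlreg_jreg (rky qok i))); slope.
Qed.

Lemma lfd_hyy i j x y m : is_lfd (hyy q i j (x, y)) m (fun u => kyy q i j (x, y, u) m).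
Proof.
apply: (@lfd_derive_comm R n (Defs.basis i) (fun y => hy q j (x, y))
  (fun y => hyy q i j (x, y)) (fun a m => ky q j (x, a.1, a.2) m)
  (fun a m => kyy q i j (x, a.1, a.2) m)) => /=.
- by move=> y' m'; exact: Dhyy.
- by move=> y' m'; exact: lfd_hy.
- by move=> y' z m'; exact: Dkyy.
- by apply: (jreg_comp _ (rkyy qok i j)); slope.
Qed.

Lemma lfd_hxy i j x y m : is_lfd (hxy q i j (x, y)) m (fun u => kxy q i j (x, y, u) m).
Proof.
apply: (@lfd_derive_comm R n (Defs.basis i) (fun x => hy q j (x, y))
  (fun x => hxy q i j (x, y)) (fun a m => ky q j (a.1, y, a.2) m)
  (fun a m => kxy q i j (a.1, y, a.2) m)) => /=.
- by move=> y' m'; exact: Dhxy.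
- by move=> y' m'; exact: lfd_hy.
- by move=> y' z m'; exact: Dkxy.
- by apply: (jreg_comp _ (rkxy qok i j)); slope.
Qed.

Lemma lfd_kz j x y z m : is_lfd (kz q j (x, y, z)) m (fun u => lz q j (x, y, z, u) m).
Proof.
apply: (@lfd_derive_comm R n (Defs.basis j) (fun z => k q (x, y, z))
  (fun z => kz q j (x, y, z)) (fun a m => l q (x, y, a.1, a.2) m)
  (fun a m => lz q j (x, y, a.1, a.2) m)) => /=.
- by move=> y' m'; exact: Dkz.
- by move=> y' m'; exact: lk.
- by move=> y' z' m'; exact: Dlz.
- by apply: (jreg_comp _ (jlreg_jreg (rlz qok j))); slope.
Qed.

Lemma lfd_kyz i j x y z m :
  is_lfd (kyz q i j (x, y, z)) m (fun u => lyz q i j (x, y, z, u) m).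
Proof.
apply: (@lfd_derive_comm R n (Defs.basis i) (fun y => kz q j (x, y, z))
  (fun y => kyz q i j (x, y, z)) (fun a m => lz q j (x, a.1, z, a.2) m)
  (fun a m => lyz q i j (x, a.1, z, a.2) m)) => /=.
- by move=> y' m'; exact: Dkyz.
- by move=> y' m'; exact: lfd_kz.
- by move=> y' z' m'; exact: Dlyz.
- by apply: (jreg_comp _ (rlyz qok i j)); slope.
Qed.

Let bounded_tr2 (X : normedModType R) (K : 'I_n -> 'I_n -> X -> P -> R) S' :
  (forall i j, bounded_fun2 (K i j)) ->
  bounded_fun2 (fun a m => tr2 (fun i j => K i j a m) S').
Proof.
move=> hK; pose C i j := xget 0 [set C | 0 <= C /\ forall a m, `|K i j a m| <= C].
have CP i j : 0 <= C i j /\ forall a m, `|K i j a m| <= C i j.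
  have [c c0 cP] := hK i j.
  exact: (xgetPex (P := [set C | 0 <= C /\ forall a m, `|K i j a m| <= C]) 0
    (ex_intro _ c (conj c0 cP))).
exists (\sum_i \sum_j C i j * `|S' j i|).
  by apply: sumr_ge0 => i _; apply: sumr_ge0 => j _; rewrite mulr_ge0//; have [] := CP i j.
move=> a m; apply: (le_trans (ler_norm_sum _ _ _)); apply: ler_sum => i _.
apply: (le_trans (ler_norm_sum _ _ _)); apply: ler_sum => j _.
by rewrite normrM ler_wpM2r//; have [_] := CP i j.
Qed.

Variables (S S0 : 'M[R]_n) (symS0 : S0^T = S0).

Let lfd_avg1 (G : E * E -> P -> R) (dG : E * E * E -> P -> R) x mu :
  creg G -> creg dG ->
  (forall y m, is_lfd (G (x, y)) m (fun u => dG (x, y, u) m)) ->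
  is_lfd (fun m => \int[m]_y G (x, y) m) mu
    (fun u => G (x, u) mu - \int[mu]_y G (x, y) mu + \int[mu]_y dG (x, y, u) mu).
Proof.
move=> rG rdG hG.
have r1 : creg (fun y m => G (x, y) m) by apply: (creg_comp _ rG); slope.
have r2 : creg (fun (a : E * E) m => dG (x, a.1, a.2) m).
  by apply: (creg_comp _ rdG); slope.
apply: (@is_lfd_integral R n (fun y m => G (x, y) m) (fun a m => dG (x, a.1, a.2) m)).
- by move=> y m; exact: hG.
- by move=> m; apply: continuous_borel; exact: r1.1.
- by move=> m; apply: cont2_measurable; exact: r2.1.
- exact: r1.2.
- exact: r2.2.
Qed.

Let kap (a : E * E * E) m := tr2 (fun i j => kyz q i j a m) S0.
Let lam (a : E * E * E * E) m := tr2 (fun i j => lyz q i j a m) S0.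

Let rkap : creg kap.
Proof. by apply: creg_tr2 => i j; exact/jreg_creg/rkyz. Qed.

Let rlam : creg lam.
Proof. by apply: creg_tr2 => i j; exact/jreg_creg/rlyz. Qed.

Let lfd_kap x y z m : is_lfd (kap (x, y, z)) m (fun u => lam (x, y, z, u) m).
Proof. by apply: is_lfd_tr2 => i j; exact: lfd_kyz. Qed.

Let kap_sym x y z m : kap (x, y, z) m = kap (x, z, y) m.
Proof.
rewrite /kap -[RHS](tr2T _ symS0); apply: eq_tr2 => i j; exact: kyz_sym.
Qed.

Let swap_kap x m (mu nu : P) : [/\ aint (fun y => \int[nu]_z kap (x, y, z) m),
  \int[(p2prob mu \x p2prob nu)%E]_a kap (x, a.1, a.2) m =
    \int[mu]_y \int[nu]_z kap (x, y, z) m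
  & \int[mu]_y \int[nu]_z kap (x, y, z) m = \int[nu]_z \int[mu]_y kap (x, y, z) m].
Proof.
have r : creg (fun (a : E * E) m => kap (x, a.1, a.2) m).
  by apply: (creg_comp _ rkap); slope.
by have [_ ? _ ? ?] := creg_swap m mu nu r.
Qed.

(** [is_lfd_integral] for the inner and then for the outer integral. Boundedness of [kap] and [lam]
    keeps the inner integral in the growth class; a quadratic integrand would leave a second moment
    of [m], which the first moment does not control. Symmetry of [kap] merges two single integrals
    into the factor 2. *)
Let lfd_kap2 x mu : is_lfd
  (fun m => \int[(p2prob m \x p2prob m)%E]_a kap (x, a.1, a.2) m) mu
  (fun u => 2 * \int[mu]_z kap (x, z, u) mu
     - 2 * \int[mu]_y \int[mu]_z kap (x, y, z) mu
     + \int[(p2prob mu \x p2prob mu)%E]_a lam (x, a.1, a.2, u) mu).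
Proof.
have [Ck Ck0 kC] := bounded_tr2 S0 (bkyz qok).
have [Cl Cl0 lC] := bounded_tr2 S0 (blyz qok).
pose G2 y m := \int[m]_z kap (x, y, z) m.
pose dG2 (a : E * E) m := kap (x, a.1, a.2) m - \int[m]_z kap (x, a.1, z) m
  + \int[m]_z lam (x, a.1, z, a.2) m.
have ikap y m m' : aint (fun z => kap (x, y, z) m).
  by apply: (creg_aint_comp _ _ rkap); slope.
have ikap' z m m' : aint (fun y => kap (x, y, z) m).
  by apply: (creg_aint_comp _ _ rkap); slope.
have ilam y u m : aint (fun z => lam (x, y, z, u) m).
  by apply: (creg_aint_comp _ _ rlam); slope.
have rl3 : creg (fun (a : E * E * E) m => lam (x, a.1.1, a.2, a.1.2) m).
  by apply: (creg_comp _ rlam); slope.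
have E2 : (fun m => \int[(p2prob m \x p2prob m)%E]_a kap (x, a.1, a.2) m) =
    (fun m => \int[m]_y G2 y m).
  by apply/funext => m; have [_ -> _] := swap_kap x m m m.
have iG2 m : aint (G2 ^~ m) by have [] := swap_kap x m m m.
have h2 : is_lfd (fun m => \int[m]_y G2 y m) mu (fun u => G2 u mu
    - \int[mu]_y G2 y mu + \int[mu]_y dG2 (y, u) mu).
  apply: is_lfd_integral.
  - move=> y m.
    apply: (@lfd_avg1 (fun a => kap (x, y, a.2)) (fun a => lam (x, y, a.1.2, a.2)) x m).
    + by apply: (creg_comp _ rkap); slope.
    + by apply: (creg_comp _ rlam); slope.
    + by move=> z m'; exact: lfd_kap.
  - by move=> m; exact: aint_measurable (iG2 m).
  - move=> m; apply: measurable_funD; first apply: measurable_funB.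
    + apply: cont2_measurable.
      have r : creg (fun (a : E * E) m => kap (x, a.1, a.2) m).
        by apply: (creg_comp _ rkap); slope.
      exact: r.1.
    + exact: (measurableT_comp (aint_measurable (iG2 m)) measurable_fst).
    + have [/integrableP[mK _] _ _ _] := creg_swap3 m m rl3.
      exact/measurable_EFinP.
  - apply: bounded_qg; exists Ck => // y m.
    by apply: int_bounded; [exact: ikap|move=> z; exact: kC].
  - apply: bounded_qg; exists (Ck + Ck + Cl); first by rewrite !addr_ge0.
    move=> a m; apply: (le_trans (ler_normD _ _)); apply: lerD.
      apply: (le_trans (ler_normB _ _)); apply: lerD; first exact: kC.
      by apply: int_bounded; [exact: ikap|move=> z; exact: kC].
    by apply: int_bounded; [exact: ilam|move=> z; exact: lC].
rewrite E2; suff -> : (fun u => 2 * \int[mu]_z kap (x, z, u) mu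
     - 2 * \int[mu]_y \int[mu]_z kap (x, y, z) mu
     + \int[(p2prob mu \x p2prob mu)%E]_a lam (x, a.1, a.2, u) mu) =
   (fun u => G2 u mu - \int[mu]_y G2 y mu + \int[mu]_y dG2 (y, u) mu) by [].
apply/funext => u.
have rl2 : creg (fun (a : E * E) m => lam (x, a.1, a.2, u) m).
  by apply: (creg_comp _ rlam); slope.
have [_ i2 _ e2 _] := creg_swap mu mu mu rl2.
have i1 := ikap' u mu mu.
have -> : \int[mu]_y dG2 (y, u) mu = \int[mu]_y kap (x, y, u) mu
    - \int[mu]_y G2 y mu + \int[(p2prob mu \x p2prob mu)%E]_a lam (x, a.1, a.2, u) mu.
  rewrite e2 /dG2 (intD mu (aintB i1 (iG2 mu)) i2) (intB mu i1 (iG2 mu)).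
  by [].
have -> : G2 u mu = \int[mu]_y kap (x, y, u) mu.
  by apply: eq_Rintegral => z _; exact: kap_sym.
rewrite /G2; repeat match goal with |- context [Rintegral ?m ?D ?K] =>
  move: (Rintegral m D K) => ? end.
by ring.
Qed.

Variables (f : E -> P -> E) (df : 'I_n -> E * E -> P -> R).
Variables (vt Ls : E -> P -> R) (ht dL : E * E -> P -> R).
Hypothesis rf : forall i, lreg (fun x m => f x m i 0).
Hypothesis rdf : forall i, lreg (df i).
Hypothesis ldf : forall i x m,
  is_lfd (fun m => f x m i 0) m (fun u => df i (x, u) m).
Hypothesis lvt : forall x m, is_lfd (vt x) m (fun u => ht (x, u) m).
Hypothesis lLs : forall x m, is_lfd (Ls x) m (fun u => dL (x, u) m).
Hypothesis value_eq : forall x m,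
  vt x m + jetL f S S0 (value_jet q) x m + Ls x m = 0.

Let tr_hyy (a : E * E) m := tr2 (fun i j => hyy q i j a m) S.
Let tr_hxy (a : E * E) m := tr2 (fun i j => hxy q i j a m) S0.
Let tr_kyy (a : E * E * E) m := tr2 (fun i j => kyy q i j a m) S.
Let tr_kxy (a : E * E * E) m := tr2 (fun i j => kxy q i j a m) S0.
Let A (a : E * E) m := \sum_i hy q i a m * f a.2 m i 0.
Let Bk (a : E * E * E) m := \sum_i ky q i a m * f a.1.2 m i 0.
Let Bh (a : E * E * E) m := \sum_i hy q i (a.1.1, a.1.2) m * df i (a.1.2, a.2) m.

Let rA : creg A.
Proof.
apply: creg_sum => i; apply: cregM; first exact/jlreg_lreg/rhy.
by apply: (@lreg_comp R n (E * E)%type E (fun a => a.2)) (rf i); slope.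
Qed.

Let rBk : creg Bk.
Proof.
apply: creg_sum => i; apply: cregM; first exact/jlreg_lreg/rky.
by apply: (@lreg_comp R n (E * E * E)%type E (fun a => a.1.2)) (rf i); slope.
Qed.

Let rBh : creg Bh.
Proof.
apply: creg_sum => i; apply: cregM.
  by apply: (lreg_comp _ (jlreg_lreg (rhy qok i))); slope.
by apply: (lreg_comp _ (rdf i)); slope.
Qed.

Let rhyy' : creg tr_hyy.
Proof. by apply: creg_tr2 => i j; exact/jreg_creg/rhyy. Qed.
Let rhxy' : creg tr_hxy.
Proof. by apply: creg_tr2 => i j; exact/jreg_creg/rhxy. Qed.
Let rkyy' : creg tr_kyy.
Proof. by apply: creg_tr2 => i j; exact/jreg_creg/rkyy. Qed.
Let rkxy' : creg tr_kxy.
Proof. by apply: creg_tr2 => i j; exact/jreg_creg/rkxy. Qed.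

Let lfdA y z m : is_lfd (A (y, z)) m (fun u => Bk (y, z, u) m + Bh (y, z, u) m).
Proof.
have -> : (fun u => Bk (y, z, u) m + Bh (y, z, u) m) = (fun u =>
   \sum_i (ky q i (y, z, u) m * f z m i 0 + hy q i (y, z) m * df i (z, u) m)).
  by apply/funext => u; rewrite /Bk /Bh -big_split.
by apply: is_lfd_sum => i; apply: is_lfdM; [exact: lfd_hy|exact: ldf].
Qed.

Let lfd_eq y m : is_lfd (fun m => vt y m + jetL f S S0 (value_jet q) y m + Ls y m) m
  (fun u => ht (y, u) m
    + (\sum_i (hx q i (y, u) m * f y m i 0 + vx q i y m * df i (y, u) m)
      + 2^-1 * tr2 (fun i j => hxx q i j (y, u) m) S
      + (A (y, u) m - \int[m]_z A (y, z) m
         + \int[m]_z (Bk (y, z, u) m + Bh (y, z, u) m))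
      + 2^-1 * (tr_hyy (y, u) m - \int[m]_z tr_hyy (y, z) m
         + \int[m]_z tr_kyy (y, z, u) m)
      + (tr_hxy (y, u) m - \int[m]_z tr_hxy (y, z) m
         + \int[m]_z tr_kxy (y, z, u) m)
      + 2^-1 * (2 * \int[m]_z kap (y, z, u) m
         - 2 * \int[m]_w \int[m]_z kap (y, w, z) m
         + \int[(p2prob m \x p2prob m)%E]_a lam (y, a.1, a.2, u) m))
    + dL (y, u) m).
Proof.
apply: is_lfdD (lLs y m); apply: is_lfdD; first exact: lvt.
apply: is_lfdD; last by apply: is_lfdZ; exact: lfd_kap2.
apply: is_lfdD; last first.
  apply: (@lfd_avg1 tr_hxy tr_kxy) => // z m'.
  by apply: is_lfd_tr2 => i j; exact: lfd_hxy.
apply: is_lfdD; last first.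
  apply: is_lfdZ; apply: (@lfd_avg1 tr_hyy tr_kyy) => // z m'.
  by apply: is_lfd_tr2 => i j; exact: lfd_hyy.
apply: is_lfdD; last first.
  have rB := cregD rBk rBh.
  by apply: (@lfd_avg1 A (fun a m => Bk a m + Bh a m)) => // z m'; exact: lfdA.
apply: is_lfdD.
  by apply: is_lfd_sum => i; apply: is_lfdM; [exact: lfd_vx|exact: ldf].
by apply: is_lfdZ; apply: is_lfd_tr2 => i j; exact: lfd_vxx.
Qed.

(* the equation of V, differentiated in the measure at the point x *)
Lemma linearised_value_eq x y mu :
  ht (y, x) mu + family_L (lin_family q) f S S0 x y mu
  + \sum_i vx q i y mu * df i (y, x) mu
  + \int[mu]_z (\sum_i hy q i (y, z) mu * df i (z, x) mu)
  + dL (y, x) mu = 0.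
Proof.
(* The equation of V holds at every measure, so its left side is constant in [m] and, by uniqueness,
   the derivative computed in [lfd_eq] is zero. *)
have c0 : is_lfd (fun m => vt y m + jetL f S S0 (value_jet q) y m + Ls y m) mu (fun=> 0).
  rewrite (_ : (fun m => _) = fun=> 0); first exact: is_lfd_cst.
  by apply/funext => m; exact: value_eq.
have /(congr1 (@^~ x)) := is_lfd_unique (lfd_eq y mu) c0.
have i3 (K : E * E * E -> P -> R) : creg K -> aint (fun z => K (y, z, x) mu).
  by move=> rK; apply: (creg_aint_comp _ _ rK); slope.
have i2 (K : E * E -> P -> R) : creg K -> aint (fun z => K (y, z) mu).
  by move=> rK; apply: (creg_aint_comp _ _ rK); slope.
rewrite (intD mu (i3 _ rBk) (i3 _ rBh)) big_split /=.
rewrite /family_L /=.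
have -> : tr2 (fun i j => hxy q j i (y, x) mu) S0 = tr_hxy (y, x) mu.
  exact: tr2T.
(* By [kzE] the derivative in the last variable splits, and its [hy] part is the normalising term -
   \int A of [lfd_eq]. The two replacements that follow have the same origin. *)
have -> : \int[mu]_z (\sum_i kz q i (y, x, z) mu * f z mu i 0) =
    \int[mu]_z Bk (y, z, x) mu - \int[mu]_z A (y, z) mu.
  rewrite -(intB mu (i3 _ rBk) (i2 _ rA)); apply: eq_Rintegral => z _.
  rewrite /Bk /A -sumrB; apply: eq_bigr => i _ /=.
  by rewrite (kzE qok) mulrBl.
have -> : \int[mu]_z tr2 (fun i j => kyy q i j (y, z, x) mu - hyy q i j (y, z) mu) S =
    \int[mu]_z tr_kyy (y, z, x) mu - \int[mu]_z tr_hyy (y, z) mu.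
  rewrite -(intB mu (i3 _ rkyy') (i2 _ rhyy')); apply: eq_Rintegral => z _.
  exact: tr2B.
have -> : \int[mu]_z tr2 (fun i j => kxy q i j (y, z, x) mu - hxy q i j (y, z) mu) S0 =
    \int[mu]_z tr_kxy (y, z, x) mu - \int[mu]_z tr_hxy (y, z) mu.
  rewrite -(intB mu (i3 _ rkxy') (i2 _ rhxy')); apply: eq_Rintegral => z _.
  exact: tr2B.
have -> : \int[mu]_z tr2 (fun i j => kyz q i j (y, x, z) mu) S0 =
    \int[mu]_z kap (y, z, x) mu.
  by apply: eq_Rintegral => z _; exact: kap_sym.
have [_ swE _] := swap_kap y mu mu mu.
have rk2 : creg (fun (a : E * E) m => kap (y, a.1, a.2) m).
  by apply: (creg_comp _ rkap); slope.
have rl2 : creg (fun (a : E * E) m => lam (y, a.1, a.2, x) m).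
  by apply: (creg_comp _ rlam); slope.
have [ik _ _ _ _] := creg_swap mu mu mu (cregZ 2 rk2).
have [ik' _ _ _ _] := creg_swap mu mu mu rk2.
have [il _ _ _ _] := creg_swap mu mu mu rl2.
(* The summand with [2 * kyz], inherited from [l_rot], reproduces the normalising double integral of
   [lfd_kap2]. *)
have -> : \int[(p2prob mu \x p2prob mu)%E]_a tr2 (fun i j =>
      lyz q i j (y, a.1, a.2, x) mu - 2 * kyz q i j (y, a.1, a.2) mu) S0 =
    \int[(p2prob mu \x p2prob mu)%E]_a lam (y, a.1, a.2, x) mu
    - 2 * \int[mu]_w \int[mu]_z kap (y, w, z) mu.
  rewrite -swE -(RintegralZl 2 measurableT ik') -(RintegralB measurableT il ik).
  by apply: eq_Rintegral => a _; rewrite tr2B tr2Z.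
have -> : \sum_i hy q i (y, x) mu * f x mu i 0 = A (y, x) mu by [].
have -> : tr2 (fun i j => hyy q i j (y, x) mu) S = tr_hyy (y, x) mu by [].
have -> : \int[mu]_z (\sum_i hy q i (y, z) mu * df i (z, x) mu) =
  \int[mu]_z Bh (y, z, x) mu by [].
repeat match goal with |- context [Rintegral ?m ?D ?K] =>
  move: (Rintegral m D K) => ? end.
move: (\sum_i _) (\sum_i _) (tr2 _ _) (A _ _) (tr_hyy _ _) (tr_hxy _ _) (ht _ _) (dL _ _).
by move=> *; lra.
Qed.

(* on the diagonal the mixed derivatives of delta_mu V in its two space
   variables carry Sigma + Sigma0 instead of Sigma0 *)
Lemma diag_family_L y x mu Sigma : S = Sigma + S0 -> Sigma^T = Sigma ->
  family_L (diag_family q) f S S0 x y mu =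
  family_L (lin_family q) f S S0 y y mu + tr2 (fun i j => hxy q i j (y, y) mu) Sigma.
Proof.
move=> SE symS; rewrite /family_L /=.
have symS1 : S^T = S by rewrite SE linearD /= symS symS0.
have i3 (K : E * E * E -> P -> R) : creg K -> aint (fun z => K (y, z, y) mu).
  by move=> rK; apply: (creg_aint_comp _ _ rK); slope.
have i2 (K : E * E -> P -> R) : creg K -> aint (fun z => K (y, z) mu).
  by move=> rK; apply: (creg_aint_comp _ _ rK); slope.
have ik : aint (fun z => kap (y, y, z) mu) by apply: (creg_aint_comp _ _ rkap); slope.
have ix := aintB (i3 _ rkxy') (i2 _ rhxy').
have -> : \int[mu]_z tr2 (fun i j => kxy q i j (y, z, y) mu - hxy q i j (y, z) mu
      + kyz q i j (y, y, z) mu) S0 =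
    \int[mu]_z tr2 (fun i j => kxy q i j (y, z, y) mu - hxy q i j (y, z) mu) S0
    + \int[mu]_z tr2 (fun i j => kyz q i j (y, y, z) mu) S0.
  have -> : \int[mu]_z tr2 (fun i j => kxy q i j (y, z, y) mu - hxy q i j (y, z) mu) S0 =
      \int[mu]_z (tr_kxy (y, z, y) mu - tr_hxy (y, z) mu).
    by apply: eq_Rintegral => z _; exact: tr2B.
  have -> : \int[mu]_z tr2 (fun i j => kyz q i j (y, y, z) mu) S0 =
      \int[mu]_z kap (y, y, z) mu by [].
  by rewrite -(intD mu ix ik); apply: eq_Rintegral => z _; rewrite tr2D tr2B.
have sum0 : \sum_i 0 * f x mu i 0 = 0 by apply: big1 => i _; rewrite mul0r.
have tr0 S' : tr2 (fun _ _ : 'I_n => 0 : R) S' = 0.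
  by apply: big1 => i _; apply: big1 => j _; rewrite mul0r.
rewrite sum0 !tr0 int_cst !tr2D.
(* Of the four second derivatives along the diagonal, the two mixed ones have equal traces by
   symmetry of [S]. With the factor 1/2 they give one trace against [S], where the operator off the
   diagonal has [S0]. *)
rewrite (@tr2T R n (fun i j => hxy q i j (y, y) mu) S symS1).
rewrite (@tr2T R n (fun i j => hxy q i j (y, y) mu) S0 symS0).
rewrite [in X in _ = _ + X](_ : Sigma = S - S0); last by rewrite SE addrK.
have -> : tr2 (fun i j => hxy q i j (y, y) mu) (S - S0) =
    tr2 (fun i j => hxy q i j (y, y) mu) S - tr2 (fun i j => hxy q i j (y, y) mu) S0.
  have := tr2S (fun i j => hxy q i j (y, y) mu) (S - S0) S0.
  by rewrite subrK => ->; rewrite addrK.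
have -> : \sum_i (hx q i (y, y) mu + hy q i (y, y) mu) * f y mu i 0 =
   \sum_i hx q i (y, y) mu * f y mu i 0 + \sum_i hy q i (y, y) mu * f y mu i 0.
  by rewrite -big_split; apply: eq_bigr => i _; rewrite mulrDl.
repeat match goal with |- context [Rintegral ?m ?D ?K] =>
  move: (Rintegral m D K) => ? end.
repeat match goal with |- context [tr2 ?m ?D] =>
  move: (tr2 m D) => ? end.
by move=> *; lra.
Qed.
End linearised_equation.

Section jet_constructions.
Context {R : realType} {n : nat}.
Local Notation E := 'cV[R]_n.
Local Notation P := (P2 R n).
Implicit Types (mu m : P) (i j : 'I_n) (x y z w : E).

Definition jet_opp (q : jet) : jet (R := R) (n := n) := Jet
  (fun x mu => - jF q x mu) (fun i x mu => - jx q i x mu)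
  (fun i j x mu => - jxx q i j x mu) (fun x mu z => - jl q x mu z)
  (fun i x mu z => - jlz q i x mu z) (fun i j x mu z => - jlzz q i j x mu z)
  (fun i j x mu z => - jlxz q i j x mu z) (fun x mu z w => - jl2 q x mu z w)
  (fun i x mu z w => - jl2w q i x mu z w)
  (fun i j x mu z w => - jl2zw q i j x mu z w).

Lemma jet_ok_opp q : jet_ok q -> jet_ok (jet_opp q).
Proof.
by move=> [? ? ? ? ? ? ? ? ?]; split => * /=; try exact: is_deriveN; exact: is_lfdN.
Qed.

Definition measure_jet (K : P -> R) : jet (R := R) (n := n) := Jet
  (fun _ m => K m) (fun _ _ _ => 0) (fun _ _ _ _ => 0)
  (fun _ m => lfd K m)
  (fun i _ m z => 'D_(Defs.basis i) (lfd K m) z)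
  (fun i j _ m z => 'D_(Defs.basis i) ('D_(Defs.basis j) (lfd K m)) z)
  (fun _ _ _ _ _ => 0)
  (fun _ m => lfd2 K m)
  (fun j _ m z w => 'D_(Defs.basis j) (lfd2 K m z) w)
  (fun i j _ m z w =>
     'D_(Defs.basis i) (fun z => 'D_(Defs.basis j) (lfd2 K m z) w) z).

Lemma measure_jet_ok (K : P -> R) :
  (forall m, [/\ lfd_ex K m, lfd2_ex K m, hess_ex (lfd K m) & cross_ex (lfd2 K m)]) ->
  jet_ok (measure_jet K).
Proof.
move=> hK; have exD (X : normedModType R) (f : X -> R) (x v : X) : derivable f x v ->
    is_derive x v f ('D_v f x) by move=> ?; exact/derivableP.
split => /=.
- by move=> i x mu; exact: is_derive_cst.
- by move=> i j x mu; exact: is_derive_cst.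
- by move=> x m; have [? _ _ _] := hK m; exact: lfdP.
- by move=> i x m z; have [_ _ [h _] _] := hK m; exact/exD.
- by move=> i j x m z; have [_ _ [_ h] _] := hK m; exact: (exD _ _ _ _ (h j z i)).
- by move=> i j x mu z; exact: is_derive_cst.
- by move=> x m z; have [_ h _ _] := hK m; exact/lfdP/h.
- by move=> j x m z w; have [_ _ _ [h _]] := hK m; exact: (exD _ _ _ _ (h z w j)).
- by move=> i j x m z w; have [_ _ _ [_ h]] := hK m; exact: (exD _ _ _ _ (h j w z i)).
Qed.

Section operator.
Variables (f : E -> P -> E) (S S0 : 'M[R]_n).
Hypothesis rf : forall i, lreg (fun x m => f x m i 0).

Lemma jet_int_reg q :
  (forall i x, lreg (fun z m => jlz q i x m z)) ->
  (forall i j x, creg (fun z m => jlzz q i j x m z)) ->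
  (forall i j x, creg (fun z m => jlxz q i j x m z)) ->
  (forall i j x, creg (fun (a : E * E) m => jl2zw q i j x m a.1 a.2)) ->
  jet_int f S S0 q.
Proof.
move=> h1 h2 h3 h4; split=> x m.
- apply: aint_sum => i; have r := cregM (h1 i x) (rf i); exact: (creg_aint m r).
- by apply: aint_tr2 => i j; exact: (creg_aint m (h2 i j x)).
- by apply: aint_tr2 => i j; exact: (creg_aint m (h3 i j x)).
- have r := creg_tr2 S0 (fun i j => h4 i j x).
  by have [] := creg_swap m m m r.
Qed.

Lemma value_jet_int (q : base (R := R) (n := n)) : base_ok q ->
  jet_int f S S0 (value_jet q).
Proof.
move=> qok; apply: jet_int_reg => /= [i x|i j x|i j x|i j x].
- by apply: (lreg_comp _ (jlreg_lreg (rhy qok i))); slope.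
- by apply: (creg_comp _ (jreg_creg (rhyy qok i j))); slope.
- by apply: (creg_comp _ (jreg_creg (rhxy qok i j))); slope.
- by apply: (creg_comp _ (jreg_creg (rkyz qok i j))); slope.
Qed.

Lemma jet_int_opp q : jet_int f S S0 q -> jet_int f S S0 (jet_opp q).
Proof.
move=> [h1 h2 h3 h4]; split=> x mu /=.
- have := aintN (h1 x mu); under eq_fun do rewrite -sumrN.
  by under eq_fun do under eq_bigr do rewrite -mulNr.
- by under eq_fun do rewrite tr2N; exact: aintN.
- by under eq_fun do rewrite tr2N; exact: aintN.
- have := integrableN (h4 x mu).
  by apply: eq_integrable => // a _ /=; rewrite tr2N EFinN.
Qed.

(** Follows from additivity applied to [q] and its opposite, whose sum has vanishing derivatives. *)
Lemma jetL_opp q x mu : jet_int f S S0 q ->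
  jetL f S S0 (jet_opp q) x mu = - jetL f S S0 q x mu.
Proof.
move=> iq; have iN := jet_int_opp iq.
have := jetL_add x mu iq iN; have -> : jetL f S S0 (jet_add q (jet_opp q)) x mu = 0.
  rewrite /jetL /=.
  have tr0 (a : 'I_n -> 'I_n -> R) S' : tr2 (fun i j => a i j - a i j) S' = 0.
    by rewrite tr2B subrr.
  rewrite tr0 big1 ?mulr0 ?addr0 => [|i _]; last by rewrite subrr mul0r.
  have int0 d (X : measurableType d) (p : {measure set X -> \bar R}) (K : X -> R) :
      (forall a, K a = 0) -> \int[p]_a K a = 0.
    by move=> K0; under eq_Rintegral do rewrite K0; rewrite /Rintegral integral0.
  rewrite int0; last by move=> z; apply: big1 => i _; rewrite subrr mul0r.
  rewrite int0; last by move=> z; exact: tr0.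
  rewrite int0; last by move=> z; exact: tr0.
  rewrite int0; last by move=> z; exact: tr0.
  by ring.
by move/esym/eqP; rewrite addrC addr_eq0 => /eqP.
Qed.

End operator.
End jet_constructions.

(** * From the assumptions to fixed time *)

Section fixed_time.
Context {R : realType} {n : nat}.
Local Notation E := 'cV[R]_n.
Local Notation P := (P2 R n).
Implicit Types (mu m : P) (X : normedModType R) (x y z : E).

Lemma jcont_sec (X Y : topologicalType) T (F : R -> X -> P -> Y) t :
  0 <= t <= T -> jcont T F -> continuous (fun a : X * P => F t a.1 a.2).
Proof.
move=> t0T /subspace_continuousP cF [a m].
apply: (@cvg_comp _ _ _ (fun b : X * P => (t, b.1, b.2))
  (fun a : R * X * P => F a.1.1 a.1.2 a.2) _ _ _ _ (cF (t, a, m) t0T)) => U.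
rewrite /within /= => nU.
have cq : continuous (fun b : X * P => (t, b.1, b.2)).
  apply: cont_pair; last by move=> ?; exact: cvg_snd.
  by apply: cont_pair; [exact: cont_cst|move=> ?; exact: cvg_fst].
(* The time constraint does not involve [b], so the relative neighbourhood is a genuine one. *)
have h : nbhs (a, m) [set b : X * P | 0 <= t <= T -> U (t, b.1, b.2)] := cq (a, m) _ nU.
suff : nbhs (a, m) [set b : X * P | U (t, b.1, b.2)] by [].
by apply: filterS h => b; exact.
Qed.

Lemma jcont_entry X p r T (F : R -> X -> P -> 'M[R]_(p, r)) t i j :
  0 <= t <= T -> jcont T F -> jcontinuous (fun a m => F t a m i j).
Proof.
move=> t0T cF; apply: (@cont_comp _ _ _ (fun a : X * P => F t a.1 a.2)
  (fun A : 'M[R]_(p, r) => A i j)).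
  exact: jcont_sec cF.
exact: coord_continuous.
Qed.

Lemma fnorm_le_norm (x : E) : fnorm x <= (n%:R + 1) * `|x|.
Proof.
rewrite -ler_sqr ?nnegrE ?fnorm_ge0 ?mulr_ge0 ?addr_ge0//.
apply: (le_trans (fnorm2_le_norm x)); rewrite exprMn ler_wpM2r ?sqr_ge0//.
by have n0 : 0 <= n%:R :> R by []; rewrite sqrrD1; nra.
Qed.

(** [|C|] replaces [C], whose sign is unknown; [N] bounds the number of vectors and n + 1 compares
    the two norms. *)
Lemma lin_lg X (xs : X -> seq E) N (K : X -> P -> R) C :
  (forall a, {in xs a, forall x, `|x| <= `|a|}) -> (forall a, (size (xs a) <= N)%N) ->
  (forall a m, `|K a m| <= lin C (xs a) m) -> lg K.
Proof.
move=> xsa xsN KC; exists (`|C| * (1 + N%:R * (n%:R + 1))).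
  by rewrite mulr_ge0// addr_ge0// mulr_ge0// addr_ge0.
move=> a m; apply: (le_trans (KC a m)); rewrite /lin -mulrA.
have s0 : 0 <= \sum_(x <- xs a) fnorm x by apply: sumr_ge0 => x _; exact: fnorm_ge0.
have sN : \sum_(x <- xs a) fnorm x <= N%:R * (n%:R + 1) * `|a|.
  apply: (@le_trans _ _ (\sum_(x <- xs a) (n%:R + 1) * `|a|)).
    rewrite !big_seq; apply: ler_sum => x xa; apply: (le_trans (fnorm_le_norm x)).
    by rewrite ler_wpM2l ?addr_ge0//; exact: xsa.
  rewrite big_const_seq count_predT iter_addr_0 -[_ *+ size _]mulr_natl mulrA.
  by rewrite ler_wpM2r// ler_wpM2r ?addr_ge0// ler_nat.
have m0 := mean_ge0 m; have a0 := normr_ge0 a.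
have c0 : 0 <= N%:R * (n%:R + 1) :> R by rewrite mulr_ge0// addr_ge0.
have h : 0 <= 1 + \sum_(x <- xs a) fnorm x + mean m by rewrite !addr_ge0.
apply: (@le_trans _ _ (`|C| * (1 + \sum_(x <- xs a) fnorm x + mean m))).
  by rewrite ler_wpM2r// ler_norm.
rewrite ler_wpM2l//; move: sN c0; set c := N%:R * _; nra.
Qed.

Lemma quad_qg X (xs : X -> seq E) N (K : X -> P -> R) C :
  (forall a, {in xs a, forall x, `|x| <= `|a|}) -> (forall a, (size (xs a) <= N)%N) ->
  (forall a m, `|K a m| <= quad C (xs a) m) -> qg K.
Proof.
move=> xsa xsN KC; exists (`|C| * (1 + N%:R * n%:R)).
  by rewrite mulr_ge0// addr_ge0// mulr_ge0.
move=> a m; apply: (le_trans (KC a m)); rewrite /quad -mulrA.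
have s0 : 0 <= \sum_(x <- xs a) fnorm x ^+ 2 by apply: sumr_ge0 => x _; exact: sqr_ge0.
have sN : \sum_(x <- xs a) fnorm x ^+ 2 <= N%:R * n%:R * `|a| ^+ 2.
  apply: (@le_trans _ _ (\sum_(x <- xs a) n%:R * `|a| ^+ 2)).
    rewrite !big_seq; apply: ler_sum => x xa; apply: (le_trans (fnorm2_le_norm x)).
    by rewrite ler_wpM2l// ler_sqr ?nnegrE//; exact: xsa.
  rewrite big_const_seq count_predT iter_addr_0 -[_ *+ size _]mulr_natl mulrA.
  by rewrite ler_wpM2r ?sqr_ge0// ler_wpM2r// ler_nat.
have m0 := sqr_ge0 (mean m); have a0 := sqr_ge0 `|a|.
have c0 : 0 <= N%:R * n%:R :> R by rewrite mulr_ge0.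
have h : 0 <= 1 + \sum_(x <- xs a) fnorm x ^+ 2 + mean m ^+ 2 by rewrite !addr_ge0.
apply: (@le_trans _ _ (`|C| * (1 + \sum_(x <- xs a) fnorm x ^+ 2 + mean m ^+ 2))).
  by rewrite ler_wpM2r// ler_norm.
rewrite ler_wpM2l//; move: sN c0 a0 m0; set c := N%:R * _.
by set s := \sum_(_ <- _) _; set b := `|a| ^+ 2; set d := mean m ^+ 2; nra.
Qed.

Lemma le_bounded X (K : X -> P -> R) C : (forall a m, `|K a m| <= C) -> bounded_fun2 K.
Proof. by move=> KC; exists `|C| => // a m; exact: le_trans (ler_norm _). Qed.

(** This ties the list of vectors in a growth assumption to the tuple that serves as the single
    argument of a regularity class. *)
Definition args_le X (xs : X -> seq E) : Prop :=
  (forall a, {in xs a, forall x, `|x| <= `|a|}) /\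
  exists N, forall a, (size (xs a) <= N)%N.

Lemma args_le1 : args_le (fun x : E => [:: x]).
Proof. by split; [move=> x y; rewrite inE => /eqP ->|exists 1%N]. Qed.

Lemma args_le_snd X (xs : X -> seq E) : args_le xs ->
  args_le (fun a : X * E => rcons (xs a.1) a.2).
Proof.
move=> [xsa [N xsN]]; split=> [[a z] y|]; last first.
  by exists N.+1 => a; rewrite size_rcons; exact: xsN.
rewrite mem_rcons inE => /orP[/eqP ->|ya] /=.
 exact: norm_snd_le.
by apply: (le_trans (xsa a y ya)); exact: norm_fst_le.
Qed.

Lemma jlreg_lin X p r T (F : R -> X -> P -> 'M[R]_(p, r)) t i j xs C :
  0 <= t <= T -> jcont T F -> args_le xs ->
  (forall a m, fnorm (F t a m) <= lin C (xs a) m) -> jlreg (fun a m => F t a m i j).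
Proof.
move=> t0T cF [xsa [N xsN]] FC; split; first exact: (@jcont_entry X p r T F t i j t0T cF).
by apply: (lin_lg xsa xsN) => a m; exact: le_trans (fnorm_entry _ _ _) (FC a m).
Qed.

Lemma jreg_bounded X p r T (F : R -> X -> P -> 'M[R]_(p, r)) t i j C :
  0 <= t <= T -> jcont T F -> (forall a m, fnorm (F t a m) <= C) ->
  jreg (fun a m => F t a m i j) /\ bounded_fun2 (fun a m => F t a m i j).
Proof.
move=> t0T cF FC; suff b : bounded_fun2 (fun a m => F t a m i j).
  by split => //; split; [exact: (@jcont_entry X p r T F t i j t0T cF)|exact: bounded_qg].
by apply: (@le_bounded _ _ C) => a m; exact: le_trans (fnorm_entry _ _ _) (FC a m).
Qed.

Lemma jreg_quad X T (F : R -> X -> P -> R) t xs C :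
  0 <= t <= T -> jcont T F -> args_le xs ->
  (forall a m, `|F t a m| <= quad C (xs a) m) -> jreg (F t).
Proof.
move=> t0T cF [xsa [N xsN]] FC; split; first exact: (jcont_sec t0T cF).
exact: (quad_qg xsa xsN).
Qed.

End fixed_time.

Section value_at_time.
Context {R : realType} {n n1 : nat}.
Local Notation E := 'cV[R]_n.
Local Notation E1 := 'cV[R]_n1.
Local Notation P := (P2 R n).
Implicit Types (mu m : P) (i j : 'I_n) (x y z w : E).
Variables (T : R) (UU : set E1) (Sigma Sigma0 : 'M[R]_n).
Variables (f : E -> E1 -> P -> E) (L : E -> E1 -> P -> R) (g : E -> P -> R).
Variables (V : R -> E -> P -> R) (phi : R -> E -> P -> E1).
Hypothesis H1 : assumptionH1 T UU Sigma Sigma0 f L g V phi.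
Variable t : R.
Hypothesis t0T : 0 <= t <= T.

Let entry (X : normedModType R) p r (F : X -> P -> 'M[R]_(p, r))
  (i : 'I_p) (j : 'I_r) a m := F a m i j.

(** Derivatives are stored as entries of [grad], [hess] and [cross], so that the continuity and
    bounds assumed for these matrices pass to the entries directly. *)
Definition value_base : base (R := R) (n := n) := Base
  (V t)
  (fun i => entry (fun x m => grad (fun x' => V t x' m) x) 0 i)
  (entry (fun x m => hess (fun x' => V t x' m) x))
  (fun '((x, y) : E * E) m => lfd (V t x) m y)
  (fun i => entry (fun '((x, y) : E * E) m => grad (fun x' => lfd (V t x') m y) x) 0 i)
  (fun i => entry (fun '((x, y) : E * E) m => grad (fun y' => lfd (V t x) m y') y) 0 i)
  (entry (fun '((x, y) : E * E) m => hess (fun x' => lfd (V t x') m y) x))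
  (entry (fun '((x, y) : E * E) m => hess (fun y' => lfd (V t x) m y') y))
  (entry (fun '((x, y) : E * E) m => cross (fun x' y' => lfd (V t x') m y') x y))
  (fun '((x, y, z) : E * E * E) m => lfd2 (V t x) m y z)
  (fun i => entry (fun '((x, y, z) : E * E * E) m =>
     grad (fun x' => lfd2 (V t x') m y z) x) 0 i)
  (fun i => entry (fun '((x, y, z) : E * E * E) m =>
     grad (fun y' => lfd2 (V t x) m y' z) y) 0 i)
  (fun i => entry (fun '((x, y, z) : E * E * E) m =>
     grad (fun z' => lfd2 (V t x) m y z') z) 0 i)
  (entry (fun '((x, y, z) : E * E * E) m => hess (fun y' => lfd2 (V t x) m y' z) y))
  (entry (fun '((x, y, z) : E * E * E) m =>
     cross (fun x' y' => lfd2 (V t x') m y' z) x y))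
  (entry (fun '((x, y, z) : E * E * E) m =>
     cross (fun y' z' => lfd2 (V t x) m y' z') y z))
  (fun '((x, y, z, w) : E * E * E * E) m => lfd3 (V t x) m y z w)
  (fun i => entry (fun '((x, y, z, w) : E * E * E * E) m =>
     grad (fun y' => lfd3 (V t x) m y' z w) y) 0 i)
  (fun i => entry (fun '((x, y, z, w) : E * E * E * E) m =>
     grad (fun z' => lfd3 (V t x) m y z' w) z) 0 i)
  (entry (fun '((x, y, z, w) : E * E * E * E) m =>
     cross (fun y' z' => lfd3 (V t x) m y' z' w) y z)).

Let exD (X : normedModType R) (F : X -> R) (a u : X) : derivable F a u ->
  is_derive a u F ('D_u F a).
Proof. by move=> ?; exact/derivableP. Qed.

Let Dgrad (F : E -> R) a i : derivable F a (Defs.basis i) ->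
  is_derive a (Defs.basis i) F (grad F a 0 i).
Proof. by rewrite mxE; exact: exD. Qed.

Let Dhess (F : E -> R) a i j : derivable ('D_(Defs.basis j) F) a (Defs.basis i) ->
  is_derive a (Defs.basis i) (fun a => grad F a 0 j) (hess F a i j).
Proof.
rewrite mxE; have -> : (fun a => grad F a 0 j) = 'D_(Defs.basis j) F.
  by apply/funext => a'; rewrite mxE.
exact: exD.
Qed.

Let Dcross (F : E -> E -> R) a c i j :
  derivable (fun a => 'D_(Defs.basis j) (F a) c) a (Defs.basis i) ->
  is_derive a (Defs.basis i) (fun a => grad (F a) c 0 j) (cross F a c i j).
Proof.
rewrite mxE; have -> : (fun a => grad (F a) c 0 j) = (fun a => 'D_(Defs.basis j) (F a) c).
  by apply/funext => a'; rewrite mxE.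
exact: exD.
Qed.

Let args2 : args_le (fun a : E * E => [:: a.1; a.2]).
Proof. exact: (args_le_snd args_le1). Qed.
Let args3 : args_le (fun a : E * E * E => [:: a.1.1; a.1.2; a.2]).
Proof. exact: (args_le_snd args2). Qed.
Let args4 : args_le (fun a : E * E * E * E => [:: a.1.1.1; a.1.1.2; a.1.2; a.2]).
Proof. exact: (args_le_snd args3). Qed.

Lemma value_base_ok : base_ok value_base.
Proof.
have [Cq hq] := H1_quad H1; have [Cl hl] := H1_lin H1.
have [C1 h1] := H1_bounded1 H1; have [C2 h2] := H1_bounded2 H1.
have bkyz i j : jreg (kyz value_base i j) /\ bounded_fun2 (kyz value_base i j).
  apply: (@jreg_bounded _ _ _ _ _ _ _ _ i j C2 t0T (H1_dyzd2V_cont H1)).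
  by move=> [[x y] z] m; have [hb _ _ _] := h2 t x y z 0 m t0T; exact: hb.
have blyz i j : jreg (lyz value_base i j) /\ bounded_fun2 (lyz value_base i j).
  apply: (@jreg_bounded _ _ _ _ _ _ _ _ i j C2 t0T (H1_dyzd3V_cont H1)).
  by move=> [[[x y] z] w] m; have [_ _ _ hb] := h2 t x y z w m t0T; exact: hb.
split.
- apply: (@jreg_quad _ _ _ _ V t _ Cq t0T (H1_V_cont H1) args_le1) => x m.
  by have [] := hq t x 0 0 0 m t0T.
- move=> i; apply: (@jlreg_lin _ _ _ _ _ _ _ t 0 i _ Cl t0T (H1_Vx_cont H1) args_le1) => x m.
  by have [] := hl t x 0 0 0 m t0T.
- move=> i j; have [|] := @jreg_bounded _ _ _ _ _ _ _ t i j C1 t0T (H1_Vxx_cont H1).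
    by move=> x m; have [hb _ _ _] := h1 t x 0 m t0T; exact: hb.
  by [].
- apply: (@jreg_quad _ _ _ _ _ t _ Cq t0T (H1_dV_cont H1) args2) => -[x y] m.
  by have [] := hq t x y 0 0 m t0T.
- move=> i; apply: (@jlreg_lin _ _ _ _ _ _ _ t 0 i _ Cl t0T (H1_dxdV_cont H1) args2).
  by move=> [x y] m; have [] := hl t x y 0 0 m t0T.
- move=> i; apply: (@jlreg_lin _ _ _ _ _ _ _ t 0 i _ Cl t0T (H1_dydV_cont H1) args2).
  by move=> [x y] m; have [] := hl t x y 0 0 m t0T.
- move=> i j; have [|] := @jreg_bounded _ _ _ _ _ _ _ t i j C1 t0T (H1_dxxdV_cont H1).
    by move=> [x y] m; have [_ _ _ hb] := h1 t x y m t0T; exact: hb.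
  by [].
- move=> i j; have [|] := @jreg_bounded _ _ _ _ _ _ _ t i j C1 t0T (H1_dyydV_cont H1).
    by move=> [x y] m; have [_ hb _ _] := h1 t x y m t0T; exact: hb.
  by [].
- move=> i j; have [|] := @jreg_bounded _ _ _ _ _ _ _ t i j C1 t0T (H1_dxydV_cont H1).
    by move=> [x y] m; have [_ _ hb _] := h1 t x y m t0T; exact: hb.
  by [].
- apply: (@jreg_quad _ _ _ _ _ t _ Cq t0T (H1_d2V_cont H1) args3) => -[[x y] z] m.
  by have [] := hq t x y z 0 m t0T.
- move=> i; apply: (@jlreg_lin _ _ _ _ _ _ _ t 0 i _ Cl t0T (H1_dyd2V_cont H1) args3).
  by move=> [[x y] z] m; have [] := hl t x y z 0 m t0T.
- move=> i j; have [|] := @jreg_bounded _ _ _ _ _ _ _ t i j C2 t0T (H1_dyyd2V_cont H1).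
    by move=> [[x y] z] m; have [_ hb _ _] := h2 t x y z 0 m t0T; exact: hb.
  by [].
- move=> i j; have [|] := @jreg_bounded _ _ _ _ _ _ _ t i j C2 t0T (H1_dxyd2V_cont H1).
    by move=> [[x y] z] m; have [_ _ hb _] := h2 t x y z 0 m t0T; exact: hb.
  by [].
- by move=> i j; have [] := bkyz i j.
- by move=> i j; have [] := bkyz i j.
- apply: (@jreg_quad _ _ _ _ _ t _ Cq t0T (H1_d3V_cont H1) args4) => -[[[x y] z] w] m.
  by have [] := hq t x y z w m t0T.
- move=> i; apply: (@jlreg_lin _ _ _ _ _ _ _ t 0 i _ Cl t0T (H1_dyd3V_cont H1) args4).
  by move=> [[[x y] z] w] m; have [] := hl t x y z w m t0T.
- by move=> i j; have [] := blyz i j.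
- by move=> i j; have [] := blyz i j.
- by move=> x m; have [h _ _ _ _] := H1_dV_ex H1 m t0T; exact: (lfdP (h x)).
- by move=> x y m; have [h _ _ _ _] := H1_d2V_ex H1 m t0T; exact: (lfdP (h x y)).
- by move=> x y z m; have [h _ _] := H1_d3V_ex H1 m t0T; exact: (lfdP (h x y z)).
- by move=> i x m; have [_ [h _]] := H1_V_ex H1 m t0T; exact: Dgrad (h x i).
- by move=> i j x m; have [_ [_ h]] := H1_V_ex H1 m t0T; exact: Dhess (h j x i).
- by move=> i x y m; have [_ _ h _ _] := H1_dV_ex H1 m t0T; exact: Dgrad ((h y).1 x i).
- by move=> i x y m; have [_ _ _ h _] := H1_dV_ex H1 m t0T; exact: Dgrad ((h x).1 y i).
- by move=> i j x y m; have [_ _ h _ _] := H1_dV_ex H1 m t0T; exact: Dhess ((h y).2 j x i).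
- by move=> i j x y m; have [_ _ _ h _] := H1_dV_ex H1 m t0T; exact: Dhess ((h x).2 j y i).
- move=> i j x y m; have [_ _ _ _ [_ h]] := H1_dV_ex H1 m t0T.
  exact: (@Dcross (fun x y => lfd (V t x) m y) _ _ _ _ (h j y x i)).
- by move=> i x y z m; have [_ h _ _ _] := H1_d2V_ex H1 m t0T; exact: Dgrad (h y z x i).
- by move=> i x y z m; have [_ _ h _ _] := H1_d2V_ex H1 m t0T; exact: Dgrad ((h x z).1 y i).
- by move=> i x y z m; have [_ _ _ _ h] := H1_d2V_ex H1 m t0T; exact: Dgrad ((h x).1 y z i).
- by move=> i j x y z m; have [_ _ h _ _] := H1_d2V_ex H1 m t0T;
    exact: Dhess ((h x z).2 j y i).
- move=> i j x y z m; have [_ _ _ h _] := H1_d2V_ex H1 m t0T.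
  exact: (@Dcross (fun x y => lfd2 (V t x) m y z) _ _ _ _ ((h z).2 j y x i)).
- move=> i j x y z m; have [_ _ _ _ h] := H1_d2V_ex H1 m t0T.
  exact: (@Dcross (fun y z => lfd2 (V t x) m y z) _ _ _ _ ((h x).2 j z y i)).
- by move=> i x y z w m; have [_ h _] := H1_d3V_ex H1 m t0T; exact: Dgrad (h x z w y i).
- move=> i x y z w m; have [_ _ h] := H1_d3V_ex H1 m t0T.
  exact: Dgrad ((h x w).1 y z i).
- move=> i j x y z w m; have [_ _ h] := H1_d3V_ex H1 m t0T.
  exact: (@Dcross (fun y z => lfd3 (V t x) m y z w) _ _ _ _ ((h x w).2 j z y i)).
Qed.
End value_at_time.

(** * The closed-loop coefficients and the time derivative *)

Section closed_loop.
Context {R : realType} {n n1 : nat}.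
Local Notation E := 'cV[R]_n.
Local Notation E1 := 'cV[R]_n1.
Local Notation P := (P2 R n).
Implicit Types (mu m : P) (i j : 'I_n) (x y z w : E).
Variables (T : R) (UU : set E1) (Sigma Sigma0 : 'M[R]_n).
Variables (f : E -> E1 -> P -> E) (L : E -> E1 -> P -> R) (g : E -> P -> R).
Variables (V : R -> E -> P -> R) (phi : R -> E -> P -> E1).
Hypotheses (T0 : 0 < T) (A1 : assumptionA1 UU f).
Hypothesis H1 : assumptionH1 T UU Sigma Sigma0 f L g V phi.
Hypothesis H2 : assumptionH2 T f L g phi.

Local Notation fs := (fstar f phi).
Local Notation Ls := (Lstar L phi).

Let args2 : args_le (fun a : E * E => [:: a.1; a.2]).
Proof. exact: (args_le_snd args_le1). Qed.

(** The feedback takes values in [UU], so continuity of [f] relative to admissible controls is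
    enough; the two linear growth bounds compose to a linear one. *)
Lemma fstar_lreg t i : 0 <= t <= T -> lreg (fun x m => fs t x m i 0).
Proof.
move=> t0T; split=> [m|].
  apply: (@cont_comp _ _ _ (fun x => fs t x m) (fun A : E => A i 0)); last first.
    exact: coord_continuous.
  move=> x; have /subspace_continuousP cf := A1_cont A1.
  have cphi : continuous (fun x => phi t x m).
    have cj := jcont_sec t0T (H1_phi_cont H1).
    apply: (@cont_comp _ _ _ (fun x => (x, m)) _ _ cj).
    by apply: cont_pair; [exact: cont_id|exact: cont_cst].
  apply: (@cvg_comp _ _ _ (fun x => (x, phi t x m, m))
    (fun a : E * E1 * P => f a.1.1 a.1.2 a.2) _ _ _ _
    (cf (x, phi t x m, m) (H1_phi_in H1 x m t0T))) => W.
  rewrite /within /= => nW.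
  have cq : continuous (fun x => (x, phi t x m, m)).
    apply: cont_pair; last exact: cont_cst.
    by apply: cont_pair => //; exact: cont_id.
  have hW : nbhs x [set x | UU (phi t x m) -> W (x, phi t x m, m)] := cq x _ nW.
  suff : nbhs x [set x | W (x, phi t x m, m)] by [].
  by apply: filterS hW => x'; apply; exact: (H1_phi_in H1 _ _ t0T).
have [C fC] := A1_growth A1; have [D pD] := H1_phi_growth H1.
exists (`|C| * (1 + (n%:R + 1) + `|D| * (1 + (n%:R + 1) + 1))).
  by rewrite !(mulr_ge0, addr_ge0).
move=> x m; apply: (le_trans (fnorm_entry _ _ _)).
apply: (le_trans (fC _ _ _ (H1_phi_in H1 x m t0T))).
have := pD t x m t0T; rewrite /lin big_seq1 => hp.
have hx := fnorm_le_norm x; have m0 := mean_ge0 m; have x0 := fnorm_ge0 x.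
have p0 := fnorm_ge0 (phi t x m).
have nx0 := normr_ge0 x; have n0 : 0 <= n%:R :> R by [].
have D0 := normr_ge0 D.
have hp' : fnorm (phi t x m) <= `|D| * (1 + (n%:R + 1) + 1) * (1 + `|x| + mean m).
  apply: (le_trans hp); apply: (@le_trans _ _ (`|D| * (1 + fnorm x + mean m))).
    by rewrite ler_wpM2r ?addr_ge0// ler_norm.
  by rewrite -mulrA ler_wpM2l//; nra.
apply: (@le_trans _ _ (`|C| * (1 + fnorm x + fnorm (phi t x m) + mean m))).
  by rewrite ler_wpM2r ?addr_ge0// ler_norm.
rewrite -mulrA ler_wpM2l//; move: hp'; set d := `|D| * _; nra.
Qed.

Definition drift_lfd t i (a : E * E) m : R :=
  (fun '((x, y) : E * E) m => vlfd (fs t x) m y) a m i 0.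

Lemma drift_lfd_lreg t i : 0 <= t <= T -> lreg (drift_lfd t i).
Proof.
move=> t0T; have [C hC] := H2_f_lin H2; apply: jlreg_lreg.
apply: (@jlreg_lin _ _ _ _ _ _ _ t i 0 _ C t0T (H2_df_cont H2) args2).
by move=> [x y] m; have [] := hC t x y 0 m t0T.
Qed.

Lemma is_lfd_drift t i x m : 0 <= t <= T ->
  is_lfd (fun m => fs t x m i 0) m (fun y => drift_lfd t i (x, y) m).
Proof.
move=> t0T; have [h _] := H2_f_ex H2 x m t0T.
have -> : (fun y => drift_lfd t i (x, y) m) = lfd (fun m => fs t x m i 0) m.
  by apply/funext => y; rewrite /drift_lfd mxE.
exact/lfdP/h.
Qed.

Definition cost_lfd t : E * E -> P -> R := fun '((x, y) : E * E) m => lfd (Ls t x) m y.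

Lemma cost_lfd_creg t : 0 <= t <= T -> creg (cost_lfd t).
Proof.
move=> t0T; have [C hC] := H2_L_quad H2; apply: jreg_creg.
apply: (@jreg_quad _ _ _ _ _ t _ C t0T (H2_dL_cont H2) args2) => -[x y] m.
by have [] := hC t x y 0 m t0T.
Qed.

Lemma is_lfd_cost t x m : 0 <= t <= T ->
  is_lfd (Ls t x) m (fun y => cost_lfd t (x, y) m).
Proof. by move=> t0T; have [h _] := H2_L_ex H2 x m t0T; exact/lfdP. Qed.

Let value_dt t x m := dt T (fun s => V s x m) t.
Definition value_lfd_dt t : E * E -> P -> R :=
  fun '((x, y) : E * E) m => dt T (fun s => lfd (V s x) m y) t.

Lemma value_lfd_dt_creg t : 0 <= t <= T -> creg (value_lfd_dt t).
Proof.
move=> t0T; have [C hC] := H1_quad H1; apply: jreg_creg.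
apply: (@jreg_quad _ _ _ _ _ t _ C t0T (H1_dtdV_cont H1) args2) => -[x y] m.
by have [] := hC t x y 0 0 m t0T.
Qed.

Let hasD_dt (h : R -> R) t : dt_ex T h t -> hasD `[0, T] h t (dt T h t).
Proof. by []. Qed.

Let in0T t : (`[0, T]%classic : set R) t = (0 <= t <= T).
Proof. by rewrite /= in_itv. Qed.

Lemma value_hasD t x m : 0 <= t <= T ->
  hasD `[0, T] (fun s => V s x m) t (value_dt t x m).
Proof. by move=> t0T; have [h _] := H1_V_ex H1 m t0T; exact/hasD_dt/h. Qed.

Lemma value_lfd_hasD t x y m : 0 <= t <= T ->
  hasD `[0, T] (fun s => lfd (V s x) m y) t (value_lfd_dt t (x, y) m).
Proof. by move=> t0T; have [_ h _ _ _] := H1_dV_ex H1 m t0T; exact/hasD_dt/h. Qed.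

(** Unlike in [value_lfd_dt_creg], the constant is uniform in time: it has to dominate difference
    quotients over all of [0, T]. *)
Lemma value_lfd_dt_bound : exists2 C, 0 <= C & forall t a m, 0 <= t <= T ->
  `|value_lfd_dt t a m| <= C * (1 + `|a| ^+ 2 + mean m ^+ 2).
Proof.
have [C hC] := H1_quad H1.
exists (`|C| * (1 + 2 * n%:R)); first by rewrite mulr_ge0// addr_ge0// mulr_ge0.
move=> t [x y] m t0T; have [_ _ _ h _] := hC t x y 0 0 m t0T.
apply: (le_trans h); rewrite /quad big_cons big_seq1.
have hx := fnorm2_le_norm x; have hy := fnorm2_le_norm y.
have xa : `|x| ^+ 2 <= `|(x, y)| ^+ 2 by rewrite ler_sqr ?nnegrE//; exact: norm_fst_le.
have ya : `|y| ^+ 2 <= `|(x, y)| ^+ 2 by rewrite ler_sqr ?nnegrE//; exact: norm_snd_le.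
have m0 := sqr_ge0 (mean m); have x0 := sqr_ge0 (fnorm x); have y0 := sqr_ge0 (fnorm y).
have n0 : 0 <= n%:R :> R by [].
apply: (@le_trans _ _ (`|C| * (1 + (fnorm x ^+ 2 + fnorm y ^+ 2) + mean m ^+ 2))).
  by rewrite ler_wpM2r ?addr_ge0// ler_norm.
rewrite -mulrA ler_wpM2l//.
have n1' := ler_wpM2l n0 xa; have n2' := ler_wpM2l n0 ya.
have nm : 0 <= n%:R * mean m ^+ 2 by rewrite mulr_ge0.
by nra.
Qed.

(** [is_lfd_deriv] with time as the parameter; it relies on the continuity of the time derivative of
    delta_mu V jointly in time and measure. *)
Lemma is_lfd_value_dt t x m : 0 <= t <= T ->
  is_lfd (value_dt t x) m (fun y => value_lfd_dt t (x, y) m).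
Proof.
move=> t0T; have [C C0 hC] := value_lfd_dt_bound.
apply: (@is_lfd_deriv R n `[0, T] t (fun s m => V s x m) (value_dt t x)
  (fun s m => lfd (V s x) m) (fun s m y => value_lfd_dt s (x, y) m)).
- exact: convex_itv.
- by rewrite in0T.
- exact: limit_pt_itv.
- by move=> m'; exact: value_hasD.
- by move=> s m'; rewrite in0T => s0T; have [h _ _ _ _] := H1_dV_ex H1 m' s0T; exact/lfdP.
- by move=> s m' z; rewrite in0T => s0T; exact: value_lfd_hasD.
- move=> s m'; rewrite in0T => s0T; apply: continuous_borel.
  have h : creg (fun (y : E) m => value_lfd_dt s (x, y) m).
    by apply: (creg_comp _ (value_lfd_dt_creg s0T)); slope.
  exact: h.1.
- exists (C * (1 + `|x| ^+ 2)); first by rewrite mulr_ge0// addr_ge0// sqr_ge0.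
  move=> s m' z; rewrite in0T => s0T; apply: (le_trans (hC s (x, z) m' s0T)).
  rewrite -mulrA ler_wpM2l//; have := norm_pair_le x z.
  have := sqr_ge0 `|x|; have := sqr_ge0 `|z|; have := sqr_ge0 (mean m').
  by set a := `|(x, z)| ^+ 2; set b := `|x| ^+ 2; set c := `|z| ^+ 2; nra.
- move=> nu z u e Iu Ie u0 e0.
  have /subspace_continuousP cd := H1_dtdV_cont H1.
  apply: (@cvg_comp _ _ _ (fun k => (u k, (x, z), mix (e k) m nu))
    (fun a : R * (E * E) * P => value_lfd_dt a.1.1 a.1.2 a.2) _ _ _ _
    (cd (t, (x, z), m) t0T)) => W.
  rewrite /within /= => nW.
  have cx : (fun _ : nat => (x, z)) k @[k --> \oo] --> (x, z) by exact: cvg_cst.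
  have c2 := @mix_seq_cvg R n e m nu Ie e0.
  have hW := seq_cvg_pair (seq_cvg_pair u0 cx) c2 nW.
  suff : \forall k \near \oo, W (u k, (x, z), mix (e k) m nu) by [].
  have hW' : \forall k \near \oo, 0 <= u k <= T -> W (u k, (x, z), mix (e k) m nu) := hW.
  by apply: filterS hW' => k; apply; rewrite -in0T; exact: Iu.
Qed.

End closed_loop.

(** * The master equation *)

Section corrector.
Context {R : realType} {n : nat}.
Local Notation E := 'cV[R]_n.
Local Notation P := (P2 R n).
Implicit Types (mu m : P) (i j : 'I_n) (x y z w : E).
Variable q : base (R := R) (n := n).
Hypothesis qok : base_ok q.
Variables (Sigma Sigma0 : 'M[R]_n).
Hypotheses (symS : Sigma^T = Sigma) (symS0 : Sigma0^T = Sigma0).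
Let S := Sigma + Sigma0.
Variables (f : E -> P -> E) (df : 'I_n -> E * E -> P -> R).
Variables (vt Ls : E -> P -> R) (ht dL : E * E -> P -> R).
Hypothesis rf : forall i, lreg (fun x m => f x m i 0).
Hypothesis rdf : forall i, lreg (df i).
Hypothesis ldf : forall i x m,
  is_lfd (fun m => f x m i 0) m (fun u => df i (x, u) m).
Hypothesis lvt : forall x m, is_lfd (vt x) m (fun u => ht (x, u) m).
Hypothesis lLs : forall x m, is_lfd (Ls x) m (fun u => dL (x, u) m).
Hypothesis value_eq : forall x m,
  vt x m + jetL f S Sigma0 (value_jet q) x m + Ls x m = 0.
Hypotheses (rht : creg ht) (rdL : creg dL).

Local Notation bar := (avg_jet (value_family q)).

(** [A] and [B] pair the two parts of the gradient of delta_mu Ubar with the derivative of the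
    drift. [H] is the excess on the diagonal, and [K] the trace against Sigma that enters the
    equation of M. *)
Let A (a : E * E) m := \sum_i vx q i a.1 m * df i a m.
Let B (a : E * E * E) m := \sum_i hy q i a.1 m * df i (a.1.2, a.2) m.
Let H (a : E) m := tr2 (fun i j => hxy q i j (a, a) m) Sigma.
Let K (a : E * E) m := tr2 (fun i j => kyz q i j (a.1, a.2, a.2) m) Sigma.

Let rA : creg A.
Proof.
apply: creg_sum => i; apply: cregM; last exact: rdf.
by apply: (lreg_comp _ (jlreg_lreg (rvx qok i))); slope.
Qed.

Let rB : creg B.
Proof.
apply: creg_sum => i; apply: cregM.
  by apply: (lreg_comp _ (jlreg_lreg (rhy qok i))); slope.
by apply: (lreg_comp _ (rdf i)); slope.
Qed.

Let rH : creg H.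
Proof.
apply: creg_tr2 => i j; apply: (creg_comp _ (jreg_creg (rhxy qok i j))); slope.
Qed.

Let rK : creg K.
Proof.
apply: creg_tr2 => i j; apply: (creg_comp _ (jreg_creg (rkyz qok i j))); slope.
Qed.

Let barz m x y u : \sum_i jlz bar i x m y * df i (y, u) m =
  A (y, u) m + \int[m]_w B (w, y, u) m.
Proof.
have ih i : aint (fun w => hy q i (w, y) m * df i (y, u) m).
  apply: aintZr; apply: (creg_aint_comp _ _ (lreg_creg (jlreg_lreg (rhy qok i)))); slope.
rewrite /A /B int_sum// -big_split; apply: eq_bigr => i _ /=; rewrite mulrDl.
congr (_ + _); rewrite intZr//.
by apply: (creg_aint_comp _ _ (lreg_creg (jlreg_lreg (rhy qok i)))); slope.
Qed.

(** At coinciding points the mixed derivative for Ubar contains [hxy] and its transpose, which have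
    the same trace against the symmetric Sigma. *)
Let barzz m x y : tr2 (fun i j => jl2zw bar i j x m y y) Sigma =
  2 * H y m + \int[m]_w K (w, y) m.
Proof.
have ik i j : aint (fun w => kyz q i j (w, y, y) m).
  by apply: (creg_aint_comp _ _ (jreg_creg (rkyz qok i j))); slope.
rewrite /= !tr2D (@tr2T R n (fun i j => hxy q i j (y, y) m))// addrA /K int_tr2//.
by rewrite -/(H y m) mulr_natl mulr2n.
Qed.

Let rBd : creg (fun (a : E * E) m => B (a.1, a.2, a.1) m).
Proof. by apply: (creg_comp _ rB); slope. Qed.
Let rBs : creg (fun (a : E * E) m => B (a.1, a.2, a.2) m).
Proof. by apply: (creg_comp _ rB); slope. Qed.
Let rBx x : creg (fun (a : E * E) m => B (a.1, a.2, x) m).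
Proof. by apply: (creg_comp _ rB); slope. Qed.

Let int_barz m x :
  aint (fun y => A (y, x) m + \int[m]_w B (w, y, x) m) /\
  \int[m]_y (A (y, x) m + \int[m]_w B (w, y, x) m) =
  \int[m]_y A (y, x) m + \int[m]_y \int[m]_z B (y, z, x) m.
Proof.
have iA : aint (fun y => A (y, x) m) by apply: (creg_aint_comp _ _ rA); slope.
have [_ _ i2 _ e] := creg_swap m m m (rBx x).
by split; [exact: aintD|rewrite (intD m iA i2) e].
Qed.

Let int_barz_diag m :
  aint (fun y => A (y, y) m + \int[m]_w B (w, y, y) m) /\
  \int[m]_y (A (y, y) m + \int[m]_w B (w, y, y) m) =
  \int[m]_y A (y, y) m + \int[m]_y \int[m]_z B (y, z, z) m.
Proof.
have iA : aint (fun y => A (y, y) m) by apply: (creg_aint_comp _ _ rA); slope.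
have [_ _ i2 _ e] := creg_swap m m m rBs.
by split; [exact: aintD|rewrite (intD m iA i2) e].
Qed.

Let barzB m x y u u' : \sum_i jlz bar i x m y * (df i (y, u) m - df i (y, u') m) =
  (A (y, u) m + \int[m]_w B (w, y, u) m) - (A (y, u') m + \int[m]_w B (w, y, u') m).
Proof.
by rewrite -!(barz m x) -sumrB; apply: eq_bigr => i _; rewrite mulrBr.
Qed.

Lemma master_terms_integrable x mu :
  [/\ aint (fun y => dL (y, x) mu - dL (y, y) mu),
      aint (fun y => \sum_i jlz bar i x mu y * (df i (y, x) mu - df i (y, y) mu))
    & aint (fun y => tr2 (fun i j => jl2zw bar i j x mu y y) Sigma)].
Proof.
split.
- by apply: aintB; apply: (creg_aint_comp _ _ rdL); slope.
- under eq_fun do rewrite barzB.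
  by apply: aintB; [have [] := int_barz mu x|have [] := int_barz_diag mu].
- under eq_fun do rewrite barzz; apply: aintD.
    by apply: aintZ; apply: (creg_aint_comp _ _ rH); slope.
  by have [] := creg_swap mu mu mu rK.
Qed.

(* the linearised equation at x minus its trace on the diagonal, averaged *)
Lemma averaged_corrector x mu :
  \int[mu]_y ht (y, x) mu - \int[mu]_y ht (y, y) mu
  + jetL f S Sigma0 (avg_jet (lin_family q)) x mu
  - jetL f S Sigma0 (avg_jet (diag_family q)) x mu
  + \int[mu]_y (dL (y, x) mu - dL (y, y) mu)
  + \int[mu]_y (\sum_i jlz bar i x mu y * (df i (y, x) mu - df i (y, y) mu))
  + 2^-1 * \int[mu]_y tr2 (fun i j => jl2zw bar i j x mu y y) Sigma
  = \int[(p2prob mu \x p2prob mu)%E]_a (\sum_i hy q i (a.2, a.1) mu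
        * (df i (a.1, a.2) mu - df i (a.1, a.1) mu))
    + 2^-1 * \int[(p2prob mu \x p2prob mu)%E]_a
        tr2 (fun i j => kyz q i j (a.2, a.1, a.1) mu) Sigma.
Proof.
have [ilin ->] := avg_jetL (lin_family_ok qok) S rf symS0 x mu.
have [idiag ->] := avg_jetL (diag_family_ok qok) S rf symS0 x mu.
have lin_eq := linearised_value_eq qok symS0 rf rdf ldf lvt lLs value_eq.
have diag_eq x' y' := diag_family_L qok symS0 f y' x' mu (erefl S) symS.
have iAx : aint (fun y => A (y, x) mu) by apply: (creg_aint_comp _ _ rA); slope.
have iAd : aint (fun y => A (y, y) mu) by apply: (creg_aint_comp _ _ rA); slope.
have iLx : aint (fun y => dL (y, x) mu) by apply: (creg_aint_comp _ _ rdL); slope.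
have iLd : aint (fun y => dL (y, y) mu) by apply: (creg_aint_comp _ _ rdL); slope.
have ihx : aint (fun y => ht (y, x) mu) by apply: (creg_aint_comp _ _ rht); slope.
have ihd : aint (fun y => ht (y, y) mu) by apply: (creg_aint_comp _ _ rht); slope.
have iH : aint (fun y => H y mu) by apply: (creg_aint_comp _ _ rH); slope.
have [_ iBx _ _ _] := creg_swap mu mu mu (rBx x).
have [_ iBd _ _ _] := creg_swap mu mu mu rBd.
(* The linearised equation at (y; x), solved for the operator and integrated in y. *)
have -> : \int[mu]_y family_L (lin_family q) f S Sigma0 x y mu =
    - (\int[mu]_y ht (y, x) mu + \int[mu]_y A (y, x) mu
       + \int[mu]_y \int[mu]_z B (y, z, x) mu + \int[mu]_y dL (y, x) mu).
  have i1 := aintD ihx iAx; have i2 := aintD i1 iBx; have i3 := aintD i2 iLx.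
  rewrite -(intD mu ihx iAx) -(intD mu i1 iBx) -(intD mu i2 iLx) -(intN mu i3).
  apply: eq_Rintegral => y _.
  by have := lin_eq x y mu; rewrite -/(A (y, x) mu) -/(B (y, _, x) mu); lra.
(* The same at (y; y), where [diag_family_L] contributes the excess [H]. *)
have -> : \int[mu]_y family_L (diag_family q) f S Sigma0 x y mu =
    \int[mu]_y H y mu - (\int[mu]_y ht (y, y) mu + \int[mu]_y A (y, y) mu
       + \int[mu]_y \int[mu]_z B (y, z, y) mu + \int[mu]_y dL (y, y) mu).
  have i1 := aintD ihd iAd; have i2 := aintD i1 iBd; have i3 := aintD i2 iLd.
  rewrite -(intD mu ihd iAd) -(intD mu i1 iBd) -(intD mu i2 iLd) -(intB mu iH i3).
  apply: eq_Rintegral => y _; rewrite diag_eq -/(H y mu).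
  by have := lin_eq y y mu; rewrite -/(A (y, y) mu) -/(B (y, _, y) mu); lra.
rewrite (intB mu iLx iLd).
have -> : \int[mu]_y (\sum_i jlz bar i x mu y * (df i (y, x) mu - df i (y, y) mu)) =
    (\int[mu]_y A (y, x) mu + \int[mu]_y \int[mu]_z B (y, z, x) mu)
    - (\int[mu]_y A (y, y) mu + \int[mu]_y \int[mu]_z B (y, z, z) mu).
  have [i1 <-] := int_barz mu x; have [i2 <-] := int_barz_diag mu.
  by rewrite -(intB mu i1 i2); apply: eq_Rintegral => y _; exact: barzB.
have [iK iK1 iK2 eK eK'] := creg_swap mu mu mu rK.
(* After the factor 1/2, the term [2 * H] cancels the excess coming from the diagonal. *)
have -> : \int[mu]_y tr2 (fun i j => jl2zw bar i j x mu y y) Sigma =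
    2 * \int[mu]_y H y mu + \int[mu]_y \int[mu]_w K (w, y) mu.
  have iH2 := aintZ 2 iH; rewrite -(intZ mu 2 iH) -(intD mu iH2 iK2).
  by apply: eq_Rintegral => y _; exact: barzz.
have rKs : creg (fun (a : E * E) m => K (a.2, a.1) m).
  by apply: (creg_comp _ rK); slope.
have [_ _ _ eKs eKs'] := creg_swap mu mu mu rKs.
have -> : \int[(p2prob mu \x p2prob mu)%E]_a
    tr2 (fun i j => kyz q i j (a.2, a.1, a.1) mu) Sigma =
    \int[mu]_y \int[mu]_w K (w, y) mu by exact: eKs.
have rB1 : creg (fun (a : E * E) m => B (a.2, a.1, a.2) m).
  by apply: (creg_comp _ rB); slope.
have rB2 : creg (fun (a : E * E) m => B (a.2, a.1, a.1) m).
  by apply: (creg_comp _ rB); slope.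
have [j1 _ _ e1 e1'] := creg_swap mu mu mu rB1.
have [j2 _ _ e2 e2'] := creg_swap mu mu mu rB2.
have -> : \int[(p2prob mu \x p2prob mu)%E]_a (\sum_i hy q i (a.2, a.1) mu
        * (df i (a.1, a.2) mu - df i (a.1, a.1) mu)) =
    \int[mu]_y \int[mu]_z B (y, z, y) mu - \int[mu]_y \int[mu]_z B (y, z, z) mu.
  rewrite -e1' -e2' -e1 -e2 -(RintegralB measurableT j1 j2).
  apply: eq_Rintegral => a _; rewrite /B -sumrB; apply: eq_bigr => i _.
  by rewrite mulrBr.
(* All terms in [ht], [A], [dL] and [H] cancel. What remains is a difference of two double integrals
   of [B] and half of that of [K], which are the source terms in the equation of M. *)
repeat match goal with |- context [Rintegral ?m ?D ?K] =>
  move: (Rintegral m D K) => ? end.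
by field.
Qed.
End corrector.

Section master_function.
Context {R : realType} {n n1 : nat}.
Local Notation E := 'cV[R]_n.
Local Notation E1 := 'cV[R]_n1.
Local Notation P := (P2 R n).
Implicit Types (mu m : P) (i j : 'I_n) (x y z w : E).
Variables (T : R) (UU : set E1) (Sigma Sigma0 : 'M[R]_n).
Hypotheses (symS : Sigma^T = Sigma) (symS0 : Sigma0^T = Sigma0).
Variables (f : E -> E1 -> P -> E) (L : E -> E1 -> P -> R) (g : E -> P -> R).
Variables (V : R -> E -> P -> R) (phi : R -> E -> P -> E1) (M : R -> P -> R).
Hypotheses (T0 : 0 < T) (A1 : assumptionA1 UU f).
Hypothesis H1 : assumptionH1 T UU Sigma Sigma0 f L g V phi.
Hypothesis H2 : assumptionH2 T f L g phi.
Hypothesis H3 : assumptionH3 T Sigma Sigma0 f V phi M.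

Local Notation fs := (fstar f phi).
Local Notation Ls := (Lstar L phi).
Local Notation S := (Sigma + Sigma0).
Let Ubar t mu := \int[mu]_y V t y mu.
Let U t x mu := V t x mu + M t mu
  + \int[mu]_y (lfd (V t y) mu x - lfd (V t y) mu y).

Let vb t := value_base V t.
Let vb_ok t : 0 <= t <= T -> base_ok (vb t).
Proof. exact: value_base_ok H1 t. Qed.

Let Mj t : jet (R := R) (n := n) := measure_jet (M t).

Let Mj_ok t : 0 <= t <= T -> jet_ok (Mj t).
Proof.
move=> t0T; apply: measure_jet_ok => m.
by have [_ ? ? ? ?] := H3_ex H3 m t0T.
Qed.

Let rfs t : 0 <= t <= T -> forall i, lreg (fun x m => fs t x m i 0).
Proof. by move=> t0T i; exact: (fstar_lreg A1 H1 i t0T). Qed.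

Let Mj_int t : 0 <= t <= T -> jet_int (fs t) S Sigma0 (Mj t).
Proof.
move=> t0T; have [Cl hl] := H3_lin H3; have [Cb hb] := H3_bounded H3.
apply: (jet_int_reg S Sigma0 (rfs t0T)) => /= [i _|i j _|i j _|i j _].
- have := jlreg_lin 0 i t0T (H3_dydM_cont H3) args_le1 (fun y m => hl t y m t0T).
  move=> /jlreg_lreg; set K := (X in lreg X -> _); set K' := (X in _ -> lreg X).
  suff -> : K = K' by [].
  by apply/funext => y; apply/funext => m; rewrite /K /K' mxE.
- have [|+ _] := jreg_bounded i j (C := Cb) t0T (H3_dyydM_cont H3).
    by move=> y m; have [] := hb t y 0 m t0T.
  move=> /jreg_creg; set K := (X in creg X -> _); set K' := (X in _ -> creg X).
  suff -> : K = K' by [].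
  by apply/funext => y; apply/funext => m; rewrite /K /K' mxE.
- exact: creg_cst.
- have [|+ _] := jreg_bounded i j (C := Cb) t0T (H3_dyzd2M_cont H3).
    by move=> [y z] m; have [] := hb t y z m t0T.
  move=> /jreg_creg.
  set K := (X in creg X -> _); set K' := (X in _ -> creg X).
  suff -> : K = K' by [].
  by apply/funext => -[y z]; apply/funext => m; rewrite /K /K' mxE.
Qed.

Let jA t := avg_jet (lin_family (vb t)).
Let jB t := avg_jet (diag_family (vb t)).
Let Uj t := jet_add (jet_add (value_jet (vb t)) (Mj t)) (jet_add (jA t) (jet_opp (jB t))).

Let Uj_ok t : 0 <= t <= T -> jet_ok (Uj t).
Proof.
move=> t0T; apply: jet_ok_add; first apply: jet_ok_add.
- exact/value_jet_ok/vb_ok.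
- exact: Mj_ok.
- apply: jet_ok_add; first exact/avg_jet_ok/lin_family_ok/vb_ok.
  exact/jet_ok_opp/avg_jet_ok/diag_family_ok/vb_ok.
Qed.

Let jA_int t : 0 <= t <= T -> jet_int (fs t) S Sigma0 (jA t).
Proof.
move=> t0T.
exact: (avg_jet_int (lin_family_ok (vb_ok t0T)) S (rfs t0T) symS0).
Qed.

Let jB_int t : 0 <= t <= T -> jet_int (fs t) S Sigma0 (jB t).
Proof.
move=> t0T.
exact: (avg_jet_int (diag_family_ok (vb_ok t0T)) S (rfs t0T) symS0).
Qed.

Let Uj_int t : 0 <= t <= T -> jet_int (fs t) S Sigma0 (Uj t).
Proof.
move=> t0T; apply: jet_int_add; first apply: jet_int_add.
- exact: (value_jet_int S Sigma0 (rfs t0T) (vb_ok t0T)).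
- exact: Mj_int.
- by apply: jet_int_add; [exact: jA_int|apply: jet_int_opp; exact: jB_int].
Qed.

Let aint_h t x mu : 0 <= t <= T ->
  aint (fun y => lfd (V t y) mu x) /\ aint (fun y => lfd (V t y) mu y).
Proof.
move=> t0T; have r := jreg_creg (rh (vb_ok t0T)).
have rp (p : E -> E * E) : slope1 p -> aint (fun y => h (vb t) (p y) mu).
  by move=> sp; exact: (creg_aint_comp mu sp r).
by split; [apply: (rp (fun y => (y, x)))|apply: (rp (fun y => (y, y)))]; slope.
Qed.

Let U_jet t : 0 <= t <= T -> U t = jF (Uj t).
Proof.
move=> t0T; apply/funext => x; apply/funext => mu.
have [i1 i2] := aint_h x mu t0T.
by rewrite /U (intB mu i1 i2).
Qed.

Let Mdt t mu := dt T (fun s => M s mu) t.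
Let Vdt t x mu := dt T (fun s => V s x mu) t.
Let Udt t x mu := Vdt t x mu + Mdt t mu
  + (\int[mu]_y value_lfd_dt T V t (y, x) mu - \int[mu]_y value_lfd_dt T V t (y, y) mu).

Let M_hasD t mu : 0 <= t <= T -> hasD `[0, T] (fun s => M s mu) t (Mdt t mu).
Proof. by move=> t0T; have [h _ _ _ _] := H3_ex H3 mu t0T; exact: h. Qed.

(** A constant [p] covers the average of delta_mu V(y; x), the identity that of delta_mu V(y; y). *)
Let int_hasD t mu (p : E -> E) : slope1 p -> 0 <= t <= T ->
  hasD `[0, T] (fun s => \int[mu]_y lfd (V s y) mu (p y)) t
    (\int[mu]_y value_lfd_dt T V t (y, p y) mu).
Proof.
move=> sp t0T; have sp2 : slope1 (fun y => (y, p y)) by apply: slope1_pair => //; slope.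
have [C C0 hC] := value_lfd_dt_bound H1.
have [_ [D D0 pD]] := sp2.
have I0 s : (`[0, T]%classic : set R) s = (0 <= s <= T) by rewrite /= in_itv.
apply: (@hasD_integral R _ _ (p2prob mu) `[0, T] (fun s y => lfd (V s y) mu (p y))
  (fun s y => value_lfd_dt T V s (y, p y) mu)
  (fun y => C * (1 + (2 * D ^+ 2 + 2 * `|y| ^+ 2) + mean mu ^+ 2))).
- exact: convex_itv.
- by rewrite I0.
- exact: limit_pt_itv.
- move=> s; rewrite I0 => s0T; have r := jreg_creg (rh (vb_ok s0T)).
  exact: (creg_aint_comp mu sp2 r mu).
- by move=> s y; rewrite I0 => s0T; exact: (value_lfd_hasD H1).
- have : aint (fun y : E => C * (1 + (2 * D ^+ 2 + 2 * `|y| ^+ 2) + mean mu ^+ 2)).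
    apply: aintZ; apply: aintD; last exact: aint_cst.
    apply: aintD; first exact: aint_cst.
    apply: aintD; first exact: aint_cst.
    by apply: aintZ; exact/qgrow_aint/qgrow_norm2.
  by apply.
- move=> s y; rewrite I0 => s0T; apply: (le_trans (hC s (y, p y) mu s0T)).
  rewrite ler_wpM2l// lerD2r lerD2l.
  apply: (@le_trans _ _ ((D + `|y|) ^+ 2)).
    by rewrite ler_sqr ?nnegrE ?addr_ge0//; exact: pD.
  by have := sqr_ge0 (D - `|y|); rewrite sqrrB sqrrD; lra.
Qed.

Let U_hasD t x mu : 0 <= t <= T -> hasD `[0, T] (fun s => U s x mu) t (Udt t x mu).
Proof.
move=> t0T; have t0T' : (`[0, T]%classic : set R) t by rewrite /= in_itv.
apply: hasDD.
  by apply: hasDD; [exact: (value_hasD H1)|exact: M_hasD].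
have hA : hasD `[0, T] (fun s => \int[mu]_y lfd (V s y) mu x) t
    (\int[mu]_y value_lfd_dt T V t (y, x) mu).
  by apply: (@int_hasD t mu (fun=> x)) => //; exact: slope1_cst.
have hB : hasD `[0, T] (fun s => \int[mu]_y lfd (V s y) mu y) t
    (\int[mu]_y value_lfd_dt T V t (y, y) mu).
  by apply: (@int_hasD t mu (fun y => y)) => //; exact: slope1_id.
apply: hasD_ext (hasDB hA hB) => // s; rewrite inE /= in_itv/= => s0T.
by have [i1 i2] := aint_h x mu s0T; rewrite -(intB mu i1 i2).
Qed.

Let Uwf t : 0 <= t <= T -> Lop_wf T fs Sigma Sigma0 U t.
Proof.
move=> t0T.
have hU x mu : exists l, hasD `[0, T] (fun s => U s x mu) t l.
  by exists (Udt t x mu); exact: U_hasD.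
exact: (jet_Lop_wf (Uj_ok t0T) (U_jet t0T) hU (Uj_int t0T)).
Qed.

Let bar t := avg_jet (value_family (vb t)).

Let bar_ok t : 0 <= t <= T -> jet_ok (bar t).
Proof. by move=> t0T; exact/avg_jet_ok/value_family_ok/vb_ok. Qed.

Let value_eq t x m : 0 <= t <= T ->
  Vdt t x m + jetL (fs t) S Sigma0 (value_jet (vb t)) x m + Ls t x m = 0.
Proof.
move=> t0T; have := H1_eq H1 x m t0T.
have hV : hasD `[0, T] (fun s => V s x m) t (Vdt t x m) by exact: (value_hasD H1).
have ok := value_jet_ok (vb_ok t0T).
by rewrite (jet_Lop fs Sigma Sigma0 T0 t0T ok (erefl _) hV).
Qed.

Let M_eq t x mu : 0 <= t <= T ->
  Mdt t mu + jetL (fs t) S Sigma0 (Mj t) x mu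
  + \int[(p2prob mu \x p2prob mu)%E]_a (\sum_i hy (vb t) i (a.2, a.1) mu
        * (drift_lfd f phi t i (a.1, a.2) mu - drift_lfd f phi t i (a.1, a.1) mu))
  + 2^-1 * \int[(p2prob mu \x p2prob mu)%E]_a
        tr2 (fun i j => kyz (vb t) i j (a.2, a.1, a.1) mu) Sigma = 0.
Proof.
move=> t0T; have := H3_eq H3 mu t0T.
rewrite (@jet_Lop R n T fs Sigma Sigma0 (fun s _ m => M s m) t (Mj t) T0 t0T
  (Mj_ok t0T) (erefl _) 0 mu _ (@M_hasD t mu t0T)).
(* The x-derivatives in the jet of M are zero, so the point 0 at which the equation of M is stated
   can be replaced by x. *)
have -> : jetL (fs t) S Sigma0 (Mj t) 0 mu = jetL (fs t) S Sigma0 (Mj t) x mu.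
  rewrite /jetL /= big1 => [|i _]; last by rewrite mul0r.
  by rewrite [X in _ = X + _ + _ + _ + _ + _]big1 => [|i _]; last by rewrite mul0r.
move=> e; rewrite -[RHS]e; congr (_ + _ + 2^-1 * _).
  apply: eq_Rintegral => -[y z] _; rewrite /rowapp mxE /=.
  by apply: eq_bigr => i _; rewrite /drift_lfd !mxE.
by apply: eq_Rintegral => -[y w] _; rewrite trE.
Qed.

Let rdf t i : 0 <= t <= T -> lreg (drift_lfd f phi t i).
Proof. exact: (drift_lfd_lreg H2). Qed.

(** Ubar is given a dummy space argument, which makes it the base function of the jet [bar t]. *)
Let gradbar t x x' mu y : 0 <= t <= T ->
  rowapp (grad (lfd (Ubar t) mu) y) (vlfd (fs t y) mu x' - vlfd (fs t y) mu y) =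
  \sum_i jlz (bar t) i x mu y *
     (drift_lfd f phi t i (y, x') mu - drift_lfd f phi t i (y, y) mu).
Proof.
move=> t0T; pose F (s : R) (_ : E) := Ubar s.
have Fb : F t = jF (bar t) by [].
rewrite -[lfd (Ubar t) mu]/(lfd (F t x) mu) (jet_gradl (bar_ok t0T) Fb) /rowapp mxE.
by apply: eq_bigr => i _; rewrite /drift_lfd !mxE.
Qed.

Let crossbar t x mu y : 0 <= t <= T ->
  \tr (cross (lfd2 (Ubar t) mu) y y *m Sigma) =
  tr2 (fun i j => jl2zw (bar t) i j x mu y y) Sigma.
Proof.
move=> t0T; pose F (s : R) (_ : E) := Ubar s.
have Fb : F t = jF (bar t) by [].
rewrite -[lfd2 (Ubar t) mu]/(lfd2 (F t x) mu) (jet_cross2 (bar_ok t0T) Fb) trE.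
by apply: eq_tr2 => i j; rewrite mxE.
Qed.

(** The final cancellation, isolated as linear arithmetic: the averaged corrector, the equation of M
    and the equation of V, in this order, add up to the master equation. *)
Let master_sum (a1 a2 vt ls mt kV kM kA kB I1 I2 I3 J1 J2 : R) :
  a1 - a2 + kA - kB + I1 + I2 + 2^-1 * I3 = J1 + 2^-1 * J2 ->
  mt + kM + J1 + 2^-1 * J2 = 0 -> vt + kV + ls = 0 ->
  0 = vt + mt + (a1 - a2) + (kV + kM + (kA + - kB)) + ls + I1 + I2 + 2^-1 * I3.
Proof. lra. Qed.

Lemma master_function_solves :
  solves_master_equation T fs Ls Sigma Sigma0 Ubar U.
Proof.
split.
- exact: Uwf.
- move=> t mu t0T.
  pose F (s : R) (_ : E) := Ubar s.
  have Fb : F t = jF (bar t) by [].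
  have e1 : lfd (Ubar t) mu = jl (bar t) 0 mu by rewrite -(jet_lfd (bar_ok t0T) Fb).
  have e2 : lfd2 (Ubar t) mu = jl2 (bar t) 0 mu by rewrite -(jet_lfd2 (bar_ok t0T) Fb).
  have okb := bar_ok t0T.
  split.
  + by exists (jl (bar t) 0 mu); exact: (okl okb 0 mu).
  + by rewrite e1 => z i; have [] := is_derive_D (oklz okb i 0 mu z).
  + move=> z; exists (jl2 (bar t) 0 mu z).
    have -> : (fun m => lfd (Ubar t) m z) = (fun m => jl (bar t) 0 m z).
      by apply/funext => m; rewrite -(jet_lfd okb Fb).
    exact: okl2.
  + rewrite e2; split=> [z w j|j w z i].
      by have [] := is_derive_D (okl2w okb j 0 mu z w).
    have -> : (fun z' => 'D_(Defs.basis j) (jl2 (bar t) 0 mu z') w) =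
        (fun z' => jl2w (bar t) j 0 mu z' w).
      by apply/funext => z'; have [] := is_derive_D (okl2w okb j 0 mu z' w).
    by have [] := is_derive_D (okl2zw okb i j 0 mu z w).
- by move=> t y mu t0T; split; [have [] := H2_L_ex H2 y mu t0T|have [] := H2_f_ex H2 y mu t0T].
- move=> t x mu t0T.
  have [i1 i2 i3] := master_terms_integrable (vb_ok t0T) symS (fun i => rdf i t0T)
    (cost_lfd_creg H2 t0T) x mu.
  split; first exact: i1.
  + by under eq_fun do rewrite (@gradbar t x x mu _ t0T); exact: i2.
  + by under eq_fun do rewrite (@crossbar t x mu _ t0T); exact: i3.
- move=> t x mu t0T.
  (* The running cost stands between the terms of the operator; moving it out lets the other seven
     terms fold into [Lop]. *)
  have reorder (a b c d e p r s u k o : R) :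
      a + b + c + d + e + p + r + s + u + k + o =
      (a + b + c + e + p + r + s) + d + u + k + o by ring.
  rewrite reorder -/(Lop T fs Sigma Sigma0 U t x mu).
  rewrite (jet_Lop fs Sigma Sigma0 T0 t0T (Uj_ok t0T) (U_jet t0T) (@U_hasD t x mu t0T)).
  have -> : \int[mu]_y (lfd (Ls t y) mu x - lfd (Ls t y) mu y) =
      \int[mu]_y (cost_lfd L phi t (y, x) mu - cost_lfd L phi t (y, y) mu).
    by apply: eq_Rintegral.
  have -> : \int[mu]_y rowapp (grad (lfd (Ubar t) mu) y)
      (vlfd (fs t y) mu x - vlfd (fs t y) mu y) =
      \int[mu]_y (\sum_i jlz (bar t) i x mu y *
        (drift_lfd f phi t i (y, x) mu - drift_lfd f phi t i (y, y) mu)).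
    by apply: eq_Rintegral => y _; exact: gradbar.
  have -> : \int[mu]_y \tr (cross (lfd2 (Ubar t) mu) y y *m Sigma) =
      \int[mu]_y tr2 (fun i j => jl2zw (bar t) i j x mu y y) Sigma.
    by apply: eq_Rintegral => y _; exact: crossbar.
  have corr := averaged_corrector (vb_ok t0T) symS symS0 (rfs t0T) (fun i => rdf i t0T)
    (fun i x m => is_lfd_drift H2 i x m t0T) (fun x m => is_lfd_value_dt T0 H1 x m t0T)
    (fun x m => is_lfd_cost H2 x m t0T) (fun x m => value_eq x m t0T)
    (value_lfd_dt_creg H1 t0T) (cost_lfd_creg H2 t0T) x mu.
  have hM := M_eq x mu t0T; have hV := value_eq x mu t0T.
  have iV := value_jet_int S Sigma0 (rfs t0T) (vb_ok t0T).
  have iB' := jet_int_opp (jB_int t0T).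
  rewrite (jetL_add x mu (jet_int_add iV (Mj_int t0T)) (jet_int_add (jA_int t0T) iB')).
  rewrite (jetL_add x mu iV (Mj_int t0T)) (jetL_add x mu (jA_int t0T) iB').
  rewrite (jetL_opp x mu (jB_int t0T)) /Udt.
  exact: master_sum corr hM hV.
Qed.

Lemma master_function_terminal x mu : U T x mu
  = g x mu + \int[mu]_y (lfd (g y) mu x - lfd (g y) mu y).
Proof.
(* The terminal condition is needed as an equality of functions of the measure, since it is
   substituted under a flat derivative. *)
have VT y : V T y = g y by apply/funext => m; exact: (H1_terminal H1).
rewrite /U (H1_terminal H1) (H3_terminal H3 mu) addr0; congr (_ + _).
by apply: eq_Rintegral => y _; rewrite VT.
Qed.

End master_function.

Theorem theorem3p6 (R : realType) (n n1 n2 n3 : nat) (T : R) (T_gt0 : 0 < T)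
    (UU : set 'cV[R]_n1) (UU_nonempty : UU !=set0) (UU_closed : closed UU)
    (sigma : 'M[R]_(n, n2)) (sigma0 : 'M[R]_(n, n3))
    (f : 'cV[R]_n -> 'cV[R]_n1 -> P2 R n -> 'cV[R]_n)
    (L : 'cV[R]_n -> 'cV[R]_n1 -> P2 R n -> R)
    (g : 'cV[R]_n -> P2 R n -> R)
    (V : R -> 'cV[R]_n -> P2 R n -> R)
    (phi : R -> 'cV[R]_n -> P2 R n -> 'cV[R]_n1)
    (M : R -> P2 R n -> R) :
  let Sigma := sigma *m sigma^T in
  let Sigma0 := sigma0 *m sigma0^T in
  assumptionA1 UU f ->
  assumptionA2 UU L g ->
  assumptionH1 T UU Sigma Sigma0 f L g V phi ->
  assumptionH2 T f L g phi ->
  assumptionH3 T Sigma Sigma0 f V phi M ->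
  let Ubar := fun t mu => \int[p2prob mu]_y V t y mu in
  let U := fun t x mu =>
    V t x mu + M t mu
    + \int[p2prob mu]_y (lfd (V t y) mu x - lfd (V t y) mu y) in
  solves_master_equation T (fstar f phi) (Lstar L phi) Sigma Sigma0 Ubar U /\
  (forall x mu,
    U T x mu
    = g x mu + \int[p2prob mu]_y (lfd (g y) mu x - lfd (g y) mu y)).
Proof.
move=> Sigma Sigma0 A1 _ H1 H2 H3 Ubar U.
have symS : Sigma^T = Sigma by rewrite /Sigma trmx_mul trmxK.
have symS0 : Sigma0^T = Sigma0 by rewrite /Sigma0 trmx_mul trmxK.
split.
  exact: (master_function_solves symS symS0 T_gt0 A1 H1 H2 H3).
by move=> x mu; exact: (master_function_terminal H1 H3).
Qed.
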